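(* Let $n\ge2$, $A_1,\dots,A_d\in\mathfrak{su}(n)$, and $\mathrm S_1\subseteq\{B_{ij}\}$, $\mathrm S_2\subseteq\{C_{ij}\}$, $\mathrm S_3\subseteq\{D_{ij}\}$ (all with $1\le i<j\le n$). Let $\mathscr G_{\rm drift}$ and $\mathscr G_{\rm contr}$ be the edge-colored multigraphs defined in the context, and suppose $\mathscr G_{\rm contr}$ is connected. Then the system $\dot X=\mathsf B_0X+(\sum_{i=1}^m u_i\mathsf B_i)X$ is structurally controllable on $\mathrm{SU}(n)$ with respect to the pair of zero patterns $\big(\Sigma_{\rm r}(\{A_1,\dots,A_d\}),\Sigma_{\rm f}(\mathrm S_1\cup\mathrm S_2\cup\mathrm S_3)\big)$ if and only if the union multigraph $\mathscr G_{\rm drift}\cup\mathscr G_{\rm contr}$ has a self-loop or a cycle containing an odd number of Red edges.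
   Context: $E_{ij}$ is the $n\times n$ matrix unit; $B_{ij}=E_{ij}-E_{ji}$, $C_{ij}=\mathrm i(E_{ij}+E_{ji})$, $D_{ij}=\mathrm i(E_{ii}-E_{jj})$, where $\mathrm i$ is the imaginary unit. $\mathfrak{su}(n)$ (traceless skew-Hermitian matrices, a real Lie algebra) is the Lie algebra of $\mathrm{SU}(n)$. For a finite subset $\{g_s\}$ of a real Lie algebra, $\Sigma_{\rm f}(\{g_s\})=\{\sum l_sg_s:l_s\in\mathbb R\}$, $\Sigma_{\rm r}(\{g_s\})=\{\sum l_sg_s:l_s\in\mathbb R,l_s\ne0\ \forall s\}$. An edge-colored multigraph on $\mathrm V=\{1,\dots,n\}$ has edges $\{i,j;c\}$ with color $c\in\{\text{Blue},\text{Red},\text{Green}\}$; $\{i,i;c\}$ is a self-loop; edges with the same endpoints but different colors are distinct. $\mathscr G_{\rm drift}$ has: a Blue edge $\{i,j\}$ ($i\ne j$) iff $\mathrm{Re}([A_s]_{ij})=-\mathrm{Re}([A_s]_{ji})\ne0$ for some $s$; a Red edge $\{i,j\}$ ($i\neq j$) iff $\mathrm{Im}([A_s]_{ij})=\mathrm{Im}([A_s]_{ji})\neq0$ for some $s$; a Green self-loop $\{i,i\}$ iff $[A_s]_{ii}\ne0$ for some $s$. $\mathscr G_{\rm contr}$ has a Blue edge $\{i,j\}$ for each $B_{ij}\in\mathrm S_1$, a Red edge $\{i,j\}$ for each $C_{ij}\in\mathrm S_2$, and Green self-loops $\{i,i\}$ and $\{j,j\}$ for each $D_{ij}\in\mathrm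 S_3$. The union has node set $\mathrm V$ and the union of edge sets. A walk is an alternating sequence of nodes and edges with consecutive endpoints; a cycle is a closed walk; a multigraph is connected if any two nodes are joined by a walk. (E.g. a Blue and a Red edge with the same endpoints form a cycle with an odd number of Red edges.) For $\dot X=\mathsf B_0X+(\sum_{i=1}^m u_i\mathsf B_i)X$ on $\mathrm{SU}(n)$ (piecewise continuous real controls), the system is controllable if every element of $\mathrm{SU}(n)$ is reachable from $X(0)=I$ at some time $T\ge0$; it is structurally controllable w.r.t. $(\Sigma_{\rm r}(\mathfrak g_\alpha),\Sigma_{\rm f}(\mathfrak g_\beta))$ if there exist $m\ge1$, $\mathsf B_0\in\Sigma_{\rm r}(\mathfrak g_\alpha)$, $\mathsf B_1,\dots,\mathsf B_m\in\Sigma_{\rm f}(\mathfrak g_\beta)$ making it controllable. *)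

(* Defs.v *)
From HB Require Import structures.
From mathcomp Require Import all_boot all_order all_algebra.
From mathcomp Require Import all_classical all_reals all_analysis.
From mathcomp Require Import complex.
Set Implicit Arguments. Unset Strict Implicit. Unset Printing Implicit Defensive.
Import Order.TTheory GRing.Theory Num.Theory.
Import numFieldNormedType.Exports.
Local Open Scope classical_set_scope.
Local Open Scope ring_scope.

Inductive color := Blue | Red | Green.

Section Defs.
Variable R : realType.
Local Notation C := R[i].

Definition Emx {n : nat} (i j : 'I_n) : 'M[C]_n := delta_mx i j.
Definition Bmx {n : nat} (i j : 'I_n) : 'M[C]_n := Emx i j - Emx j i.
Definition Cmx {n : nat} (i j : 'I_n) : 'M[C]_n := 'i%C *: (Emx i j + Emx j i).
Definition Dmx {n : nat} (i j : 'I_n) : 'M[C]_n := 'i%C *: (Emx i i - Emx j j).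

Definition mx_adj {n : nat} (A : 'M[C]_n) : 'M[C]_n := (map_mx (@conjc R) A)^T.
Definition in_su (n : nat) (A : 'M[C]_n) : Prop := mx_adj A = - A /\ \tr A = 0.
Definition in_SU (n : nat) (X : 'M[C]_n) : Prop := mx_adj X *m X = 1%:M /\ \det X = 1.

(** Sigma_f and Sigma_r of a finite subset {g_s} (given as a list; duplicates
    are removed, so the notions only depend on the underlying set). *)
Definition real_comb {n : nat} (gs : seq 'M[C]_n) (l : nat -> R) : 'M[C]_n :=
  \sum_(k < size gs) ((l k)%:C)%C *: gs`_k.
Definition Sigma_f {n : nat} (gs : seq 'M[C]_n) : set 'M[C]_n :=
  [set M | exists l : nat -> R, M = real_comb (undup gs) l].
Definition Sigma_r {n : nat} (gs : seq 'M[C]_n) : set 'M[C]_n :=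
  [set M | exists l : nat -> R, (forall k, (k < size (undup gs))%N -> l k != 0) /\
                                M = real_comb (undup gs) l].

(** Edge-colored multigraphs on V = 'I_n: a graph is the (symmetric) predicate
    [g c i j] meaning "the edge {i,j;c} is present". *)
Definition cgraph (n : nat) := color -> 'I_n -> 'I_n -> Prop.

Definition graph_union {n : nat} (g1 g2 : cgraph n) : cgraph n :=
  fun c i j => g1 c i j \/ g2 c i j.

Fixpoint walk {n : nat} (g : cgraph n) (x : 'I_n) (w : seq (color * 'I_n * 'I_n))
    (y : 'I_n) : Prop :=
  match w with
  | [::] => x = y
  | (c, a, b) :: w' => a = x /\ g c a b /\ walk g b w' y
  end.

Definition connected_graph {n : nat} (g : cgraph n) : Prop :=
  forall x y : 'I_n, exists w, walk g x w y.

Definition has_self_loop {n : nat} (g : cgraph n) : Prop :=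
  exists c x, g c x x.

Definition num_red {n : nat} (w : seq (color * 'I_n * 'I_n)) : nat :=
  count (fun e : color * 'I_n * 'I_n => if e.1.1 is Red then true else false) w.

Definition has_odd_red_cycle {n : nat} (g : cgraph n) : Prop :=
  exists (x : 'I_n) (w : seq (color * 'I_n * 'I_n)), walk g x w x /\ odd (num_red w).

Definition G_drift {n d : nat} (A : 'I_d -> 'M[C]_n) : cgraph n :=
  fun c i j => match c with
  | Blue => i <> j /\ exists s, @complex.Re R (A s i j) = - @complex.Re R (A s j i) /\ @complex.Re R (A s i j) <> 0
  | Red => i <> j /\ exists s, @complex.Im R (A s i j) = @complex.Im R (A s j i) /\ @complex.Im R (A s i j) <> 0
  | Green => i = j /\ exists s, A s i i <> 0
  end.

(** The control graph of S1 (B_ij), S2 (C_ij), S3 (D_ij), each given by the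
    set of index pairs (i,j) with i < j. *)
Definition G_contr {n : nat} (S1 S2 S3 : {set 'I_n * 'I_n}) : cgraph n :=
  fun c i j => match c with
  | Blue => (i, j) \in S1 \/ (j, i) \in S1
  | Red => (i, j) \in S2 \/ (j, i) \in S2
  | Green => i = j /\ exists k, (i, k) \in S3 \/ (k, i) \in S3
  end.

Definition ctrl_mats {n : nat} (S1 S2 S3 : {set 'I_n * 'I_n}) : seq 'M[C]_n :=
  [seq Bmx p.1 p.2 | p <- enum S1] ++ [seq Cmx p.1 p.2 | p <- enum S2]
  ++ [seq Dmx p.1 p.2 | p <- enum S3].

Definition piecewise_continuous (T : R) (u : R -> R) : Prop :=
  (exists bad : seq R, forall t, 0 < t < T -> t \notin bad -> {for t, continuous u}) /\
  (forall t, 0 <= t < T -> exists l : R, u x @[x --> t^'+] --> l) /\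
  (forall t, 0 < t <= T -> exists l : R, u x @[x --> t^'-] --> l).

Definition mx_has_deriv {n : nat} (X : R -> 'M[C]_n) (t : R) (D : 'M[C]_n) : Prop :=
  forall i j, is_derive t 1 (fun s => @complex.Re R (X s i j)) (@complex.Re R (D i j)) /\
              is_derive t 1 (fun s => @complex.Im R (X s i j)) (@complex.Im R (D i j)).

Definition mx_continuous_on {n : nat} (X : R -> 'M[C]_n) (a b : R) : Prop :=
  forall i j, {within `[a, b], continuous (fun s => @complex.Re R (X s i j))} /\
              {within `[a, b], continuous (fun s => @complex.Im R (X s i j))}.

Definition is_solution {n m : nat} (B0 : 'M[C]_n) (Bs : 'I_m -> 'M[C]_n)
    (u : 'I_m -> R -> R) (T : R) (X : R -> 'M[C]_n) : Prop :=
  X 0 = 1%:M /\ mx_continuous_on X 0 T /\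
  exists bad : seq R, forall t, 0 < t < T -> t \notin bad ->
    mx_has_deriv X t ((B0 + \sum_(k < m) ((u k t)%:C)%C *: Bs k) *m X t).

Definition reachable {n m : nat} (B0 : 'M[C]_n) (Bs : 'I_m -> 'M[C]_n)
    (Y : 'M[C]_n) : Prop :=
  exists (T : R) (u : 'I_m -> R -> R) (X : R -> 'M[C]_n),
    0 <= T /\ (forall k, piecewise_continuous T (u k)) /\
    is_solution B0 Bs u T X /\ X T = Y.

Definition controllable {n m : nat} (B0 : 'M[C]_n) (Bs : 'I_m -> 'M[C]_n) : Prop :=
  forall Y : 'M[C]_n, in_SU Y -> reachable B0 Bs Y.

Definition structurally_controllable {n : nat} (drift_pat ctrl_pat : set 'M[C]_n) : Prop :=
  exists (m : nat) (B0 : 'M[C]_n) (Bs : 'I_m -> 'M[C]_n),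
    (1 <= m)%N /\ drift_pat B0 /\ (forall k, ctrl_pat (Bs k)) /\ controllable B0 Bs.

End Defs.

(* Main.v *)
Require Import Defs.
From HB Require Import structures.
From mathcomp Require Import all_boot all_order all_algebra.
From mathcomp Require Import all_classical all_reals all_analysis.
From mathcomp Require Import complex ring lra.
Set Implicit Arguments. Unset Strict Implicit. Unset Printing Implicit Defensive.
Import Order.TTheory GRing.Theory Num.Theory.
Import numFieldNormedType.Exports.
Local Open Scope classical_set_scope.
Local Open Scope ring_scope.

(** Necessity: without self-loops and odd-red cycles the connected graph has a
    [Z/2]-potential [p], and conjugating by the diagonal matrix with entries
    [1] or [i] according to [p] makes every admissible generator real and
    skew-symmetric; the sum of the squared imaginary parts of the gauged
    solution is then conserved, so [diag(i, -i, 1, ..., 1)] is not reachable.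

    Sufficiency: let [S] be the monoid of products of flows [exp (t N)], [t >= 0],
    with [N = B0 + sum_k v_k B_k].  Its closure in the compact group [SU(n)] is
    a group, whose tangent vectors form a real Lie algebra (Trotter formula,
    derivative of [Ad]).  With [z E_ij - z^* E_ji] written [Xmx i j z], the
    identities [[X_ij z, X_jk w] = X_ik (z w)] and
    [(ad X ^ 4 + ad X ^ 2) B = 6 (P B P + X B X)] show that this Lie algebra is
    [su(n)] when the drift is incompatible with the potentials of the control
    graph, so [S] is dense.  Density also lets one choose a product of flows whose
    time derivatives span [su(n)]; completing it by Hermitian and scalar factors
    gives a map of the matrix space into itself with strict derivative the
    identity, hence (contraction) [S] has an interior point in [SU(n)], and a
    dense submonoid with an interior point is the whole group. *)

(** * Generation of su(n) *)

Section LieGeneration.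
Variables (R : realType) (n : nat).
Local Notation C := R[i].
Implicit Types (L : 'M[C]_n -> Prop) (A B M : 'M[C]_n) (i j k l : 'I_n) (z w : C).

(** The drift cannot be run backwards, so only a semigroup is available. Its closure acquires
    inverses by recurrence: by pigeonhole some positive power of a unitary matrix returns near the
    identity, and the power just before it approximates the inverse. Density alone does not settle
    exact reachability, whence the interior point. It is found in the flat space of all matrices,
    without charts on [SU(n)]: a surjectivity theorem is proved there, and for targets in [SU(n)]
    the auxiliary Hermitian and scalar factors are shown to be trivial.

    The polynomial in [ad X] comes from its spectrum. As [X] has eigenvalues among 0, i, -i, [ad X]
    has eigenvalues among 0, i, -i, 2i, -2i; [t^4 + t^2] vanishes at the first three and equals 12
    at the last two. What remains of a drift is its part in one 2x2 block, which exposes a missing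
    direction.

    One drift must defeat every potential of the control graph. By connectedness two potentials
    differ at most by a global flip, so a single bad entry serves them all. *)

Definition bracket A B := A *m B - B *m A.

Lemma bracketDr A B M : bracket A (B + M) = bracket A B + bracket A M.
Proof. by rewrite /bracket mulmxDl mulmxDr opprD addrACA. Qed.

Lemma bracketZr A z B : bracket A (z *: B) = z *: bracket A B.
Proof. by rewrite /bracket -scalemxAl -scalemxAr scalerBr. Qed.

Definition real_lie_algebra L :=
  [/\ forall A B, L A -> L B -> L (A + B),
      forall (a : R) A, L A -> L (a%:C%C *: A) &
      forall A B, L A -> L B -> L (bracket A B)].

(** At [i = j] this is the diagonal matrix [2 i Im(z) E_ii], which lets [su_decomposition] sum over
    all ordered pairs. *)
Definition Xmx i j z : 'M[C]_n := z *: delta_mx i j - z^*%C *: delta_mx j i.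

Lemma XmxBmx i j : Xmx i j 1 = Bmx R i j.
Proof. by rewrite /Xmx conjc1 !scale1r. Qed.

Lemma XmxCmx i j : Xmx i j 'i%C = Cmx R i j.
Proof.
rewrite /Xmx /Cmx /Emx scalerDr; congr (_ + _).
by rewrite -scaleNr; congr (_ *: _); simpc.
Qed.

Lemma Xmx_sym i j z : Xmx i j z = Xmx j i (- z^*%C).
Proof. by rewrite /Xmx rmorphN /= conjcK !scaleNr opprK addrC. Qed.

Lemma XmxD i j z w : Xmx i j (z + w) = Xmx i j z + Xmx i j w.
Proof. by rewrite /Xmx rmorphD !scalerDl opprD addrACA. Qed.

Lemma XmxZ i j (a : R) z : Xmx i j (a%:C%C * z) = a%:C%C *: Xmx i j z.
Proof. by rewrite /Xmx rmorphM /= oppr0 scalerBr !scalerA. Qed.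

Lemma mul_scaled_delta i j k l z w :
  (z *: delta_mx i j : 'M[C]_n) *m (w *: delta_mx k l)
  = ((z * w) *+ (j == k)) *: delta_mx i l.
Proof.
rewrite -scalemxAl -scalemxAr scalerA mul_delta_mx_cond.
by case: eqP => _; rewrite ?mulr0n ?mulr1n ?scaler0 ?scale0r.
Qed.

Lemma bracket_Xmx i j k z w : i != j -> j != k -> i != k ->
  bracket (Xmx i j z) (Xmx j k w) = Xmx i k (z * w).
Proof.
move=> ij jk ik; rewrite /bracket /Xmx !mulmxBl !mulmxBr !mul_scaled_delta.
rewrite !eqxx (eq_sym k j) (eq_sym j i) (eq_sym k i).
rewrite (negPf ij) (negPf jk) (negPf ik) !mulr0n !mulr1n !scale0r.
by rewrite !subr0 !sub0r !opprK rmorphM [_^*%C * _]mulrC.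
Qed.

Lemma bracket_Xmx_opp i j z w : i != j ->
  bracket (Xmx i j z) (Xmx j i w) = (2 * complex.Im (z * w))%:C%C *: Dmx R i j.
Proof.
move=> ij; rewrite /bracket /Xmx !mulmxBl !mulmxBr !mul_scaled_delta.
rewrite !eqxx (eq_sym j i) (negPf ij) !mulr0n !mulr1n !scale0r /Dmx /Emx scalerA.
have -> : (2 * complex.Im (z * w))%:C%C * 'i%C = z * w - (z * w)^*%C.
  by rewrite subcJ rmorphM rmorph_nat.
by rewrite rmorphM /=; apply/matrixP=> a b; rewrite !mxE; ring.
Qed.

(** Both matrix units factor through 1x1 matrices, and the inner product is the scalar [A j k]. *)
Lemma mul_delta_mul i j k l A :
  delta_mx i j *m A *m delta_mx k l = A j k *: delta_mx i l.
Proof.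
rewrite -(mul_delta_mx (0 : 'I_1) i j) -(mul_delta_mx (0 : 'I_1) k l).
rewrite -!mulmxA [A *m _]mulmxA [delta_mx 0 j *m _]mulmxA [delta_mx 0 j *m _]mulmxA.
rewrite -rowE -colE (_ : col k _ = (A j k)%:M); last first.
  by apply/matrixP=> a b; rewrite !ord1 !mxE eqxx mulr1n.
by rewrite mul_scalar_mx -scalemxAr mul_delta_mx.
Qed.

Lemma bracket_Dmx_Xmx i j z : i != j ->
  bracket (Dmx R i j) (Xmx i j z) = Xmx i j (2 * 'i%C * z).
Proof.
move=> ij; rewrite /bracket /Xmx /Dmx /Emx scalerBr.
rewrite !mulmxBl !mulmxBr !mul_scaled_delta.
rewrite !eqxx (eq_sym j i) (negPf ij) !mulr0n !mulr1n !scale0r.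
have -> : (2 * 'i * z)^*%C = - (2 * 'i%C * z^*%C).
  by rewrite !rmorphM rmorph_nat /= -mulNr -mulrN; congr (_ * _ * _); simpc.
by apply/matrixP=> a b; rewrite !mxE; ring.
Qed.

Lemma XmxN i j z : Xmx i j (- z) = - Xmx i j z.
Proof. by rewrite /Xmx rmorphN /= !scaleNr opprK opprB addrC. Qed.

Lemma Dmxx i : Dmx R i i = 0.
Proof. by rewrite /Dmx subrr scaler0. Qed.

(** Each off-diagonal entry is met from both of its ordered pairs, hence the factor 2. Because the
    trace vanishes, the [E_ii] contributions of the [Dmx a i] cancel, so one reference index [i] is
    enough for the diagonal. *)
Lemma su_decomposition i M : in_su M -> (2 : R)%:C%C *: M =
  \sum_a (\sum_(b | b != a) Xmx a b (M a b)
          + (2 * complex.Im (M a a))%:C%C *: Dmx R a i).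
Proof.
move=> [Mskew Mtr].
have MJ a b : - (M a b)^*%C = M b a.
  by have /matrixP/(_ b a) := Mskew; rewrite !mxE => ->; rewrite opprK.
have Mii a : M a a = 'i%C * (complex.Im (M a a))%:C%C.
  rewrite {1}[M a a]complexE; have := MJ a a; case: (M a a) => r s /= [/eqP].
  by rewrite eq_sym -addr_eq0 -mulr2n mulrn_eq0 /= => /eqP ->; rewrite add0r.
have ImMtr : \sum_a complex.Im (M a a) = 0.
  have : 'i%C * (\sum_a complex.Im (M a a))%:C%C = 0.
    by rewrite rmorph_sum mulr_sumr -[RHS]Mtr; apply: eq_bigr => a _; rewrite -Mii.
  move/eqP; rewrite mulf_eq0 => /orP[/eqP[]|/eqP[]//].
  by move/eqP; rewrite oner_eq0.
rewrite big_split /=.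
have -> : \sum_a (2 * complex.Im (M a a))%:C%C *: Dmx R a i
    = \sum_a Xmx a a (M a a).
  rewrite /Dmx /Emx.
  under eq_bigr do rewrite !scalerBr.
  rewrite sumrB -scaler_suml; under [X in _ - X *: _]eq_bigr do rewrite rmorphM.
  rewrite /= -mulr_sumr -rmorph_sum ImMtr rmorph0 mulr0 scale0r subr0.
  apply: eq_bigr => a _; rewrite /Xmx -scalerBl scalerA; congr (_ *: _).
  by rewrite subcJ rmorphM rmorph_nat.
rewrite addrC -big_split /=.
have -> : \sum_a (Xmx a a (M a a) + \sum_(b | b != a) Xmx a b (M a b))
    = \sum_a \sum_b Xmx a b (M a b).
  by apply: eq_bigr => a _; rewrite [RHS](bigD1 a).
rewrite /Xmx.
under eq_bigr do rewrite big_split /=.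
rewrite big_split /= -matrix_sum_delta exchange_big /=.
under [X in _ + X]eq_bigr => a _ do under eq_bigr => b _ do rewrite -scaleNr MJ.
by rewrite -matrix_sum_delta rmorph_nat scaler_nat mulr2n.
Qed.

Section Block.
Variables (L : 'M[C]_n -> Prop) (HL : real_lie_algebra L).

Lemma lieD A B : L A -> L B -> L (A + B). Proof. by case: HL => H _ _; apply: H. Qed.
Lemma lieZ (a : R) A : L A -> L (a%:C%C *: A).
Proof. by case: HL => _ H _; apply: H. Qed.
Lemma lie_bracket A B : L A -> L B -> L (bracket A B).
Proof. by case: HL => _ _; apply. Qed.
Lemma lieB A B : L A -> L B -> L (A - B).
Proof.
move=> LA LB; have := lieZ (-1) LB; rewrite rmorphN1 scaleN1r.
exact: lieD.
Qed.
Lemma lieZK (a : R) A : a != 0 -> L (a%:C%C *: A) -> L A.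
Proof.
move=> a0 /(lieZ a^-1); rewrite scalerA -rmorphM mulVf //.
by rewrite rmorph1 scale1r.
Qed.

(* [P B P + X B X] is [(ad X ^ 4 + ad X ^ 2) B / 6] as soon as [X ^ 2 = - P]
   for a projection [P]: the other eigenspaces of [ad X] are killed. *)
Lemma lie_block A P B : A *m A = - P -> P *m A = A -> A *m P = A -> P *m P = P ->
  L A -> L B -> L (P *m B *m P + A *m B *m A).
Proof.
move=> AA PA AP PP LA LB.
pose ad2 M := bracket A (bracket A M).
have ad2E M : ad2 M = - (P *m M) - (A *m M *m A) *+ 2 - M *m P.
  rewrite /ad2 /bracket mulmxBr mulmxBl !mulmxA AA mulNmx.
  rewrite -[M *m A *m A]mulmxA AA mulmxN opprB addrACA.
  by apply/matrixP => a b; rewrite !mxE; ring.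
have L2 M : L M -> L (ad2 M) by move=> ?; apply: lie_bracket => //; apply: lie_bracket.
have := lieD (L2 _ (L2 _ LB)) (L2 _ LB).
have -> : ad2 (ad2 B) + ad2 B = 6%:R%:C%C *: (P *m B *m P + A *m B *m A).
  rewrite {1}ad2E ad2E.
  rewrite !(mulmxBl, mulmxBr, mulmxDl, mulmxDr, mulmxN, mulNmx, mulmxA, mulr2n).
  rewrite !(PP, PA, AP, AA, mulNmx, mulmxN).
  rewrite -!(mulmxA _ A A) -!(mulmxA _ P P) -!(mulmxA _ A P) -!(mulmxA _ P A).
  rewrite !(PP, PA, AP, AA, mulNmx, mulmxN).
  by rewrite rmorph_nat; apply/matrixP => a b; rewrite !mxE; ring.
by apply: lieZK; rewrite pnatr_eq0.
Qed.

(** [lie_block] with [P] the projection onto the coordinates [i] and [j]. Inside the block,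
    [P B P + X B X] kills the components of [B] along [i P] and along [X], which commute with [X],
    and doubles the components along [Dmx i j] and [Xmx i j (i z)], which anticommute with it. *)
Lemma lie_Xmx_block i j z B : i != j -> z * z^*%C = 1 -> in_su B ->
  L (Xmx i j z) -> L B ->
  L ((complex.Im (B i i) - complex.Im (B j j))%:C%C *: Dmx R i j
     + (2 * complex.Im (z^*%C * B i j))%:C%C *: Xmx i j ('i%C * z)).
Proof.
move=> ij zz HB LX LB; set P : 'M[C]_n := delta_mx i i + delta_mx j j.
have ij' : (i == j) = false by exact: negPf.
have PE : P = 1 *: delta_mx i i + 1 *: delta_mx j j by rewrite !scale1r.
have XX : Xmx i j z *m Xmx i j z = - P.
  rewrite /Xmx PE !mulmxBl !mulmxBr !mul_scaled_delta !eqxx (eq_sym j i) ij'.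
  rewrite !mulr0n !mulr1n !scale0r zz mulrC zz.
  by apply/matrixP=> a b; rewrite !mxE; ring.
have PX : P *m Xmx i j z = Xmx i j z.
  rewrite /Xmx PE !mulmxDl !mulmxBr !mul_scaled_delta !eqxx (eq_sym j i) ij'.
  rewrite !mulr0n !mulr1n !scale0r !mul1r.
  by apply/matrixP=> a b; rewrite !mxE; ring.
have XP : Xmx i j z *m P = Xmx i j z.
  rewrite /Xmx PE !mulmxDr !mulmxBl !mul_scaled_delta !eqxx (eq_sym j i) ij'.
  rewrite !mulr0n !mulr1n !scale0r !mulr1.
  by apply/matrixP=> a b; rewrite !mxE; ring.
have PP : P *m P = P.
  rewrite PE !mulmxDr !mulmxDl !mul_scaled_delta !eqxx (eq_sym j i) ij'.
  rewrite !mulr0n !mulr1n !scale0r !mulr1.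
  by apply/matrixP=> a b; rewrite !mxE; ring.
have := lie_block XX PX XP PP LX LB; congr L.
have Bskew a b : B b a = - (B a b)^*%C.
  by have [/matrixP/(_ b a) + _] := HB; rewrite !mxE => ->; rewrite opprK.
have BIm a : B a a = 'i%C * (complex.Im (B a a))%:C%C.
  rewrite {1}[B a a]complexE; have := Bskew a a; case: (B a a) => r s /= [/eqP].
  by rewrite -addr_eq0 -mulr2n mulrn_eq0 /= => /eqP -> _; rewrite add0r.
move: (BIm i) (BIm j); set r1 := complex.Im (B i i); set r2 := complex.Im (B j j).
move=> h1 h2; rewrite /P /Xmx !(mulmxDl, mulmxDr, mulmxBl, mulmxBr, mulNmx, mulmxN).
rewrite -!(scalemxAl, scalemxAr) !mul_delta_mul /Dmx /Emx.
rewrite (Bskew i j) h1 h2 rmorphM rmorph_nat rmorphB /=.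
have E2 : 2 * (complex.Im (z^*%C * B i j))%:C%C * 'i%C = z^*%C * B i j - z * (B i j)^*%C.
  by rewrite -subcJ rmorphM /= conjcK.
have Ei : ('i * z)^*%C = - ('i%C * z^*%C) by rewrite rmorphM /= -mulNr; congr (_ * _); simpc.
have e1 : 2 * (complex.Im (z^*%C * B i j))%:C%C * ('i%C * z) = B i j - z * z * (B i j)^*%C.
  by rewrite mulrA E2; ring: zz.
have e2 : 2 * (complex.Im (z^*%C * B i j))%:C%C * (- ('i%C * z^*%C))
    = (B i j)^*%C - z^*%C * z^*%C * B i j.
  by rewrite mulrN mulrA E2; ring: zz.
rewrite [_ *: (_ - _ *: delta_mx j i)]scalerBr !scalerA Ei e1 e2.
apply/matrixP=> a b; rewrite !mxE.
by ring: zz.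
Qed.

(** [ad X / 2] is a quarter turn of the plane spanned by [Dmx i j] and [Xmx i j (i z)]. A nonzero
    [V] and its image therefore span the plane, and this combination isolates [Dmx i j]. *)
Lemma bracket_Xmx_block i j z (a c : R) : i != j -> z * z^*%C = 1 ->
  let V := a%:C%C *: Dmx R i j + c%:C%C *: Xmx i j ('i%C * z) in
  a%:C%C *: V + (c / 2)%:C%C *: bracket (Xmx i j z) V = (a ^+ 2 + c ^+ 2)%:C%C *: Dmx R i j.
Proof.
move=> ij zz V.
have bD : bracket (Xmx i j z) (Dmx R i j) = - (2 : R)%:C%C *: Xmx i j ('i%C * z).
  rewrite scaleNr -XmxZ mulrA rmorph_nat -bracket_Dmx_Xmx //.
  by rewrite /bracket opprB.
have bX : bracket (Xmx i j z) (Xmx i j ('i%C * z)) = (2 : R)%:C%C *: Dmx R i j.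
  rewrite [Xmx i j ('i%C * z)]Xmx_sym bracket_Xmx_opp //.
  have -> : z * - ('i * z)^*%C = 'i%C.
    have -> : ('i * z)^*%C = - 'i%C * z^*%C by rewrite rmorphM; congr (_ * _); simpc.
    by ring: zz.
  by rewrite mulr1.
have bV : bracket (Xmx i j z) V
    = a%:C%C *: bracket (Xmx i j z) (Dmx R i j)
      + c%:C%C *: bracket (Xmx i j z) (Xmx i j ('i%C * z)).
  by rewrite /V bracketDr !bracketZr.
rewrite bV bD bX /V.
have -> : (a ^+ 2 + c ^+ 2)%:C%C = a%:C%C ^+ 2 + c%:C%C ^+ 2 :> C.
  by rewrite rmorphD !rmorphXn.
have -> : (c / 2)%:C%C = c%:C%C / 2 :> C by rewrite rmorphM fmorphV rmorph_nat.
rewrite rmorph_nat.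
move: (Xmx _ _ _) (Dmx _ _ _) => X D.
by apply/matrixP => k l; rewrite !mxE; field.
Qed.
End Block.
End LieGeneration.

(** * Potentials of colored graphs *)

Section Potentials.
Variables (R : realType) (n : nat).
Implicit Types (g : cgraph n) (p : 'I_n -> bool) (i j x y : 'I_n).

(** Green is excluded outright: a diagonal entry of a skew-Hermitian matrix is imaginary, and
    conjugation by a diagonal unitary matrix leaves it unchanged. *)
Definition potential g p := forall c i j, g c i j ->
  match c with Blue => p i = p j | Red => p i = ~~ p j | Green => False end.

Lemma potential_walk g p x w y : potential g p -> walk g x w y ->
  odd (num_red w) = p x (+) p y.
Proof.
move=> gp; elim: w x => [x /= -> |[[c a] b] w IH x /=]; first by rewrite addbb.
case=> -> [/gp gxb /IH]; rewrite oddD => ->.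
by case: c gxb => //= ->; case: (p b); case: (p y).
Qed.

(** Up to sign, the imaginary part of the entry after the gauge attached to [p] (see [gauge_off]):
    it measures how far [M] is from becoming real. *)
Definition off_part p i j (M : 'M[R[i]]_n) : R :=
  if p i == p j then complex.Im (M i j) else complex.Re (M i j).

End Potentials.

(** * Lie algebras containing the controls of a connected graph *)

Section ControlLieAlgebra.
Local Opaque Xmx Dmx Bmx Cmx bracket.
Variables (R : realType) (n : nat).
Local Notation C := R[i].
Variables (S1 S2 S3 : {set 'I_n * 'I_n}).
Hypotheses (hn : (2 <= n)%N)
  (hS1 : forall p, p \in S1 -> (p.1 < p.2)%N)
  (hS2 : forall p, p \in S2 -> (p.1 < p.2)%N)
  (hS3 : forall p, p \in S3 -> (p.1 < p.2)%N)
  (hconn : connected_graph (G_contr S1 S2 S3)).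
Variables (L : 'M[C]_n -> Prop) (HL : real_lie_algebra L).
Hypotheses (LS1 : forall i j, (i, j) \in S1 -> L (Bmx R i j))
  (LS2 : forall i j, (i, j) \in S2 -> L (Cmx R i j))
  (LS3 : forall i j, (i, j) \in S3 -> L (Dmx R i j)).
Implicit Types (i j k l x y : 'I_n) (z w : C).

Let Lz i j z := L (Xmx i j z).
(** The phase of a Blue ([true]) or Red ([false]) direction. Up to sign, multiplying phases is [==]
    on the booleans. *)
Let u (b : bool) : C := if b then 1 else 'i%C.

Local Lemma LzN i j z : Lz i j z -> Lz i j (- z).
Proof.
by move=> /(lieZ HL (-1)); rewrite rmorphN1 scaleN1r /Lz XmxN.
Qed.

Local Lemma Lz_sym i j b : Lz i j (u b) -> Lz j i (u b).
Proof.
rewrite {1}/Lz Xmx_sym -/(Lz j i _); case: b; rewrite /u.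
  by rewrite conjc1 => /LzN; rewrite opprK.
by rewrite (_ : - 'i^*%C = 'i%C :> C) //; simpc.
Qed.

Local Lemma LzM i j k z w : i != j -> j != k -> i != k ->
  Lz i j z -> Lz j k w -> Lz i k (z * w).
Proof.
by move=> ij jk ik Hz Hw; rewrite /Lz -(@bracket_Xmx _ _ i j k) //; exact: lie_bracket.
Qed.

Local Lemma uM b c : u b * u c = u (b == c) \/ u b * u c = - u (b == c).
Proof.
case: b; case: c => /=; rewrite ?mul1r ?mulr1; try by left.
by right; rewrite -expr2 sqr_i.
Qed.

Local Lemma LzuM i j k b c : i != j -> j != k -> i != k ->
  Lz i j (u b) -> Lz j k (u c) -> Lz i k (u (b == c)).
Proof.
move=> ij jk ik Hz Hw; have := LzM ij jk ik Hz Hw.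
case: (uM b c) => ->; first by apply.
by move/LzN; rewrite opprK; apply.
Qed.

Local Lemma Lz_edge c x y : x != y -> G_contr S1 S2 S3 c x y ->
  match c with Blue => Lz x y (u true) | Red => Lz x y (u false) | Green => False end.
Proof.
move=> xy; case: c => /=.
- case=> /LS1; rewrite -XmxBmx => H; first exact: H.
  by apply: (@Lz_sym _ _ true); exact: H.
- case=> /LS2; rewrite -XmxCmx => H; first exact: H.
  by apply: (@Lz_sym _ _ false); exact: H.
- by case=> xy'; rewrite xy' eqxx in xy.
Qed.

Local Lemma Lz_walk x s y : walk (G_contr S1 S2 S3) x s y -> x != y ->
  exists b, Lz x y (u b).
Proof.
elim: s x => [x /= ->|[[c a] b] s IH x /=]; first by rewrite eqxx.
case=> -> [gxb wby] xy; have [xb|xb] := eqVneq x b.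
  by rewrite -xb in wby; exact: IH wby xy.
have [d Hd] : exists d, Lz x b (u d).
  by have := Lz_edge xb gxb; case: (c) => [H|H|[]]; [exists true|exists false].
have [bY|bY] := eqVneq b y; first by rewrite -bY; exists d.
have [e He] := IH _ wby bY.
by exists (d == e); exact: (LzuM xb bY xy Hd He).
Qed.

Local Lemma Lz_unit x y : x != y -> exists b, Lz x y (u b).
Proof. by have [w Hw] := hconn x y; apply: Lz_walk Hw. Qed.

Let full i j := Lz i j (u true) /\ Lz i j (u false).

Local Lemma full_sym i j : full i j -> full j i.
Proof. by case=> *; split; apply: Lz_sym. Qed.

(** Both phases at [(i, j)], bracketed with whichever phase is present at [(j, k)], give both phases
    at [(i, k)], possibly exchanged. *)
Local Lemma full_r i j k : i != j -> i != k -> full i j -> full i k.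
Proof.
move=> ij ik [H1 H2]; have [<-|jk] := eqVneq j k; first by [].
have [b Hb] := Lz_unit jk.
have HM c : Lz i j (u c) -> Lz i k (u (c == b)).
  by move=> Hc; exact: (LzuM ij jk ik Hc Hb).
by case: b Hb HM => _ HM; split; [exact: HM H1|exact: HM H2|exact: HM H2|exact: HM H1].
Qed.

Local Lemma full_all i j k l : i != j -> k != l -> full i j -> full k l.
Proof.
move=> ij kl fij; have [ik|ik] := eqVneq i k.
  by rewrite -ik in kl *; exact: full_r fij.
have fik := full_r ij ik fij; apply: full_r (full_sym fik) => //.
by rewrite eq_sym.
Qed.

Local Lemma full_Dmx i j : i != j -> full i j -> L (Dmx R i j).
Proof.
move=> ij [H1 /Lz_sym H2]; have := lie_bracket HL H1 H2.
rewrite bracket_Xmx_opp //= mul0r mulr1 addr0 mulr1.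
by apply: lieZK => //; rewrite pnatr_eq0.
Qed.

Local Lemma full_Xmx i j z : full i j -> L (Xmx i j z).
Proof.
case=> H1 H2; rewrite [z]complexE XmxD [_ * (complex.Im z)%:C%C]mulrC.
rewrite -[(complex.Re z)%:C%C]mulr1 !XmxZ.
by apply: (lieD HL); apply: (lieZ HL).
Qed.

Local Lemma full_su i j M : i != j -> full i j -> in_su M -> L M.
Proof.
move=> ij fij HM.
have L0 : L 0.
  rewrite -(scale0r (Xmx i j (u true))) -(rmorph0 (real_complex R)).
  by apply: (lieZ HL); case: fij.
apply: (lieZK HL (a := 2)); first by rewrite pnatr_eq0.
rewrite (su_decomposition i HM).
apply: (big_ind L); [exact: L0|by move=> A B; apply: lieD|move=> a _].
apply: (lieD HL).
  apply: (big_ind L); [exact: L0|by move=> A B; apply: lieD|move=> b ba].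
  by apply: full_Xmx; apply: full_all fij; rewrite // eq_sym.
apply: (lieZ HL); have [->|ai] := eqVneq a i.
  by rewrite Dmxx.
by apply: full_Dmx => //; apply: full_all fij.
Qed.

(** [ad (Dmx i j)] multiplies the phase at [(i, j)] by [2 i], so it turns the phase supplied by
    connectedness into the other one. *)
Local Lemma Dmx_full i j : i != j -> L (Dmx R i j) -> full i j.
Proof.
move=> ij LD; have [b Hb] := Lz_unit ij.
have : Lz i j ('i%C * u b).
  have := lie_bracket HL LD Hb; rewrite bracket_Dmx_Xmx // -mulrA.
  have -> : 2 = (2 : R)%:C%C :> C by rewrite rmorph_nat.
  by rewrite XmxZ; apply: (lieZK HL); rewrite pnatr_eq0.
case: b Hb => /= Hb; first by rewrite mulr1.
by rewrite -expr2 sqr_i => /LzN; rewrite opprK.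
Qed.

(** The disjunction says that the 2x2 block of [B] is not a combination of [i P] and [X]; then
    [a ^+ 2 + c ^+ 2] is nonzero and [Dmx i j] can be extracted. *)
Local Lemma block_full i j b (B : 'M[C]_n) : i != j -> in_su B -> L B ->
  Lz i j (u b) ->
  complex.Im (B i i) != complex.Im (B j j) \/ complex.Im ((u b)^*%C * B i j) != 0 ->
  full i j.
Proof.
move=> ij HB LB Lu ab0; apply: Dmx_full => //.
pose a := complex.Im (B i i) - complex.Im (B j j).
pose c := 2 * complex.Im ((u b)^*%C * B i j).
have uu : u b * (u b)^*%C = 1 by rewrite /u; case: (b); simpc.
have LV := lie_Xmx_block HL ij uu HB Lu LB.
rewrite -/a -/c in LV.
have := lieD HL (lieZ HL a LV) (lieZ HL (c / 2) (lie_bracket HL Lu LV)).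
rewrite (bracket_Xmx_block _ _ ij uu) => LD.
apply: (lieZK HL (a := a ^+ 2 + c ^+ 2)) LD.
rewrite paddr_eq0 ?sqr_ge0 // !sqrf_eq0 negb_and /a /c subr_eq0 mulf_eq0 pnatr_eq0 /=.
by case: ab0 => ->; rewrite ?orbT.
Qed.

(** If no pair is full, every pair carries exactly one phase. These phases form a potential of the
    control graph, and the entry of [B0] incompatible with that potential makes a pair full after
    all. *)
Theorem control_lie_full (B0 : 'M[C]_n) : in_su B0 -> L B0 ->
  (forall p, potential (G_contr S1 S2 S3) p -> exists i j, off_part p i j B0 != 0) ->
  forall M, in_su M -> L M.
Proof.
move=> HB0 LB0 Hoff.
suff [i [j [ij fij]]] : exists i j, i != j /\ full i j by move=> M; apply: full_su fij.
apply: contrapT => Nfull.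
have Nf i j : i != j -> ~ full i j by move=> ij fij; apply: Nfull; exists i, j.
pose i0 : 'I_n := Ordinal (ltnW hn).
(* The first conjunct forces [p i0 = false]: [Xmx i0 i0] is a diagonal matrix, and its membership in
   [L] says nothing about phases. *)
pose p i := (i != i0) && `[< Lz i0 i (u false) >].
have pE0 i : i != i0 -> Lz i0 i (u (~~ p i)).
  move=> ii0; rewrite /p ii0 /=; case: asboolP => Hn; first exact: Hn.
  rewrite eq_sym in ii0; have [b Hb] := Lz_unit ii0.
  by case: b Hb => Hb; [exact: Hb|case: (Hn Hb)].
have pE i j : i != j -> Lz i j (u (p i == p j)).
  move=> ij; have [ii0|ii0] := eqVneq i i0.
    have -> : p i = false by rewrite /p ii0 eqxx.
    by rewrite ii0 eq_sym eqbF_neg; apply: pE0; rewrite -ii0 eq_sym.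
  have [jj0|jj0] := eqVneq j i0.
    have -> : p j = false by rewrite /p jj0 eqxx.
    by rewrite jj0 eqbF_neg; apply: Lz_sym; apply: pE0.
  have -> : (p i == p j) = (~~ p i == ~~ p j) by case: (p i); case: (p j).
  by apply: (LzuM ii0 _ ij); [rewrite eq_sym|apply/Lz_sym/pE0|apply: pE0].
have pot : potential (G_contr S1 S2 S3) p.
  have ltn_neq i j : (i < j)%N -> i != j by move=> lt; rewrite -val_eqE /= ltn_eqF.
  have neq c i j : G_contr S1 S2 S3 c i j -> c <> Green -> i != j.
    case: c => [[/hS1/ltn_neq|/hS1/ltn_neq]|[/hS2/ltn_neq|/hS2/ltn_neq]|_ []] //=;
      by rewrite eq_sym.
  case=> i j g /=.
  - have ij : i != j by apply: neq g _.
    have := Lz_edge ij g; have := pE _ _ ij; case: eqP => [pij _ _|_ H1 H2]; first exact: pij.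
    by case: (Nf _ _ ij); split.
  - have ij : i != j by apply: neq g _.
    have := Lz_edge ij g; have := pE _ _ ij.
    case: eqP => [_ H1 H2|pij _ _]; first by case: (Nf _ _ ij); split.
    by case: (p i) (p j) pij => [] [].
  - case: g => _ [k [] H]; have /= /ltn_neq ik := hS3 H;
      by apply: (Nf _ _ ik); apply: (Dmx_full ik); apply: LS3.
have [i [j Hij]] := Hoff _ pot.
have [iEj|ij] := eqVneq i j.
  move: Hij; rewrite -iEj /off_part eqxx => Hi.
  (* A traceless matrix with a nonzero diagonal entry cannot have a constant diagonal. *)
  have [k Hk] : exists k, complex.Im (B0 k k) != complex.Im (B0 i i).
    apply: contrapT => Hn.
    have all_eq k : complex.Im (B0 k k) = complex.Im (B0 i i).
      by apply/eqP; apply: contraPT Hn => Hk; case; exists k.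
    have : complex.Im (\tr B0) = 0 by case: HB0 => _ ->.
    rewrite /mxtrace (big_morph (@complex.Im R) (id1 := 0) (op1 := +%R)) //; last by case=> ? ? [].
    rewrite (eq_bigr (fun=> complex.Im (B0 i i))) // sumr_const card_ord => /eqP.
    by rewrite mulrn_eq0 (negPf Hi) orbF => /eqP n0; move: hn; rewrite n0.
  have ik : i != k by apply: contraNN Hk => /eqP ->.
  apply: (Nf _ _ ik); apply: (block_full ik HB0 LB0 (pE _ _ ik)).
  by left; rewrite eq_sym.
apply: (Nf _ _ ij); apply: (block_full ij HB0 LB0 (pE _ _ ij)); right.
move: Hij; rewrite /off_part; case: (p i == p j); rewrite /u.
  by rewrite conjc1 mul1r.
by case: (B0 i j) => r s /= Hr; rewrite mul0r mulN1r add0r oppr_eq0.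
Qed.
End ControlLieAlgebra.

(** * Unitary one-parameter groups *)

Section MatrixNorm.
Variables (R : realType) (n : nat).
Local Notation C := R[i].
Implicit Types (A B M U V : 'M[C]_n) (i j : 'I_n) (z w : C) (a : R).

(** An l1 norm with values in [R], so that estimates split into those of the two real
    coordinates. *)
Definition cnorm z : R := `|complex.Re z| + `|complex.Im z|.

Lemma cnorm_ge0 z : 0 <= cnorm z.
Proof. by rewrite addr_ge0. Qed.

Lemma cnorm_eq0 z : cnorm z = 0 -> z = 0.
Proof.
case: z => r s /eqP; rewrite /cnorm /= paddr_eq0 // !normr_eq0.
by move=> /andP[/eqP -> /eqP ->].
Qed.

Lemma cnormD z w : cnorm (z + w) <= cnorm z + cnorm w.
Proof.
case: z w => [r s] [r' s']; rewrite /cnorm /=.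
by rewrite addrACA; apply: lerD; apply: ler_normD.
Qed.

Lemma cnormN z : cnorm (- z) = cnorm z.
Proof. by case: z => r s; rewrite /cnorm /= !normrN. Qed.

Lemma cnormJ z : cnorm z^*%C = cnorm z.
Proof. by case: z => r s; rewrite /cnorm /= normrN. Qed.

Lemma cnormM z w : cnorm (z * w) <= cnorm z * cnorm w.
Proof.
case: z w => [r s] [r' s']; rewrite /cnorm /= mulrDl !mulrDr -!normrM.
rewrite [leRHS](_ : _ = (`|r * r'| + `|s * s'|) + (`|r * s'| + `|s * r'|)); last by ring.
by apply: lerD; rewrite ?(le_trans (ler_normB _ _)) ?(le_trans (ler_normD _ _)).
Qed.

Lemma cnormZ a z : cnorm (a%:C%C * z) = `|a| * cnorm z.
Proof.
case: z => r s; rewrite /cnorm /= !mul0r subr0 addr0 !normrM.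
by rewrite mulrDr.
Qed.

Definition nrm A : R := \sum_i \sum_j cnorm (A i j).

Lemma nrm_ge0 A : 0 <= nrm A.
Proof. by apply: sumr_ge0 => i _; apply: sumr_ge0 => j _; apply: cnorm_ge0. Qed.

Lemma cnorm_le_nrm A i j : cnorm (A i j) <= nrm A.
Proof.
rewrite /nrm (bigD1 i) //= (bigD1 j) //= -addrA lerDl addr_ge0 //.
  by apply: sumr_ge0 => ? _; apply: cnorm_ge0.
by apply: sumr_ge0 => ? _; apply: sumr_ge0 => ? _; apply: cnorm_ge0.
Qed.

Lemma nrm_eq0 A : nrm A <= 0 -> A = 0.
Proof.
move=> A0; apply/matrixP=> i j; rewrite mxE; apply: cnorm_eq0; apply: le_anti.
by rewrite cnorm_ge0 andbT (le_trans (cnorm_le_nrm A i j)).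
Qed.

Lemma nrm0 : nrm 0 = 0.
Proof.
by rewrite /nrm big1 // => i _; rewrite big1 // => j _; rewrite mxE /cnorm /= normr0 addr0.
Qed.

Lemma nrmD A B : nrm (A + B) <= nrm A + nrm B.
Proof.
rewrite /nrm -big_split; apply: ler_sum => i _ /=; rewrite -big_split.
by apply: ler_sum => j _ /=; rewrite mxE cnormD.
Qed.

Lemma nrmN A : nrm (- A) = nrm A.
Proof. by apply: eq_bigr => i _; apply: eq_bigr => j _; rewrite mxE cnormN. Qed.

Lemma nrmB A B : nrm (A - B) <= nrm A + nrm B.
Proof. by rewrite -(nrmN B); apply: nrmD. Qed.

Lemma nrm_subC A B : nrm (A - B) = nrm (B - A).
Proof. by rewrite -nrmN opprB. Qed.

Lemma nrmZ a A : nrm (a%:C%C *: A) = `|a| * nrm A.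
Proof.
rewrite /nrm mulr_sumr; apply: eq_bigr => i _; rewrite mulr_sumr.
by apply: eq_bigr => j _; rewrite mxE cnormZ.
Qed.

Lemma nrmM A B : nrm (A *m B) <= nrm A * nrm B.
Proof.
have -> : nrm A * nrm B = \sum_i \sum_k cnorm (A i k) * nrm B.
  by rewrite /nrm mulr_suml; apply: eq_bigr => i _; rewrite mulr_suml.
apply: ler_sum => i _.
apply: (@le_trans _ _ (\sum_j \sum_k cnorm (A i k) * cnorm (B k j))).
  apply: ler_sum => j _; rewrite mxE; elim/big_rec2: _ => [|k x y _ H].
    by rewrite /cnorm /= normr0 addr0.
  by apply: le_trans (cnormD _ _) _; rewrite lerD // cnormM.
rewrite exchange_big /=; apply: ler_sum => k _.
rewrite -mulr_sumr ler_wpM2l ?cnorm_ge0 //.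
rewrite /nrm [leRHS](bigD1 k) //= lerDl.
by apply: sumr_ge0 => ? _; apply: sumr_ge0 => ? _; apply: cnorm_ge0.
Qed.

Lemma nrm_adj A : nrm (mx_adj A) = nrm A.
Proof.
rewrite /nrm exchange_big; apply: eq_bigr => i _; apply: eq_bigr => j _.
by rewrite !mxE cnormJ.
Qed.

Lemma mx_adjM A B : mx_adj (A *m B) = mx_adj B *m mx_adj A.
Proof. by rewrite /mx_adj map_mxM trmx_mul. Qed.

Lemma mx_adjK A : mx_adj (mx_adj A) = A.
Proof. by apply/matrixP => i j; rewrite !mxE conjcK. Qed.

Lemma mx_adjD A B : mx_adj (A + B) = mx_adj A + mx_adj B.
Proof. by apply/matrixP => i j; rewrite !mxE rmorphD. Qed.

Lemma mx_adjN A : mx_adj (- A) = - mx_adj A.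
Proof. by apply/matrixP => i j; rewrite !mxE rmorphN. Qed.

Lemma mx_adjZ z A : mx_adj (z *: A) = z^*%C *: mx_adj A.
Proof. by apply/matrixP => i j; rewrite !mxE rmorphM. Qed.

Lemma mx_adj1 : mx_adj 1%:M = 1%:M :> 'M[C]_n.
Proof. by rewrite /mx_adj map_mx1 trmx1. Qed.

Definition unitary U := mx_adj U *m U = 1%:M.

Lemma unitary_mulVC U : unitary U -> U *m mx_adj U = 1%:M.
Proof. exact: mulmx1C. Qed.

Lemma unitary1 : unitary 1%:M.
Proof. by rewrite /unitary mx_adj1 mulmx1. Qed.

Lemma unitaryM U V : unitary U -> unitary V -> unitary (U *m V).
Proof.
by move=> uU uV; rewrite /unitary mx_adjM mulmxA -(mulmxA _ _ U) uU mulmx1.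
Qed.

Lemma unitary_adj U : unitary U -> unitary (mx_adj U).
Proof. by move=> uU; rewrite /unitary mx_adjK unitary_mulVC. Qed.

(** The entry-sum norm [nrm] is not unitarily invariant; this constant is the price of each unitary
    factor. The real and imaginary parts of the [n * n] entries are at most 1 in absolute value, and
    the successor keeps the bound at least 1. *)
Definition unitary_bound : R := (n * n * 2).+1%:R.

Lemma unitary_bound_ge1 : 1 <= unitary_bound.
Proof. by rewrite /unitary_bound ler1n. Qed.

Lemma unitary_bound_gt0 : 0 < unitary_bound.
Proof. by apply: lt_le_trans unitary_bound_ge1; apply: ltr01. Qed.

Lemma unitary_entry U i j : unitary U ->
  complex.Re (U i j) ^+ 2 + complex.Im (U i j) ^+ 2 <= 1.
Proof.
move=> /unitary_mulVC /matrixP/(_ i i); rewrite !mxE eqxx => E.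
have : complex.Re (\sum_j U i j * (mx_adj U) j i) = 1 by rewrite E.
rewrite (big_morph (@complex.Re R) (id1 := 0) (op1 := +%R)) //; last by case=> ? ? [].
move=> {E} <-; rewrite (bigD1 j) //= -[leLHS]addr0; apply: lerD.
  by rewrite !mxE; case: (U i j) => r s /=; rewrite mulrN opprK !expr2.
apply: sumr_ge0 => k _; rewrite !mxE; case: (U i k) => r s /=.
by rewrite mulrN opprK -!expr2 addr_ge0 ?sqr_ge0.
Qed.

Lemma nrm_unitary U : unitary U -> nrm U <= unitary_bound.
Proof.
move=> uU; apply: (@le_trans _ _ (\sum_(i < n) \sum_(j < n) 2)).
  apply: ler_sum => i _; apply: ler_sum => j _.
  have := unitary_entry i j uU; rewrite /cnorm.
  move: (complex.Re _) (complex.Im _) => x y xy.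
  have B (b c : R) : b ^+ 2 + c ^+ 2 <= 1 -> `|b| <= 1.
    move=> bc; rewrite -(@ler_pXn2r _ 2) ?nnegrE // expr1n real_normK ?num_real //.
    by apply: le_trans bc; rewrite lerDl sqr_ge0.
  by apply: lerD; [apply: (B _ y)|apply: (B _ x); rewrite addrC].
rewrite !sumr_const !card_ord -!mulrnA /unitary_bound ler_nat.
by apply/leqW/eq_leq; ring.
Qed.

Lemma nrm_unitaryMl U A : unitary U -> nrm (U *m A) <= unitary_bound * nrm A.
Proof.
move=> /nrm_unitary uU; apply: le_trans (nrmM _ _) _.
by apply: ler_wpM2r => //; apply: nrm_ge0.
Qed.

Lemma nrm_unitaryMr U A : unitary U -> nrm (A *m U) <= unitary_bound * nrm A.
Proof.
move=> /nrm_unitary uU; apply: le_trans (nrmM _ _) _.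
by rewrite mulrC; apply: ler_wpM2r => //; apply: nrm_ge0.
Qed.

Definition mxpow A k := iter k (mulmx A) 1%:M.

Lemma mxpowS A k : mxpow A k.+1 = A *m mxpow A k. Proof. by []. Qed.

Lemma mxpowD A k l : mxpow A (k + l) = mxpow A k *m mxpow A l.
Proof. by elim: k => [|k IH]; rewrite ?mul1mx // addSn !mxpowS IH mulmxA. Qed.

Lemma unitary_mxpow U k : unitary U -> unitary (mxpow U k).
Proof.
by move=> uU; elim: k => [|k IH]; [apply: unitary1|apply: unitaryM].
Qed.

Lemma nrm_mxpowB U V k : unitary U -> unitary V ->
  nrm (mxpow U k - mxpow V k) <= k%:R * (unitary_bound ^+ 2 * nrm (U - V)).
Proof.
move=> uU uV.
(* The unitary prefix [W] absorbs the factors met during the induction. Without it each step would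
   cost another [unitary_bound], and the estimate would be exponential in [k] instead of linear. *)
suff H W : unitary W ->
    nrm (W *m (mxpow U k - mxpow V k)) <= k%:R * (unitary_bound ^+ 2 * nrm (U - V)).
  by have := H _ unitary1; rewrite mul1mx.
elim: k W => [|k IH] W uW; first by rewrite subrr mulmx0 nrm0 mul0r.
rewrite !mxpowS (_ : W *m _ = W *m U *m (mxpow U k - mxpow V k)
    + W *m (U - V) *m mxpow V k); last first.
  by rewrite !mulmxBr !mulmxBl !mulmxA addrA subrK.
apply: le_trans (nrmD _ _) _; rewrite -natr1 mulrDl mul1r; apply: lerD.
  by apply: IH; apply: unitaryM.
rewrite expr2 -mulrA.
apply: le_trans (nrm_unitaryMr _ (unitary_mxpow k uV)) _.
by rewrite ler_pM2l ?unitary_bound_gt0 // nrm_unitaryMl.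
Qed.

(** Strict derivative at 0: both points vary, as a contraction argument requires. The source is a
    group with a size function, so that reals, row vectors and matrices are treated alike. *)
Definition strict_diff (T : zmodType) (p : T -> R) (F L : T -> 'M[C]_n) :=
  forall c, 0 < c -> exists2 r, 0 < r & forall x y, p x <= r -> p y <= r ->
    nrm (F x - F y - L (x - y)) <= c * p (x - y).

(** [U t] plays the role of [exp (t M)], characterized by its group law and its derivative at 0.
    Existence comes from diagonalization ([flow_exists]) and uniqueness from [flow_unique]. *)
Definition unitary_flow (U : R -> 'M[C]_n) M :=
  [/\ forall t, unitary (U t), forall s t, U (s + t) = U s *m U t &
      forall c, 0 < c -> exists2 r, 0 < r & forall s, `|s| <= r ->
        nrm (U s - 1%:M - s%:C%C *: M) <= c * `|s|].

Section Flow.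
Variables (U : R -> 'M[C]_n) (M : 'M[C]_n) (HU : unitary_flow U M).

Lemma flow_unitary t : unitary (U t). Proof. by case: HU. Qed.
Lemma flowD s t : U (s + t) = U s *m U t. Proof. by case: HU. Qed.

Lemma flow0 : U 0 = 1%:M.
Proof.
have /(congr1 (mulmx (mx_adj (U 0)))) := flowD 0 0.
by rewrite addr0 mulmxA (flow_unitary 0) mul1mx.
Qed.

Lemma flowN t : U (- t) = mx_adj (U t).
Proof.
rewrite -[LHS]mul1mx -(flow_unitary t) -mulmxA -flowD subrr flow0.
by rewrite mulmx1.
Qed.

Lemma flow_mxpow s k : U (k%:R * s) = mxpow (U s) k.
Proof.
elim: k => [|k IH]; first by rewrite mul0r flow0.
by rewrite mxpowS -IH -flowD -natr1 mulrDl mul1r addrC.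
Qed.

Lemma flow_diff0 c : 0 < c -> exists2 r, 0 < r & forall s, `|s| <= r ->
  nrm (U s - 1%:M - s%:C%C *: M) <= c * `|s|.
Proof. by case: HU => _ _; apply. Qed.

End Flow.

Lemma nat_large (t r : R) : 0 < r -> exists2 k : nat, (0 < k)%N & `|t / k%:R| <= r.
Proof.
move=> r0; have := archi_boundP (x := `|t| / r); set k := Num.bound _ => Hk.
have k0 : 0 < k.+1%:R :> R by rewrite ltr0n.
exists k.+1; rewrite // normrM normfV (ger0_norm (ltW k0)) ler_pdivrMr // mulrC.
rewrite -ler_pdivrMr //; apply: ltW; apply: lt_trans (Hk _) _.
  by rewrite divr_ge0 // ltW.
by rewrite ltr_nat.
Qed.

(** Cut [t] into [k] equal steps [s]. One step contributes [|s| * nrm (A - B)] plus an error [o(s)],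
    and [nrm_mxpowB] adds up the [k] contributions. *)
Lemma flow_dist (U V : R -> 'M[C]_n) A B (t : R) : unitary_flow U A -> unitary_flow V B ->
  nrm (U t - V t) <= unitary_bound ^+ 2 * (`|t| * nrm (A - B)).
Proof.
move=> HU HV; apply/ler_addgt0Pr => e e0.
have K0 : 0 < unitary_bound ^+ 2 by rewrite exprn_gt0 // unitary_bound_gt0.
(* The accumulated [o(s)] errors of both flows amount to [|t| * (c *+ 2)], up to the unitary
   constant; [c] makes them at most [e]. *)
have [c c0 Hc] : exists2 c, 0 < c & unitary_bound ^+ 2 * (`|t| * (c *+ 2)) <= e.
  pose D := unitary_bound ^+ 2 * (`|t| + 1) * 2.
  have D0 : 0 < D by rewrite !mulr_gt0 // ltr_wpDl.
  exists (e / D); first exact: divr_gt0.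
  apply: (@le_trans _ _ (e / D * D)); last by rewrite divfK ?gt_eqF.
  have : 0 < e / D by exact: divr_gt0.
  move: (e / D) => c c0; rewrite [leLHS](_ : _ = c * (unitary_bound ^+ 2 * `|t| * 2)).
    by rewrite ler_pM2l // /D ler_pM2r // ler_pM2l // lerDl.
  by rewrite -mulr_natr; ring.
have [r1 r10 H1] := flow_diff0 HU c0; have [r2 r20 H2] := flow_diff0 HV c0.
have [|k k0 Hk] := @nat_large t (Num.min r1 r2); first by rewrite lt_min r10.
have kR : 0 < k%:R :> R by rewrite ltr0n.
set s := t / k%:R in Hk; have tE : t = k%:R * s by rewrite mulrC divfK ?gt_eqF.
clearbody s; move: Hk; rewrite le_min => /andP[/H1 {}H1 /H2 {}H2].
have Hs : nrm (U s - V s) <= `|s| * nrm (A - B) + c * `|s| *+ 2.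
  rewrite (_ : U s - V s = (U s - 1%:M - s%:C%C *: A) - (V s - 1%:M - s%:C%C *: B)
     + s%:C%C *: (A - B)); last by apply/matrixP => i j; rewrite !mxE; ring.
  apply: le_trans (nrmD _ _) _; rewrite addrC nrmZ lerD2l mulr2n.
  by apply: le_trans (nrmB _ _) _; apply: lerD.
rewrite tE (flow_mxpow HU) (flow_mxpow HV).
apply: le_trans (nrm_mxpowB _ (flow_unitary HU s) (flow_unitary HV s)) _.
apply: (@le_trans _ _ (k%:R * (unitary_bound ^+ 2 * (`|s| * nrm (A - B) + c * `|s| *+ 2)))).
  by rewrite ler_pM2l // ler_pM2l.
have -> : k%:R * (unitary_bound ^+ 2 * (`|s| * nrm (A - B) + c * `|s| *+ 2))
  = unitary_bound ^+ 2 * (`|t| * nrm (A - B)) + unitary_bound ^+ 2 * (`|t| * (c *+ 2)).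
  by rewrite tE normrM (ger0_norm (ltW kR)) !mulr2n; ring.
by rewrite -tE lerD2l.
Qed.

Lemma flow_unique (U V : R -> 'M[C]_n) A (t : R) : unitary_flow U A -> unitary_flow V A -> U t = V t.
Proof.
move=> HU HV; apply/subr0_eq/nrm_eq0/(le_trans (flow_dist t HU HV)).
by rewrite subrr nrm0 !mulr0.
Qed.

End MatrixNorm.

(** * Real derivatives as little-o estimates *)

Section LittleO.
Variable R : realType.

Lemma is_derive_littleo (f : R -> R) (t df : R) : is_derive t 1 f df ->
  forall c, 0 < c -> exists2 r, 0 < r & forall s, `|s| <= r ->
    `|f (t + s) - f t - s * df| <= c * `|s|.
Proof.
move=> [Df Ef] c c0.
have : h^-1 *: (f (h *: 1 + t) - f t) @[h --> (0 : R)^'] --> df.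
  by rewrite -Ef; exact: Df.
move=> /cvgrPdist_le /(_ c c0) /nbhs_ballP[e /= e0 He].
exists (e / 2); first by rewrite divr_gt0.
move=> s se; have [->|s0] := eqVneq s 0.
  by rewrite addr0 subrr mul0r subrr normr0 mulr0.
have := He s; rewrite /ball /= sub0r normrN => /(_ _ s0).
rewrite (le_lt_trans se) ?ltr_pdivrMr ?ltr_pMr ?ltr1n // => /(_ isT).
rewrite -[_ *: 1]/(s * 1) mulr1 [s + t]addrC => H.
rewrite (_ : _ - _ = s * (s^-1 *: (f (t + s) - f t) - df)); last first.
  by rewrite mulrBr -[_ *: _]/(s^-1 * _) mulrA divff // mul1r.
by rewrite normrM mulrC ler_wpM2r // distrC.
Qed.

Lemma littleo_is_derive (f : R -> R) (t df : R) :
  (forall c, 0 < c -> exists2 r, 0 < r & forall s, `|s| <= r ->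
    `|f (t + s) - f t - s * df| <= c * `|s|) -> is_derive t 1 f df.
Proof.
move=> H.
have L : h^-1 *: (f (h *: 1 + t) - f t) @[h --> (0 : R)^'] --> df.
  apply/cvgrPdist_le => c c0; have [r r0 Hr] := H c c0.
  apply/nbhs_ballP; exists r => //= s; rewrite /ball /= sub0r normrN => sr s0.
  have := Hr s (ltW sr); rewrite -[_ *: 1]/(s * 1) mulr1 [t + s]addrC => {}Hr.
  rewrite -(ler_pM2r (x := `|s|)) ?normr_gt0 // distrC -normrM.
  apply: le_trans Hr; rewrite mulrBl -[_ *: _]/(s^-1 * _) mulrAC mulVf // mul1r.
  by rewrite [df * s]mulrC.
split; first by apply/cvg_ex; exists df.
exact: cvg_lim L.
Qed.
End LittleO.

Lemma finite_radius (R : realType) (I : finType) (Q : I -> R -> Prop) :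
  (forall j, exists2 r, 0 < r & forall s : R, `|s| <= r -> Q j s) ->
  exists2 r, 0 < r & forall j (s : R), `|s| <= r -> Q j s.
Proof.
move=> H; have /choice[r Hr] : forall j, exists r, 0 < r /\ forall s, `|s| <= r -> Q j s.
  by move=> j; have [r r0 Hr] := H j; exists r.
exists (\big[Num.min/1]_j r j).
  by apply: lt_bigmin => // j _; case: (Hr j).
move=> j s sr; case: (Hr j) => _; apply; apply: le_trans sr _.
exact: bigmin_le_cond.
Qed.

(** * Existence of flows by diagonalization *)

Section FlowExists.
Variables (R : realType) (n : nat).
Local Notation C := R[i].
Implicit Types (M : 'M[C]_n) (U : R -> 'M[C]_n).

Definition cis (x : R) : C := (cos x +i* sin x)%C.

Lemma cisD x y : cis (x + y) = cis x * cis y.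
Proof. by rewrite /cis cosD sinD; simpc; congr (_ +i* _)%C; ring. Qed.

Lemma cis0 : cis 0 = 1. Proof. by rewrite /cis cos0 sin0. Qed.

Lemma cis_conj x : (cis x)^*%C * cis x = 1.
Proof.
rewrite /cis; simpc; rewrite -!expr2 cos2Dsin2 [sin x * _]mulrC subrr.
by [].
Qed.

Lemma cis_sum I (r : seq I) (F : I -> R) :
  cis (\sum_(i <- r) F i) = \prod_(i <- r) cis (F i).
Proof. by apply: (big_morph cis cisD cis0). Qed.

Lemma cis_surj (z : C) : z^*%C * z = 1 -> exists x, z = cis x.
Proof.
case: z => a b; simpc => -[]; rewrite -!expr2 => ab _.
have a1 : -1 <= a <= 1.
  by rewrite -ler_norml -(@ler_pXn2r _ 2) ?nnegrE // expr1n real_normK ?num_real // -ab lerDl sqr_ge0.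
have sb : sin (acos a) ^+ 2 = b ^+ 2.
  by rewrite sin2cos2 acosK // -ab addrC addKr.
have /orP[] : (b == sin (acos a)) || (b == - sin (acos a)) by rewrite -eqf_sqr sb.
  by move=> /eqP ->; exists (acos a); rewrite /cis acosK.
by move=> /eqP ->; exists (- acos a); rewrite /cis cosN sinN acosK.
Qed.

Lemma cis_littleo (th c : R) : 0 < c -> exists2 r, 0 < r & forall s, `|s| <= r ->
  cnorm (cis (th * s) - 1 - s%:C%C * ('i%C * th%:C%C)) <= c * `|s|.
Proof.
move=> c0; have c20 : 0 < c / 2 by rewrite divr_gt0.
have dl : is_derive (0 : R) 1 ( *%R th) th.
  apply: littleo_is_derive => e e0; exists 1 => // s _.
  by rewrite add0r mulr0 subr0 [s * _]mulrC subrr normr0 mulr_ge0 // ltW.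
have d1 : is_derive (0 : R) 1 (fun s => cos (th * s)) 0.
  apply: is_derive_eq (is_derive1_comp (is_derive_cos _) dl) _.
  by rewrite mulr0 sin0 oppr0 mul0r.
have d2 : is_derive (0 : R) 1 (fun s => sin (th * s)) th.
  apply: is_derive_eq (is_derive1_comp (is_derive_sin _) dl) _.
  by rewrite mulr0 cos0 mul1r.
have [r1 r10 H1] := is_derive_littleo d1 c20.
have [r2 r20 H2] := is_derive_littleo d2 c20.
exists (Num.min r1 r2); first by rewrite lt_min r10.
move=> s; rewrite le_min => /andP[/H1 + /H2].
rewrite add0r !mulr0 cos0 sin0 !subr0 => {}H1 {}H2.
rewrite /cis /cnorm; simpc => /=.
by rewrite [c]splitr mulrDl; apply: lerD.
Qed.

(** Functional calculus in a fixed eigenbasis: for unitary [P], products, adjoints, determinants and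
    traces are computed on the eigenvalues [d]. *)
Definition diag_conj (P : 'M[C]_n) (d : 'I_n -> C) : 'M[C]_n :=
  mx_adj P *m diag_mx (\row_j d j) *m P.

Lemma diag_conjM P d e : unitary P ->
  diag_conj P d *m diag_conj P e = diag_conj P (fun j => d j * e j).
Proof.
move=> uP; rewrite /diag_conj !mulmxA -[_ *m P *m mx_adj P]mulmxA.
rewrite (unitary_mulVC uP) mulmx1 -[_ *m diag_mx _ *m diag_mx _]mulmxA mulmx_diag.
by congr (_ *m diag_mx _ *m _); apply/rowP => j; rewrite !mxE.
Qed.

Lemma diag_conj_adj P d : mx_adj (diag_conj P d) = diag_conj P (fun j => (d j)^*%C).
Proof.
rewrite /diag_conj !mx_adjM mx_adjK mulmxA; congr (_ *m _ *m _).
by apply/matrixP => i j; rewrite !mxE rmorphMn eq_sym; case: eqP => // ->.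
Qed.

Lemma diag_conj1 P : unitary P -> diag_conj P (fun=> 1) = 1%:M.
Proof.
move=> uP; rewrite /diag_conj (_ : diag_mx _ = 1%:M) ?mulmx1 //.
by apply/matrixP => i j; rewrite !mxE.
Qed.

Lemma diag_conjB P d e : diag_conj P d - diag_conj P e = diag_conj P (fun j => d j - e j).
Proof.
rewrite /diag_conj -mulmxBl -mulmxBr -raddfB /=; congr (_ *m diag_mx _ *m _).
by apply/rowP => j; rewrite !mxE.
Qed.

Lemma diag_conjZ P z d : z *: diag_conj P d = diag_conj P (fun j => z * d j).
Proof.
rewrite /diag_conj scalemxAl scalemxAr -linearZ /=; congr (_ *m diag_mx _ *m _).
by apply/rowP => j; rewrite !mxE.
Qed.

Lemma det_diag_conj P d : unitary P -> \det (diag_conj P d) = \prod_j d j.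
Proof.
move=> uP; rewrite /diag_conj !det_mulmx mulrAC -det_mulmx uP det1 mul1r.
by rewrite det_diag; apply: eq_bigr => j _; rewrite mxE.
Qed.

Lemma tr_diag_conj P d : unitary P -> \tr (diag_conj P d) = \sum_j d j.
Proof.
move=> uP; rewrite /diag_conj mxtrace_mulC mulmxA (unitary_mulVC uP) mul1mx.
by rewrite mxtrace_diag; apply: eq_bigr => j _; rewrite mxE.
Qed.

Lemma diag_conj_inj P d e j : unitary P -> diag_conj P d = diag_conj P e -> d j = e j.
Proof.
move=> uP /(congr1 (fun A => P *m A *m mx_adj P)); rewrite /diag_conj.
rewrite !mulmxA (unitary_mulVC uP) !mul1mx -!mulmxA (unitary_mulVC uP) !mulmx1.
by move=> /matrixP/(_ j j); rewrite !mxE eqxx.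
Qed.

Lemma normal_diag_conj M : M *m mx_adj M = mx_adj M *m M ->
  exists P d, unitary P /\ M = diag_conj P d.
Proof.
have conjE m (A : 'M[C]_m) : (map_mx Num.conj A^T) = mx_adj A.
  by apply/matrixP => i j; rewrite !mxE.
move=> HM; have /orthomx_spectralP -E : M \is normalmx.
  by apply/normalmxP; rewrite conjE.
exists (spectralmx M), (fun j => spectral_diag M 0 j).
have := spectral_unitarymx M => uP.
have uP' : unitary (spectralmx M).
  by have /unitarymxP := uP; rewrite conjE => /mulmx1C.
split; first exact: uP'.
apply: etrans E _; rewrite /diag_conj (invmx_unitary uP) conjE.
by rewrite (_ : \row_j _ = spectral_diag M) //; apply/rowP => j; rewrite mxE.
Qed.

Lemma diag_flow P (th : 'I_n -> R) : unitary P ->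
  unitary_flow (fun t => diag_conj P (fun j => cis (th j * t)))
               (diag_conj P (fun j => 'i%C * (th j)%:C%C)).
Proof.
move=> uP; split.
- move=> t; rewrite /unitary diag_conj_adj diag_conjM // -[RHS](diag_conj1 uP).
  by congr diag_conj; apply/funext => j; rewrite cis_conj.
- move=> s t; rewrite diag_conjM //; congr diag_conj; apply/funext => j.
  by rewrite mulrDr cisD.
move=> c c0.
(* Conjugating a diagonal matrix with [n] entries of size [e] costs at most [K * e]; the final [+ 1]
   makes [K] positive. *)
pose K : R := unitary_bound R n * (\sum_(j < n) 1) * unitary_bound R n + 1.
have K0 : 0 < K.
  by rewrite ltr_wpDl // !mulr_ge0 ?sumr_ge0 // ltW // unitary_bound_gt0.
have cK0 : 0 < c / K by rewrite divr_gt0.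
have [r r0 Hr] : exists2 r, 0 < r & forall j s, `|s| <= r ->
    cnorm (cis (th j * s) - 1 - s%:C%C * ('i%C * (th j)%:C%C)) <= c / K * `|s|.
  by apply: finite_radius => j; exact: cis_littleo.
exists r => // s sr.
rewrite -(diag_conj1 uP) diag_conjB diag_conjZ diag_conjB.
set d := fun j => _.
have Hd j : cnorm (d j) <= c / K * `|s| by exact: Hr.
have nd : nrm (diag_mx (\row_j d j)) <= \sum_(j < n) c / K * `|s|.
  apply: ler_sum => j _; rewrite (bigD1 j) //= big1 ?addr0.
    by rewrite !mxE eqxx mulr1n.
  by move=> k kj; rewrite !mxE eq_sym (negPf kj) mulr0n /cnorm /= normr0 addr0.
apply: le_trans (nrmM _ _) _; apply: le_trans (_ : nrm (mx_adj P *m diag_mx (\row_j d j)) * nrm P <= unitary_bound R n * (\sum_(j < n) c / K * `|s|) * unitary_bound R n) _.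
  apply: ler_pM; rewrite ?nrm_ge0 ?nrm_unitary //.
  apply: le_trans (nrmM _ _) _.
  by apply: ler_pM; rewrite ?nrm_ge0 ?nrm_adj ?nrm_unitary.
apply: (@le_trans _ _ (K * (c / K * `|s|))); last first.
  by rewrite mulrA [c / K]mulrC mulrA divff ?mul1r // gt_eqF.
have : 0 <= c / K * `|s| by rewrite mulr_ge0 // ltW.
move: (c / K * `|s|) => e e0; rewrite /K mulrDl mul1r.
rewrite (_ : \sum_(j < n) e = (\sum_(j < n) 1) * e); last first.
  by rewrite mulr_suml; apply: eq_bigr => j _; rewrite mul1r.
by rewrite [leLHS](_ : _ = unitary_bound R n * (\sum_(j < n) 1) * unitary_bound R n * e) ?lerDl //; ring.
Qed.

Lemma skew_diag_conj M : mx_adj M = - M -> exists P (th : 'I_n -> R),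
  unitary P /\ M = diag_conj P (fun j => 'i%C * (th j)%:C%C).
Proof.
move=> Mskew; have [|P [d [uP E]]] := @normal_diag_conj M.
  by rewrite Mskew mulmxN mulNmx.
exists P, (fun j => complex.Im (d j)); split=> //; rewrite {1}E.
congr diag_conj; apply/funext => j; rewrite [LHS]complexE.
suff -> : complex.Re (d j) = 0 by rewrite rmorph0 add0r.
have : diag_conj P (fun j => (d j)^*%C) = diag_conj P (fun j => -1 * d j).
  by rewrite -diag_conj_adj -diag_conjZ -E Mskew scaleN1r.
move=> /(diag_conj_inj j uP); rewrite mulN1r; case: (d j) => a b /= [/eqP].
by rewrite -addr_eq0 -mulr2n mulrn_eq0 => /eqP.
Qed.

Lemma flow_exists M : mx_adj M = - M -> exists U, unitary_flow U M.
Proof.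
move=> /skew_diag_conj[P [th [uP ->]]].
by eexists; exact: diag_flow.
Qed.

(** By uniqueness the flow is the diagonalized one, whose determinant is [cis] of [t] times the sum
    of the angles; that sum is zero because the trace is. *)
Lemma flow_det (U : R -> 'M[C]_n) M t : mx_adj M = - M -> \tr M = 0 -> unitary_flow U M ->
  \det (U t) = 1.
Proof.
move=> /skew_diag_conj[P [th [uP ->]]] trM HU.
rewrite (flow_unique t HU (diag_flow th uP)) det_diag_conj // -cis_sum -mulr_suml.
move: trM; rewrite tr_diag_conj // -mulr_sumr -rmorph_sum /= => /eqP.
rewrite mulf_eq0 => /orP[/eqP[/eqP]|/eqP[->]]; first by rewrite oner_eq0.
by rewrite mul0r cis0.
Qed.

Lemma SU_flow (Y : 'M[C]_n) : (0 < n)%N -> in_SU Y ->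
  exists U M, [/\ in_su M, unitary_flow U M & Y = U 1].
Proof.
move=> n0 [uY detY]; have [|P [d [uP E]]] := @normal_diag_conj Y.
  by rewrite uY; exact: unitary_mulVC.
have dd j : (d j)^*%C * d j = 1.
  apply: (@diag_conj_inj P (fun j => (d j)^*%C * d j) (fun=> 1) j uP).
  by rewrite -diag_conjM // -diag_conj_adj -E uY diag_conj1.
have /choice[th Hth] : forall j, exists x, d j = cis x by move=> j; exact: cis_surj.
pose i0 := Ordinal n0.
(* Arbitrary arguments of the eigenvalues sum only to a multiple of [2 pi]. Replacing one of them by
   minus the sum of the others makes the generator traceless, and determinant 1 shows that the
   eigenvalue is unchanged. *)
pose th' j := if j == i0 then - \sum_(k | k != i0) th k else th j.
have sth' : \sum_j th' j = 0.
  rewrite (bigD1 i0) //= {1}/th' eqxx; apply/eqP; rewrite addrC subr_eq0; apply/eqP.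
  by apply: eq_bigr => j /negPf j0; rewrite /th' j0.
have Hth' j : d j = cis (th' j).
  rewrite /th'; case: eqP => [->|//]; move: detY.
  rewrite E det_diag_conj // (bigD1 i0) //= => D.
  have D' : cis (\sum_(k | k != i0) th k) = \prod_(k | k != i0) d k.
    by rewrite (big_morph cis cisD cis0); apply: eq_bigr => k _.
  rewrite -D' in D; move: D; set S := \sum_(k | k != i0) th k => D.
  have -> : d i0 = d i0 * cis (S - S) by rewrite subrr cis0 mulr1.
  by rewrite cisD mulrA D mul1r.
exists (fun t => diag_conj P (fun j => cis (th' j * t))).
exists (diag_conj P (fun j => 'i%C * (th' j)%:C%C)); split; last 2 first.
- exact: diag_flow.
- by rewrite E; congr diag_conj; apply/funext => j; rewrite mulr1.
split; last by rewrite tr_diag_conj // -mulr_sumr -rmorph_sum /= sth' rmorph0 mulr0.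
rewrite diag_conj_adj -scaleN1r diag_conjZ; congr diag_conj; apply/funext => j.
by rewrite rmorphM /= mulN1r -mulNr; simpc.
Qed.
End FlowExists.

(** * Strict differentiability *)

Section StrictDiff.
Variables (R : realType) (n : nat).
Local Notation C := R[i].
Variables (T : zmodType) (p : T -> R) (p0 : p 0 = 0) (p_ge0 : forall x, 0 <= p x).
Implicit Types (F G L : T -> 'M[C]_n) (A B : 'M[C]_n).

Definition lbounded L := exists2 K, 0 <= K & forall x, nrm (L x) <= K * p x.

Definition sdiff F L := lbounded L /\ strict_diff p F L.

Lemma sdiff_cst A : sdiff (fun=> A) (fun=> 0).
Proof.
split; first by exists 0 => // x; rewrite nrm0 mul0r.
move=> c c0; exists 1 => // x y _ _.
by rewrite subrr subr0 nrm0 mulr_ge0 // ltW.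
Qed.

Lemma sdiff_cvg F L e : sdiff F L -> 0 < e ->
  exists2 r, 0 < r & forall x, p x <= r -> nrm (F x - F 0) <= e.
Proof.
case=> -[K K0 HK] HF e0; have [r r0 Hr] := HF 1 ltr01.
have K1 : 0 < K + 1 by rewrite ltr_wpDl.
exists (Num.min r (e / (K + 1))); first by rewrite lt_min r0 divr_gt0.
move=> x; rewrite le_min => /andP[xr xe].
have := Hr x 0 xr; rewrite p0 => /(_ (ltW r0)); rewrite subr0 => H.
rewrite -[F x - F 0](subrK (L x)); apply: le_trans (nrmD _ _) _.
apply: (@le_trans _ _ (1 * p x + K * p x)); first exact: lerD.
by rewrite -mulrDl [1 + K]addrC mulrC -ler_pdivlMr.
Qed.

Lemma sdiffM F G L L' : sdiff F L -> sdiff G L' ->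
  sdiff (fun x => F x *m G x) (fun x => L x *m G 0 + F 0 *m L' x).
Proof.
move=> sF sG; case: (sF) => -[K K0 HK] HF; case: (sG) => -[K' K'0 HK'] HG.
split.
  exists (K * nrm (G 0) + nrm (F 0) * K').
    by rewrite addr_ge0 // mulr_ge0 // nrm_ge0.
  move=> x; rewrite mulrDl; apply: le_trans (nrmD _ _) _; apply: lerD.
    rewrite mulrAC; apply: le_trans (nrmM _ _) _.
    by rewrite ler_wpM2r ?nrm_ge0.
  rewrite -mulrA; apply: le_trans (nrmM _ _) _.
  by rewrite ler_wpM2l ?nrm_ge0.
move=> c c0.
(* [N] dominates [K], [K'] and, near 0, the norms of both factors. With [e * N <= c / 4] each of the
   four error terms below takes a quarter of [c]. *)
pose N := nrm (G 0) + nrm (F 0) + K + K' + 1.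
have N1 : 1 <= N by rewrite lerDr !addr_ge0 // nrm_ge0.
have N0 : 0 < N by apply: lt_le_trans N1.
pose e := Num.min 1 (c / (4 * N)).
have e0 : 0 < e by rewrite lt_min ltr01 divr_gt0 // mulr_gt0.
have [r1 r10 H1] := sdiff_cvg sF e0; have [r2 r20 H2] := sdiff_cvg sG e0.
have [r3 r30 H3] := HF e e0; have [r4 r40 H4] := HG e e0.
exists (Num.min (Num.min r1 r2) (Num.min r3 r4)); first by rewrite !lt_min r10 r20 r30.
move=> x y; rewrite !le_min => /andP[/andP[x1 x2] /andP[x3 x4]].
move=> /andP[/andP[y1 y2] /andP[y3 y4]].
have e1 : e <= 1 by rewrite ge_min lexx.
have eN : e * N <= c / 4.
  rewrite -ler_pdivlMr // -mulrA -invfM ge_min; apply/orP; right.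
  by rewrite mulrC [4 * _]mulrC.
have GN : nrm (G x) <= N.
  rewrite -[G x](subrK (G 0)); apply: le_trans (nrmD _ _) _.
  apply: le_trans (lerD (H2 _ x2) (lexx _)) _; rewrite addrC.
  by apply: le_trans (lerD (lexx _) e1) _; rewrite /N; have := nrm_ge0 (F 0); lra.
have FN : nrm (F y) <= N.
  rewrite -[F y](subrK (F 0)); apply: le_trans (nrmD _ _) _.
  apply: le_trans (lerD (H1 _ y1) (lexx _)) _; rewrite addrC.
  by apply: le_trans (lerD (lexx _) e1) _; rewrite /N; have := nrm_ge0 (G 0); lra.
have KN : K <= N by rewrite /N; have := nrm_ge0 (F 0); have := nrm_ge0 (G 0); lra.
have K'N : K' <= N by rewrite /N; have := nrm_ge0 (F 0); have := nrm_ge0 (G 0); lra.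
set d := x - y.
rewrite (_ : _ - _ - _ = ((F x - F y - L d) *m G x + L d *m (G x - G 0))
    + (F y *m (G x - G y - L' d) + (F y - F 0) *m L' d)); last first.
  rewrite !mulmxBl !mulmxBr.
  move: (F x *m G x) (F y *m G x) (L d *m G x) (L d *m G 0) (F y *m G y)
    (F y *m L' d) (F 0 *m L' d) => a1 a2 a3 a4 a5 a6 a7.
  by apply/matrixP => i j; rewrite !mxE; ring.
have d0 := p_ge0 d.
have T1 : nrm ((F x - F y - L d) *m G x) <= c / 4 * p d.
  apply: le_trans (nrmM _ _) _.
  apply: (@le_trans _ _ (e * p d * N)); last by rewrite mulrAC ler_wpM2r.
  by apply: ler_pM; rewrite ?nrm_ge0 ?H3.
have T2 : nrm (L d *m (G x - G 0)) <= c / 4 * p d.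
  apply: le_trans (nrmM _ _) _.
  apply: (@le_trans _ _ (N * p d * e)).
    apply: ler_pM; rewrite ?nrm_ge0 ?H2 //; apply: le_trans (HK _) _.
    by rewrite ler_wpM2r.
  by rewrite mulrC mulrA ler_wpM2r.
have T3 : nrm (F y *m (G x - G y - L' d)) <= c / 4 * p d.
  apply: le_trans (nrmM _ _) _.
  apply: (@le_trans _ _ (N * (e * p d))).
    by apply: ler_pM; rewrite ?nrm_ge0 ?H4.
  by rewrite mulrA [N * e]mulrC ler_wpM2r.
have T4 : nrm ((F y - F 0) *m L' d) <= c / 4 * p d.
  apply: le_trans (nrmM _ _) _.
  apply: (@le_trans _ _ (e * (N * p d))).
    apply: ler_pM; rewrite ?nrm_ge0 ?H1 //; apply: le_trans (HK' _) _.
    by rewrite ler_wpM2r.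
  by rewrite mulrA ler_wpM2r.
apply: le_trans (nrmD _ _) _.
apply: le_trans (lerD (nrmD _ _) (nrmD _ _)) _.
by move: T1 T2 T3 T4; lra.
Qed.

Lemma sdiff_ext F G L L' : F =1 G -> L =1 L' -> sdiff F L -> sdiff G L'.
Proof. by move=> /funext -> /funext ->. Qed.

End StrictDiff.

Section StrictDiffComp.
Variables (R : realType) (n : nat) (T T' : zmodType) (p : T -> R) (p' : T' -> R).
Hypothesis p'_ge0 : forall x, 0 <= p' x.

Lemma sdiff_comp (F L : T -> 'M[R[i]]_n) (f : T' -> T) K :
  {morph f : x y / x - y} -> 0 <= K -> (forall x, p (f x) <= K * p' x) ->
  sdiff p F L -> sdiff p' (F \o f) (L \o f).
Proof.
move=> fB K0 Hf [[K1 K10 HL] HF]; split.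
  exists (K1 * K); first exact: mulr_ge0.
  by move=> x; apply: le_trans (HL _) _; rewrite -mulrA ler_wpM2l.
have K'0 : 0 < K + 1 by rewrite ltr_wpDl.
move=> c c0; have cK : 0 < c / (K + 1) by exact: divr_gt0.
have [r r0 Hr] := HF _ cK; exists (r / (K + 1)); first exact: divr_gt0.
have H x : p (f x) <= (K + 1) * p' x.
  by apply: le_trans (Hf x) _; rewrite ler_wpM2r // lerDl.
have Hx x : p' x <= r / (K + 1) -> p (f x) <= r.
  by rewrite ler_pdivlMr // mulrC => h; apply: le_trans (H x) h.
move=> x y /Hx xr /Hx yr; rewrite /= fB; apply: le_trans (Hr _ _ xr yr) _.
rewrite -fB mulrAC ler_pdivrMr // -mulrA ler_pM2l // [_ * (K + 1)]mulrC.
exact: H.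
Qed.
End StrictDiffComp.

Section FlowDiff.
Variables (R : realType) (n : nat).
Local Notation C := R[i].
Implicit Types (A B M X Y : 'M[C]_n) (U V : R -> 'M[C]_n).

(** The group law [U x = U y *m U (x - y)] reduces strict differentiability to the derivative at 0
    and to the continuity of [U] there. *)
Lemma flow_sdiff U M : unitary_flow U M ->
  sdiff (fun s : R => `|s|) U (fun s => s%:C%C *: M).
Proof.
move=> HU; split.
  by exists (nrm M); rewrite ?nrm_ge0 // => s; rewrite nrmZ mulrC.
pose K := @unitary_bound R n; have K0 : 0 < K by exact: unitary_bound_gt0.
move=> c c0; pose c' := c / (K * 2).
have c'0 : 0 < c' by rewrite divr_gt0 // mulr_gt0.
pose N := nrm M + 1; have N0 : 0 < N by rewrite ltr_wpDl ?nrm_ge0.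
pose c1 := Num.min 1 (c / (2 * N)).
have c10 : 0 < c1 by rewrite lt_min ltr01 divr_gt0 // mulr_gt0.
have [r r0 Hr] := flow_diff0 HU c'0.
have [r1 r10 Hr1] := flow_diff0 HU ltr01.
exists (Num.min (r / 2) (Num.min r1 (c1 / N))).
  by rewrite !lt_min r10 !divr_gt0.
move=> x y; rewrite !le_min => /andP[xr /andP[xr1 xe]] /andP[yr /andP[yr1 ye]].
have dr : `|x - y| <= r by rewrite [r]splitr; apply: le_trans (ler_normB _ _) (lerD xr yr).
set d := x - y in dr *.
have Ux : U x = U y *m U d by rewrite -(flowD HU) /d addrC subrK.
rewrite (_ : _ - _ - _ = U y *m (U d - 1%:M - d%:C%C *: M) + (U y - 1%:M) *m (d%:C%C *: M));
    last first.
  rewrite Ux !mulmxBr !mulmxBl mulmx1 !mul1mx.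
  move: (U y *m U d) (U y *m _) (_ *: M) => a1 a2 a3.
  by apply/matrixP => i j; rewrite !mxE; ring.
have d0 : 0 <= `|d| by [].
apply: le_trans (nrmD _ _) _; rewrite [c]splitr mulrDl; apply: lerD.
  apply: le_trans (nrm_unitaryMl _ (flow_unitary HU y)) _; rewrite -/K.
  apply: (@le_trans _ _ (K * (c' * `|d|))); first by rewrite ler_pM2l // Hr.
  have -> : c' = c / 2 / K by rewrite /c' invfM mulrA mulrAC.
  by rewrite mulrA [K * _]mulrC divfK ?gt_eqF.
apply: le_trans (nrmM _ _) _; rewrite nrmZ.
have Uy : nrm (U y - 1%:M) <= c1.
  rewrite -[U y - _](subrK (y%:C%C *: M)); apply: le_trans (nrmD _ _) _.
  rewrite nrmZ; apply: le_trans (lerD (Hr1 _ yr1) (lexx _)) _.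
  by rewrite [1 * _]mulrC -mulrDr [1 + _]addrC -ler_pdivlMr.
have c1N : c1 * N <= c / 2.
  rewrite -ler_pdivlMr // -mulrA -invfM ge_min; apply/orP; right.
  by [].
apply: (@le_trans _ _ (c1 * (`|d| * N))).
  apply: ler_pM; rewrite ?nrm_ge0 ?mulr_ge0 ?nrm_ge0 // ler_wpM2l //.
  by rewrite lerDl.
by rewrite mulrCA [leLHS]mulrC ler_wpM2r.
Qed.

Lemma sdiff_at0 (F L : R -> 'M[C]_n) c : sdiff (fun s : R => `|s|) F L -> 0 < c ->
  exists2 r, 0 < r & forall s, `|s| <= r -> nrm (F s - F 0 - L s) <= c * `|s|.
Proof.
case=> _ H c0; have [r r0 Hr] := H c c0; exists r => // s sr.
by have := Hr s 0 sr; rewrite subr0 normr0 => /(_ (ltW r0)).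
Qed.

Lemma flow_mul_diff U V A B c : unitary_flow U A -> unitary_flow V B -> 0 < c ->
  exists2 r, 0 < r & forall s, `|s| <= r ->
    nrm (U s *m V s - 1%:M - s%:C%C *: (A + B)) <= c * `|s|.
Proof.
move=> HU HV c0.
have [r r0 Hr] := sdiff_at0 (sdiffM (normr0 R) (@normr_ge0 R R) (flow_sdiff HU) (flow_sdiff HV)) c0.
exists r => // s /Hr; rewrite (flow0 HU) (flow0 HV) mulmx1 mul1mx mulmx1.
by rewrite scalerDr.
Qed.

(** Product rule for [U s *m Y *m U (- s)], the adjoint being the flow at the opposite time. *)
Lemma flow_Ad_diff U X Y c : unitary_flow U X -> 0 < c ->
  exists2 r, 0 < r & forall s, `|s| <= r ->
    nrm (U s *m Y *m mx_adj (U s) - Y - s%:C%C *: bracket X Y) <= c * `|s|.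
Proof.
move=> HU c0; have sU := flow_sdiff HU.
have n0 := normr0 R; have ng := @normr_ge0 R R.
have sUN : sdiff (fun s : R => `|s|) (U \o -%R) ((fun s => s%:C%C *: X) \o -%R).
  apply: (sdiff_comp ng _ ler01 _ sU) => [x y|x]; first by rewrite opprB opprK addrC.
  by rewrite mul1r normrN.
have [r r0 Hr] := sdiff_at0
  (sdiffM n0 ng (sdiffM n0 ng sU (sdiff_cst ng Y)) sUN) c0.
exists r => // s /Hr; rewrite /= oppr0 (flow0 HU) !mul1mx !mulmx1 addr0.
rewrite -(flowN HU) /bracket scalerBr rmorphN scaleNr mulmxN.
by rewrite -scalemxAl -scalemxAr.
Qed.

End FlowDiff.

(** * The closure of a semigroup of unitary matrices *)

Section Recurrence.
Variables (R : realType) (n : nat).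
Local Notation C := R[i].
Implicit Types (X Y : 'M[C]_n).

(** Grid cell of width [2 / N] in [[-1, 1]]; the endpoint 1 falls into the extra cell of index
    [N]. *)
Let cell N (x : R) : 'I_N.+1 := inord (Num.truncn ((x + 1) / 2 * N%:R)).

Local Lemma cell_dist N (x y : R) : (0 < N)%N -> `|x| <= 1 -> `|y| <= 1 ->
  cell N x = cell N y -> `|x - y| <= 2 / N%:R.
Proof.
move=> N0 x1 y1; have NR : 0 < N%:R :> R by rewrite ltr0n.
have B (z : R) : `|z| <= 1 -> 0 <= (z + 1) / 2 * N%:R <= N%:R.
  rewrite ler_norml => /andP[z1 z2]; apply/andP; split.
    by rewrite mulr_ge0 // divr_ge0 // -lerBlDr sub0r.
  rewrite -[leRHS]mul1r ler_pM2r // ler_pdivrMr // mul1r.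
  by rewrite -[2]/(1 + 1) lerD2r.
have T (z : R) : `|z| <= 1 -> (Num.truncn ((z + 1) / 2 * N%:R) < N.+1)%N.
  move=> /B/andP[z0 zN]; rewrite ltnS -(ler_nat R); apply: le_trans zN.
  by have /andP[] := truncn_itv z0.
move=> /(congr1 val) /=; rewrite !inordK ?T // => E.
have /andP[x0 _] := B _ x1; have /andP[y0 _] := B _ y1.
have /andP[xa xb] := truncn_itv x0; have /andP[ya yb] := truncn_itv y0.
move: xa xb ya yb; rewrite E -[(Num.truncn _).+1%:R]natr1; move: (Num.truncn _)%:R => q xa xb ya yb.
rewrite ler_pdivlMr // -[`|_| * _](mulfVK (x := 2)) ?pnatr_eq0 //.
rewrite -[leRHS]mul1r ler_pM2r // -mulrA -[N%:R / 2]ger0_norm ?divr_ge0 // -normrM.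
by rewrite ler_norml; apply/andP; split; move: xa xb ya yb; lra.
Qed.

(** Pigeonhole: two powers [U ^ a] and [U ^ b], [a < b], have all entries in the same cells, and
    multiplying their difference by the inverse of [U ^ a] preserves smallness. The exponent is
    positive, which is what [adherent_adj] needs. *)
Lemma unitary_recurrence (U : 'M[C]_n) e : unitary U -> 0 < e ->
  exists k, nrm (mxpow U k.+1 - 1%:M) <= e.
Proof.
move=> uU e0; pose K := @unitary_bound R n; have K0 : 0 < K := unitary_bound_gt0 R n.
have [N N0 HN] : exists2 N : nat, (0 < N)%N & K * (\sum_(i < n) \sum_(j < n) (2 / N%:R + 2 / N%:R)) <= e.
  have [N N0 HN] := @nat_large R (K * (\sum_(i < n) \sum_(j < n) 4)) e e0.
  exists N => //; apply: le_trans HN; apply: le_trans (ler_norm _).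
  rewrite -mulrA mulr_suml ler_pM2l // le_eqVlt; apply/orP; left; apply/eqP.
  apply: eq_bigr => i _; rewrite mulr_suml; apply: eq_bigr => j _.
  by rewrite -mulrDl; congr (_ / _); rewrite -natrD.
pose f (k : nat) : {ffun 'I_n * 'I_n -> 'I_N.+1 * 'I_N.+1} :=
  [ffun ij => (cell N (complex.Re (mxpow U k ij.1 ij.2)), cell N (complex.Im (mxpow U k ij.1 ij.2)))].
pose m := #|{: {ffun 'I_n * 'I_n -> 'I_N.+1 * 'I_N.+1}}|.
have [a [b [ab fab]]] : exists a b : nat, (a < b)%N /\ f a = f b.
  apply: contrapT => H.
  have inj : injective (fun k : 'I_m.+1 => f k).
    move=> a b fab; apply/val_inj => /=; case: (ltngtP a b) => // ab; exfalso; apply: H.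
      by exists a, b.
    by exists b, a.
  by have := leq_card _ inj; rewrite card_ord ltnn.
exists (b - a).-1; rewrite prednK ?subn_gt0 //.
have uX k : unitary (mxpow U k) by exact: unitary_mxpow.
have -> : mxpow U (b - a) - 1%:M = mx_adj (mxpow U a) *m (mxpow U b - mxpow U a).
  by rewrite mulmxBr -{2}(subnKC (ltnW ab)) mxpowD mulmxA uX mul1mx.
apply: le_trans (nrm_unitaryMl _ (unitary_adj (uX a))) _; apply: le_trans HN.
rewrite ler_pM2l //; apply: ler_sum => i _; apply: ler_sum => j _; rewrite !mxE.
have /ffunP/(_ (i, j)) := fab; rewrite !ffunE /= => -[E1 E2].
have B k : `|complex.Re (mxpow U k i j)| <= 1 /\ `|complex.Im (mxpow U k i j)| <= 1.
  have := unitary_entry i j (uX k); move: (complex.Re _) (complex.Im _) => x y xy.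
  split; rewrite -(@ler_pXn2r _ 2) ?nnegrE // expr1n real_normK ?num_real //.
    by apply: le_trans xy; rewrite lerDl sqr_ge0.
  by apply: le_trans xy; rewrite lerDr sqr_ge0.
have [B1 B2] := B a; have [B3 B4] := B b.
have := cell_dist N0 B3 B1 (esym E1); have := cell_dist N0 B4 B2 (esym E2).
case: (mxpow U b i j) (mxpow U a i j) => [x y] [x' y'] /= H1 H2.
by rewrite /cnorm /= lerD.
Qed.

Implicit Types (M A B g : 'M[C]_n) (U V W : R -> 'M[C]_n).

Variables (S : 'M[C]_n -> Prop) (S1 : S 1%:M)
  (SM : forall X Y, S X -> S Y -> S (X *m Y)) (Su : forall X, S X -> unitary X).

Definition adherent X := forall e, 0 < e -> exists2 Y, S Y & nrm (X - Y) <= e.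

Lemma adherent_sub X : S X -> adherent X.
Proof. by move=> SX e e0; exists X; rewrite // subrr nrm0 ltW. Qed.

Lemma adherent_closed X :
  (forall e, 0 < e -> exists2 Y, adherent Y & nrm (X - Y) <= e) -> adherent X.
Proof.
move=> H e e0; have e20 : 0 < e / 2 by rewrite divr_gt0.
have [Y aY XY] := H _ e20; have [Z SZ YZ] := aY _ e20; exists Z => //.
rewrite [X - Z](_ : _ = (X - Y) + (Y - Z)); last by rewrite addrA subrK.
by apply: le_trans (nrmD _ _) _; rewrite [e]splitr lerD.
Qed.

Lemma adherentM X X' : adherent X -> adherent X' -> adherent (X *m X').
Proof.
move=> aX aX' e e0.
pose N := nrm X' + unitary_bound R n.
have N0 : 0 < N by rewrite ltr_wpDl ?nrm_ge0 ?unitary_bound_gt0.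
have eN : 0 < e / N by rewrite divr_gt0.
have [Y SY XY] := aX _ eN; have [Y' SY' XY'] := aX' _ eN.
exists (Y *m Y'); first exact: SM.
rewrite (_ : _ - _ = (X - Y) *m X' + Y *m (X' - Y')); last first.
  by rewrite mulmxBl mulmxBr addrA subrK.
apply: le_trans (nrmD _ _) _.
apply: (@le_trans _ _ (e / N * nrm X' + unitary_bound R n * (e / N))).
  apply: lerD.
    by apply: le_trans (nrmM _ _) _; rewrite ler_wpM2r ?nrm_ge0.
  apply: le_trans (nrm_unitaryMl _ (Su SY)) _.
  by rewrite ler_pM2l ?unitary_bound_gt0.
by rewrite [_ * (e / N)]mulrC -mulrDr divfK // gt_eqF.
Qed.

Lemma adherent_mxpow X k : adherent X -> adherent (mxpow X k).
Proof.
move=> aX; elim: k => [|k IH]; first exact: adherent_sub.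
by rewrite mxpowS; apply: adherentM.
Qed.

(** If [Y] in [S] approximates [X] and [Y ^ k.+1] is close to 1, then [Y ^ k], again in [S], is
    close to the inverse of [Y]. *)
Lemma adherent_adj X : adherent X -> adherent (mx_adj X).
Proof.
move=> aX e e0; have K0 := unitary_bound_gt0 R n.
have e20 : 0 < e / 2 by rewrite divr_gt0.
have [Y SY XY] := aX _ e20.
have [k Hk] := unitary_recurrence (Su SY) (divr_gt0 e20 K0).
exists (mxpow Y k).
  by elim: k {Hk} => [//|k IH]; rewrite mxpowS; apply: SM.
rewrite (_ : _ - _ = mx_adj (X - Y) + mx_adj Y *m (1%:M - mxpow Y k.+1)); last first.
  by rewrite mx_adjD mx_adjN mulmxBr mulmx1 mxpowS mulmxA (Su SY) mul1mx addrA subrK.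
apply: le_trans (nrmD _ _) _; rewrite nrm_adj [e]splitr; apply: lerD => //.
apply: le_trans (nrm_unitaryMl _ (unitary_adj (Su SY))) _.
by rewrite mulrC -ler_pdivlMr // nrm_subC.
Qed.

(** All real times are required, as for the Lie algebra of a group; [tangentP] recovers negative
    times from [adherent_adj]. By [flow_unique] the quantifier over [U] ranges over a single
    flow. *)
Definition tangent M := mx_adj M = - M /\
  forall U, unitary_flow U M -> forall t, adherent (U t).

Lemma tangentP U M : mx_adj M = - M -> unitary_flow U M ->
  (forall t, 0 <= t -> adherent (U t)) -> tangent M.
Proof.
move=> Ms HU aU; split=> // V HV t; rewrite (flow_unique t HV HU).
have [t0|t0] := leP 0 t; first exact: aU.
rewrite -[t]opprK (flowN HU); apply/adherent_adj/aU.
by rewrite oppr_ge0 ltW.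
Qed.

Lemma flow_scale U M (a : R) : unitary_flow U M ->
  unitary_flow (fun t => U (a * t)) (a%:C%C *: M).
Proof.
move=> HU; split.
- by move=> t; exact: flow_unitary HU _.
- by move=> s t; rewrite mulrDr (flowD HU).
move=> c c0; have a1 : 0 < `|a| + 1 by rewrite ltr_wpDl.
have [r r0 Hr] := flow_diff0 HU (divr_gt0 c0 a1).
exists (r / (`|a| + 1)) => [|s sr]; first exact: divr_gt0.
have H : `|a * s| <= (`|a| + 1) * `|s|.
  by rewrite normrM ler_wpM2r // lerDl.
have := Hr (a * s); rewrite scalerA [s%:C%C * _]mulrC -rmorphM => {}Hr.
apply: le_trans (Hr _) _; first by apply: le_trans H _; rewrite mulrC -ler_pdivlMr.
rewrite mulrAC ler_pdivrMr // -mulrA ler_pM2l // [_ * (_ + 1)]mulrC.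
exact: H.
Qed.

Lemma flow_conj U M g : unitary g -> unitary_flow U M ->
  unitary_flow (fun t => g *m U t *m mx_adj g) (g *m M *m mx_adj g).
Proof.
move=> ug HU; split.
- by move=> t; apply: unitaryM; [apply: unitaryM => //; exact: flow_unitary HU _|exact: unitary_adj].
- move=> s t; rewrite (flowD HU) !mulmxA -[_ *m mx_adj g *m g]mulmxA ug mulmx1.
  by [].
move=> c c0; have K0 := unitary_bound_gt0 R n.
have KK : 0 < unitary_bound R n ^+ 2 by rewrite exprn_gt0.
have [r r0 Hr] := flow_diff0 HU (divr_gt0 c0 KK).
exists r => // s /Hr {}Hr.
rewrite (_ : _ - _ - _ = g *m (U s - 1%:M - s%:C%C *: M) *m mx_adj g); last first.
  rewrite !mulmxBr !mulmxBl mulmx1 (unitary_mulVC ug); congr (_ - _).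
  by rewrite -!scalemxAr -scalemxAl.
apply: le_trans (nrm_unitaryMr _ (unitary_adj ug)) _.
apply: (@le_trans _ _ (unitary_bound R n * (unitary_bound R n * (c / unitary_bound R n ^+ 2 * `|s|)))).
  rewrite ler_pM2l //; apply: le_trans (nrm_unitaryMl _ ug) _.
  by rewrite ler_pM2l.
rewrite !mulrA -expr2 [_ * c]mulrC -[c * _ / _]mulrA divff ?mulr1 //.
by rewrite gt_eqF.
Qed.

Lemma tangentZ (a : R) M : tangent M -> tangent (a%:C%C *: M).
Proof.
move=> [Ms aM]; have [U HU] := flow_exists Ms; split.
  by rewrite mx_adjZ conjc_real Ms scalerN.
move=> V HV t; rewrite (flow_unique t HV (flow_scale a HU)).
exact: aM HU _.
Qed.

Lemma tangent_Ad g M : unitary g -> adherent g -> tangent M -> tangent (g *m M *m mx_adj g).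
Proof.
move=> ug ag [Ms aM]; have [U HU] := flow_exists Ms; split.
  by rewrite !mx_adjM mx_adjK Ms !mulmxA mulmxN mulNmx.
move=> V HV t; rewrite (flow_unique t HV (flow_conj ug HU)).
by apply: adherentM; [apply: adherentM => //; exact: aM HU _|exact: adherent_adj].
Qed.

(** The flow at a fixed time depends continuously on its generator, by [flow_dist], and the closure
    of [S] is closed. *)
Lemma tangent_closed M : mx_adj M = - M ->
  (forall e, 0 < e -> exists2 M', tangent M' & nrm (M - M') <= e) -> tangent M.
Proof.
move=> Ms H; split=> // U HU t; apply: adherent_closed => e e0.
pose N := unitary_bound R n ^+ 2 * (`|t| + 1).
have KK : 0 < unitary_bound R n ^+ 2 by rewrite exprn_gt0 // unitary_bound_gt0.
have N0 : 0 < N by rewrite mulr_gt0 // ltr_wpDl.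
have [M' [Ms' aM'] MM'] := H _ (divr_gt0 e0 N0).
have [V HV] := flow_exists Ms'; exists (V t); first exact: aM' HV _.
apply: le_trans (flow_dist t HU HV) _.
apply: (@le_trans _ _ (N * (e / N))); last by rewrite mulrC divfK ?gt_eqF.
rewrite mulrA; apply: ler_pM; [by rewrite mulr_ge0 // ltW|exact: nrm_ge0| |exact: MM'].
by rewrite /N ler_pM2l // lerDl.
Qed.

Lemma tangentD A B : tangent A -> tangent B -> tangent (A + B).
Proof.
move=> [As aA] [Bs aB].
have ABs : mx_adj (A + B) = - (A + B) by rewrite mx_adjD As Bs opprD.
have [U HU] := flow_exists As; have [V HV] := flow_exists Bs.
have [W HW] := flow_exists ABs.
split=> // W' HW' t; rewrite (flow_unique t HW' HW) => {W' HW'}.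
apply: adherent_closed => e e0.
have KK : 0 < unitary_bound R n ^+ 2 by rewrite exprn_gt0 // unitary_bound_gt0.
(* [N] collects the telescoping constant, the total time, and a factor 2 for the two flows compared
   with the first-order expansion [1 + s (A + B)]. *)
pose N := unitary_bound R n ^+ 2 * (`|t| + 1) * 2.
have N0 : 0 < N by rewrite !mulr_gt0 // ltr_wpDl.
have c0 : 0 < e / N by rewrite divr_gt0.
have [r1 r10 H1] := flow_mul_diff HU HV c0.
have [r2 r20 H2] := flow_diff0 HW c0.
have [|k k0 Hk] := @nat_large R t (Num.min r1 r2); first by rewrite lt_min r10.
have kR : 0 < k%:R :> R by rewrite ltr0n.
move: Hk; set s := t / k%:R; have tE : t = k%:R * s by rewrite mulrC divfK ?gt_eqF.
clearbody s; rewrite le_min => /andP[/H1 {}H1 /H2 {}H2].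
exists (mxpow (U s *m V s) k).
  by apply/adherent_mxpow/adherentM; [exact: aA HU _|exact: aB HV _].
rewrite tE (flow_mxpow HW).
have uUV : unitary (U s *m V s).
  by apply: unitaryM; [exact: flow_unitary HU _|exact: flow_unitary HV _].
apply: le_trans (nrm_mxpowB _ (flow_unitary HW s) uUV) _.
have Hs : nrm (W s - U s *m V s) <= e / N * `|s| * 2.
  rewrite (_ : W s - _ = (W s - 1%:M - s%:C%C *: (A + B))
     - (U s *m V s - 1%:M - s%:C%C *: (A + B))); last first.
    by move: (U s *m V s) (s%:C%C *: _) => a1 a2; apply/matrixP=> i j; rewrite !mxE; ring.
  apply: le_trans (nrmB _ _) _; rewrite mulr_natr mulr2n.
  exact: lerD.
apply: (@le_trans _ _ (k%:R * (unitary_bound R n ^+ 2 * (e / N * `|s| * 2)))).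
  by rewrite ler_pM2l // ler_pM2l.
apply: (@le_trans _ _ (N * (e / N))); last by rewrite mulrC divfK ?gt_eqF.
rewrite [leLHS](_ : _ = unitary_bound R n ^+ 2 * `|t| * 2 * (e / N)); last first.
  by rewrite tE normrM (ger0_norm (ltW kR)); move: (e / N) => q; ring.
rewrite ler_pM2r // /N ler_pM2r // ler_pM2l // lerDl //.
Qed.

Lemma tangentB A B : tangent A -> tangent B -> tangent (A - B).
Proof.
move=> tA tB; rewrite -scaleN1r -[-1](rmorphN1 (real_complex R)).
by apply: tangentD => //; apply: tangentZ.
Qed.

Lemma skew_bracket A B : mx_adj A = - A -> mx_adj B = - B ->
  mx_adj (bracket A B) = - bracket A B.
Proof.
move=> As Bs; rewrite /bracket mx_adjD mx_adjN !mx_adjM As Bs.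
by rewrite !mulmxN !mulNmx !opprK opprB.
Qed.

(** The difference quotients [(Ad (U r) B - B) / r] are tangent and approach the bracket. *)
Lemma tangent_bracket A B : tangent A -> tangent B -> tangent (bracket A B).
Proof.
move=> tA tB; have [[As aA] [Bs aB]] := (tA, tB).
apply: tangent_closed; first exact: skew_bracket.
move=> e e0; have [U HU] := flow_exists As.
have [r r0 Hr] := flow_Ad_diff B HU e0.
exists ((r^-1)%:C%C *: (U r *m B *m mx_adj (U r) - B)).
  apply: tangentZ; apply: tangentB => //; apply: tangent_Ad => //.
    exact: flow_unitary HU _.
  exact: aA HU _.
have rC : (r^-1)%:C%C * r%:C%C = 1 :> C by rewrite -rmorphM mulVf ?rmorph1 // gt_eqF.
rewrite nrm_subC (_ : _ - _ = (r^-1)%:C%C *: (U r *m B *m mx_adj (U r) - B - r%:C%C *: bracket A B)).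
  rewrite nrmZ ger0_norm ?invr_ge0 ?(ltW r0) // mulrC ler_pdivrMr //.
  by apply: le_trans (Hr r _) _; rewrite ger0_norm // ltW.
by rewrite [RHS]scalerBr scalerA rC scale1r.
Qed.

Lemma tangent_lie : real_lie_algebra tangent.
Proof.
by split; [exact: tangentD|exact: tangentZ|exact: tangent_bracket].
Qed.

Lemma adherent_SU : (0 < n)%N -> (forall M, in_su M -> tangent M) ->
  forall Y, in_SU Y -> adherent Y.
Proof.
move=> n0 H Y /(SU_flow n0)[U [M [/H[_ aM] HU ->]]].
exact: aM.
Qed.

End Recurrence.

(** * Interior points *)

Section LocalSurjectivity.
Variable R : realType.

Lemma le0_geometric (q K : R) : (forall k, q <= K / 2 ^+ k) -> q <= 0.
Proof.
move=> H; rewrite leNgt; apply/negP => q0.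
have q20 : 0 < q / 2 by rewrite divr_gt0.
have [k k0 Hk] := nat_large K q20.
have kR : 0 < k%:R :> R by rewrite ltr0n.
have p0 : 0 < 2 ^+ k :> R by rewrite exprn_gt0.
have kp : k%:R <= 2 ^+ k :> R by rewrite -natrX ler_nat ltnW // ltn_expl.
have : q <= q / 2.
  apply: le_trans Hk; apply: le_trans (H k) _.
  rewrite normrM normfV (ger0_norm (ltW kR)).
  apply: (@le_trans _ _ (`|K| / 2 ^+ k)); first by rewrite ler_pM2r ?invr_gt0 ?ler_norm.
  by rewrite ler_wpM2l // lef_pV2 ?posrE.
by move: q0; lra.
Qed.

(** With [g k = 2 d / 2 ^ k], whose decrements are exactly the allowed steps, [x - g] increases and
    [x + g] decreases; the supremum of the former is the limit. *)
Lemma geometric_limit (x : nat -> R) d :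
  (forall k, `|x k.+1 - x k| <= d / 2 ^+ k) ->
  exists a, forall k, `|x k - a| <= 2 * d / 2 ^+ k.
Proof.
move=> H.
pose g k : R := 2 * d / 2 ^+ k.
have gS k : g k - g k.+1 = d / 2 ^+ k.
  have p0 : 2 ^+ k != 0 :> R by rewrite expf_neq0 // pnatr_eq0.
  by rewrite /g exprS; field.
have y_ndec k l : x k - g k <= x (k + l)%N - g (k + l)%N.
  elim: l => [|l IH]; first by rewrite addn0.
  apply: le_trans IH _; rewrite addnS.
  have := H (k + l)%N; rewrite -gS ler_norml => /andP[].
  by lra.
have z_ninc k l : x (k + l)%N + g (k + l)%N <= x k + g k.
  elim: l => [|l IH]; first by rewrite addn0.
  apply: le_trans IH; rewrite addnS.
  have := H (k + l)%N; rewrite -gS ler_norml => /andP[].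
  by lra.
have g0 k : 0 <= g k.
  have d0 : 0 <= d by have := le_trans (normr_ge0 _) (H 0%N); rewrite expr0 divr1.
  by rewrite /g divr_ge0 ?mulr_ge0 ?exprn_ge0.
have yz k l : x k - g k <= x l + g l.
  apply: le_trans (y_ndec k l) _; apply: le_trans (z_ninc l k); rewrite addnC.
  by have := g0 (l + k)%N; lra.
pose E := [set x k - g k | k in [set: nat]].
have supE : has_sup E.
  split; first by exists (x 0%N - g 0%N), 0%N.
  by exists (x 0%N + g 0%N) => _ [k _ <-].
exists (sup E) => k; rewrite -/(g k) ler_norml; apply/andP; split.
  have : sup E <= x k + g k by apply: ge_sup => [|_ [l _ <-]]; [by case: supE|].
  by lra.
have : x k - g k <= sup E by apply: sup_upper_bound => //; exists k.
by lra.
Qed.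

Variable n : nat.
Local Notation C := R[i].
Implicit Types A Z : 'M[C]_n.

Lemma geometric_limit_mx (X : nat -> 'M[C]_n) d :
  (forall k, nrm (X k.+1 - X k) <= d / 2 ^+ k) ->
  exists A, exists2 K, 0 <= K & forall k, nrm (X k - A) <= K / 2 ^+ k.
Proof.
move=> H.
have e k i j : cnorm (X k.+1 i j - X k i j) <= d / 2 ^+ k.
  by have := le_trans (cnorm_le_nrm _ i j) (H k); rewrite !mxE.
have /choice[a Ha] : forall ij : 'I_n * 'I_n, exists a, forall k,
    `|complex.Re (X k ij.1 ij.2) - a| <= 2 * d / 2 ^+ k.
  move=> [i j]; apply: geometric_limit => k; apply: le_trans (e k i j).
  by case: (X k.+1 i j) (X k i j) => [? ?] [? ?]; rewrite /cnorm /= lerDl.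
have /choice[b Hb] : forall ij : 'I_n * 'I_n, exists a, forall k,
    `|complex.Im (X k ij.1 ij.2) - a| <= 2 * d / 2 ^+ k.
  move=> [i j]; apply: geometric_limit => k; apply: le_trans (e k i j).
  by case: (X k.+1 i j) (X k i j) => [? ?] [? ?]; rewrite /cnorm /= lerDr.
have d0 : 0 <= d by have := le_trans (nrm_ge0 _) (H 0%N); rewrite expr0 divr1.
exists (\matrix_(i, j) (a (i, j) +i* b (i, j))%C).
exists (\sum_(i < n) \sum_(j < n) (2 * d + 2 * d)).
  by apply: sumr_ge0 => i _; apply: sumr_ge0 => j _; rewrite addr_ge0 ?mulr_ge0.
move=> k; rewrite mulr_suml; apply: ler_sum => i _; rewrite mulr_suml.
apply: ler_sum => j _; rewrite !mxE mulrDl.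
have := Ha (i, j) k; have := Hb (i, j) k => /=.
by case: (X k i j) => u v /= Hu Hv; rewrite /cnorm /=; apply: lerD.
Qed.

(** Iterate [A |-> A + (Z - Phi A)] from 0. Near 0 this map contracts by 1/2, because the strict
    derivative of [Phi] is the identity, and its fixed points solve [Phi A = Z]. *)
Lemma local_surjectivity (Phi : 'M[C]_n -> 'M[C]_n) r :
  sdiff (@nrm R n) Phi id -> 0 < r ->
  exists2 e, 0 < e & forall Z, nrm (Z - Phi 0) <= e ->
    exists2 A, nrm A <= r & Phi A = Z.
Proof.
case=> _ H r0; have h0 : (0 : R) < 1 / 2 by rewrite divr_gt0.
have [r1 r10 Hr1] := H _ h0.
pose r2 := Num.min r r1; have r20 : 0 < r2 by rewrite lt_min r0.
have lip A B : nrm A <= r2 -> nrm B <= r2 ->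
    nrm (Phi A - Phi B - (A - B)) <= 1 / 2 * nrm (A - B).
  rewrite !le_min => /andP[_ A1] /andP[_ B1]; exact: Hr1.
exists (r2 / 2) => [|Z HZ]; first by rewrite divr_gt0.
pose d := r2 / 2.
pose X k := iter k (fun A => A + (Z - Phi A)) 0.
have XS k : X k.+1 = X k + (Z - Phi (X k)) by [].
have p0 k : 0 < 2 ^+ k :> R by rewrite exprn_gt0.
(* The first step is at most [d = r2 / 2] and each step halves, so the partial sums stay within the
   radius [2 * d = r2] where the contraction estimate holds. The two bounds need each other. *)
have XB k : nrm (X k) <= 2 * d * (1 - (2 ^+ k)^-1) /\ nrm (X k.+1 - X k) <= d / 2 ^+ k.
  elim: k => [|k [IH1 IH2]].
    split; first by rewrite /X /= nrm0 expr0 invr1 subrr mulr0.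
    by rewrite XS /X /= expr0 divr1 add0r subr0.
  have dE : r2 = 2 * d by rewrite /d mulrC divfK ?pnatr_eq0.
  have B1 : nrm (X k.+1) <= 2 * d * (1 - (2 ^+ k.+1)^-1).
    rewrite -[X k.+1](subrK (X k)); apply: le_trans (nrmD _ _) _.
    apply: le_trans (lerD IH2 IH1) _; rewrite exprS invfM.
    by move: ((2 ^+ k)^-1) => q; lra.
  have d0 : 0 < d by rewrite /d divr_gt0.
  have small l : 2 * d * (1 - (2 ^+ l)^-1) <= r2.
    by rewrite dE -[leRHS]mulr1 ler_pM2l ?mulr_gt0 // lerBlDr lerDl invr_ge0 ltW.
  split=> //.
  have -> : X k.+2 - X k.+1 = - (Phi (X k.+1) - Phi (X k) - (X k.+1 - X k)).
    have ZE : Z = X k.+1 - X k + Phi (X k) by rewrite XS [X k + _]addrC addrK subrK.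
    rewrite [X k.+2]XS {1}ZE.
    move: (Phi (X k.+1)) (Phi (X k)) (X k.+1) (X k) => P1 P2 X1 X0.
    by apply/matrixP => i j; rewrite !mxE; ring.
  rewrite nrmN; apply: le_trans (lip _ _ _ _) _.
  - by apply: le_trans B1 _.
  - by apply: le_trans IH1 _.
  apply: (@le_trans _ _ (1 / 2 * (d / 2 ^+ k))); first by rewrite ler_pM2l.
  by rewrite exprS invfM mul1r [leRHS]mulrCA.
have [A [K K0 HK]] := geometric_limit_mx (fun k => (XB k).2).
have Xr2 k : nrm (X k) <= r2.
  apply: le_trans (XB k).1 _; rewrite /d.
  have : 0 <= (2 ^+ k)^-1 :> R by rewrite invr_ge0 ltW.
  by move: ((2 ^+ k)^-1) r20 => q; nra.
have Ar2 : nrm A <= r2.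
  rewrite -subr_le0; apply: (le0_geometric (K := K)) => k.
  rewrite lerBlDl; apply: (@le_trans _ _ (nrm (X k) + nrm (A - X k))).
    by apply: le_trans (nrmD _ _); rewrite addrC subrK.
  by rewrite nrm_subC; apply: lerD.
exists A; first by apply: le_trans Ar2 _; rewrite ge_min lexx.
apply/subr0_eq/nrm_eq0; apply: (le0_geometric (K := 2 * K + d)) => k.
have -> : Phi A - Z = (Phi A - Phi (X k) - (A - X k)) + ((A - X k) - (X k.+1 - X k)).
  by rewrite XS; move: (Phi A) (Phi (X k)) (X k) => P1 P2 X0; apply/matrixP => i j; rewrite !mxE; ring.
apply: le_trans (nrmD _ _) _.
apply: le_trans (lerD (lip _ _ Ar2 (Xr2 k)) (nrmB _ _)) _.
have := HK k; have := (XB k).2; rewrite (nrm_subC A) mulrDl -mulrA.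
have := nrm_ge0 (X k - A); lra.
Qed.

End LocalSurjectivity.

(** * Real coordinates of complex matrices *)

Section Vectorization.
Variables (R : realType) (n : nat).
Local Notation C := R[i].
Local Notation D := (n * n + n * n)%N.
Implicit Types (A B : 'M[C]_n).

(** Rank and row spaces are taken over [R], since [su(n)] is only a real subspace of the complex
    matrices. *)
Definition cvec A : 'rV[R]_D :=
  row_mx (mxvec (map_mx (@complex.Re R) A)) (mxvec (map_mx (@complex.Im R) A)).

Definition uncvec (v : 'rV[R]_D) : 'M[C]_n :=
  \matrix_(i, j) (vec_mx (lsubmx v) i j +i* vec_mx (rsubmx v) i j)%C.

Lemma cvecK : cancel cvec uncvec.
Proof.
move=> A; apply/matrixP => i j.
by rewrite mxE row_mxKl row_mxKr !mxvecK !mxE; case: (A i j).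
Qed.

Lemma cvecD A B : cvec (A + B) = cvec A + cvec B.
Proof.
rewrite /cvec add_row_mx -!linearD /=; congr (row_mx (mxvec _) (mxvec _));
  by apply/matrixP => i j; rewrite !mxE; case: (A i j) (B i j) => ? ? [].
Qed.

Lemma cvecZ (a : R) A : cvec (a%:C%C *: A) = a *: cvec A.
Proof.
rewrite /cvec scale_row_mx -!linearZ /=; congr (row_mx (mxvec _) (mxvec _));
  by apply/matrixP => i j; rewrite !mxE; case: (A i j) => ? ?; rewrite /= !mul0r ?subr0 ?addr0.
Qed.

Lemma cvecB A B : cvec (A - B) = cvec A - cvec B.
Proof.
by rewrite -scaleN1r -[-1](rmorphN1 (real_complex R)) cvecD cvecZ scaleN1r.
Qed.

Lemma uncvecD u v : uncvec (u + v) = uncvec u + uncvec v.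
Proof. by apply/matrixP => i j; rewrite !mxE. Qed.

Lemma uncvecZ (a : R) v : uncvec (a *: v) = a%:C%C *: uncvec v.
Proof. by apply/matrixP => i j; rewrite !mxE; simpc. Qed.

Lemma uncvec0 : uncvec 0 = 0.
Proof. by apply/matrixP => i j; rewrite !mxE. Qed.

Lemma cvec_le A k : `|cvec A 0 k| <= nrm A.
Proof.
rewrite /cvec -[k]splitK; case: (fintype.split k) => k' /=.
  rewrite row_mxEl; case/mxvec_indexP: k' => i j; rewrite mxvecE mxE.
  by apply: le_trans (cnorm_le_nrm A i j); rewrite /cnorm lerDl.
rewrite row_mxEr; case/mxvec_indexP: k' => i j; rewrite mxvecE mxE.
by apply: le_trans (cnorm_le_nrm A i j); rewrite /cnorm lerDr.
Qed.

Definition l1 k (x : 'rV[R]_k) : R := \sum_i `|x 0 i|.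

Lemma l1_ge0 k (x : 'rV[R]_k) : 0 <= l1 x.
Proof. exact: sumr_ge0. Qed.

Lemma l1_0 k : l1 (0 : 'rV[R]_k) = 0.
Proof. by rewrite /l1 big1 // => i _; rewrite mxE normr0. Qed.

Lemma cvec_mul_bound k (W : 'M[R]_(D, k)) :
  exists2 K, 0 <= K & forall A, l1 (cvec A *m W) <= K * nrm A.
Proof.
exists (\sum_j \sum_i `|W i j|).
  by apply: sumr_ge0 => j _; exact: sumr_ge0.
move=> A; rewrite mulr_suml; apply: ler_sum => j _; rewrite mxE mulr_suml.
apply: le_trans (ler_norm_sum _ _ _) _; apply: ler_sum => i _.
by rewrite normrM mulrC ler_wpM2l // cvec_le.
Qed.

Lemma l1_split k (x : 'rV[R]_(k + 1)) : l1 x = l1 (lsubmx x) + `|rsubmx x 0 0|.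
Proof.
rewrite /l1 big_split_ord big_ord1 /=; congr (_ + _); last by rewrite mxE.
by apply: eq_bigr => i _; rewrite mxE.
Qed.

(** Being unitary and Hermitian, [1 + H] squares to 1, so [2 H = - H^2] and
    [2 nrm H <= nrm H ^ 2]. *)
Lemma unitary_herm_small (H : 'M[C]_n) : unitary (1%:M + H) -> mx_adj H = H -> nrm H < 2 -> H = 0.
Proof.
rewrite /unitary mx_adjD mx_adj1 => uH Hs H2; rewrite Hs in uH.
have E : (2 : R)%:C%C *: H = - (H *m H).
  move: uH; rewrite mulmxDl mul1mx mulmxDr mulmx1 => uH.
  apply/eqP; rewrite -addr_eq0 rmorph_nat scaler_nat mulr2n -addrA.
  by rewrite -(addKr 1%:M (H + _)) [1%:M + _]addrA uH addNr.
apply: nrm_eq0; have := nrmM H H; rewrite -(nrmN (H *m H)) -E nrmZ normr_nat.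
by have := nrm_ge0 H; nra.
Qed.

Lemma cis_eq1 (x : R) : `|x| <= 1 -> cis x = 1 -> x = 0.
Proof.
move=> x1 [cx _]; apply/eqP; rewrite -normr_eq0; apply/eqP.
apply: (@cos_inj R).
- by rewrite in_itv /= normr_ge0 /= (le_trans x1) // (le_trans _ (pi_ge2 R)) // ler1n.
- by rewrite in_itv /= lexx pi_ge0.
by rewrite cos0 -cx; case: (ler0P x); rewrite ?cosN.
Qed.

End Vectorization.

(** * From infinitesimal generation to the whole of [SU(n)] *)

Section SemigroupInterior.
Variables (R : realType) (n : nat).
Local Notation C := R[i].
Local Notation D := (n * n + n * n)%N.
Hypothesis n_gt0 : (0 < n)%N.
Variables (S : 'M[C]_n -> Prop) (S1 : S 1%:M)
  (SM : forall X Y, S X -> S Y -> S (X *m Y)) (SSU : forall X, S X -> in_SU X).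
(** [N] holds the generators whose forward flows lie in [S]. [Ngen] expresses generation of [su(n)]
    by quantifying over all Lie algebras; it serves once with [tangent S] for density and once with
    the annihilator condition of [family_spans]. *)
Variable (N : 'M[C]_n -> Prop).
Hypotheses (Nsu : forall M, N M -> in_su M)
  (NS : forall M U, N M -> unitary_flow U M -> forall t, 0 <= t -> S (U t))
  (Ngen : forall L, real_lie_algebra L -> (forall M, N M -> L M) ->
            forall M, in_su M -> L M).
Implicit Types (X Y Z A B M g h : 'M[C]_n).

Local Lemma Su X : S X -> unitary X. Proof. by case/SSU. Qed.

Local Lemma SU_mul X Y : in_SU X -> in_SU Y -> in_SU (X *m Y).
Proof.
by move=> [uX dX] [uY dY]; split; [exact: unitaryM|rewrite det_mulmx dX dY mulr1].
Qed.

Local Lemma det_adj X : \det (mx_adj X) = (\det X)^*%C.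
Proof. by rewrite /mx_adj det_tr det_map_mx. Qed.

Local Lemma SU_adj X : in_SU X -> in_SU (mx_adj X).
Proof.
by move=> [uX dX]; split; [exact: unitary_adj|rewrite det_adj dX conjc1].
Qed.

Local Lemma S_dense Y : in_SU Y -> adherent S Y.
Proof.
apply: (adherent_SU n_gt0); apply: Ngen; first exact: (tangent_lie S1 SM Su).
move=> M NM; have [Ms _] := Nsu NM; have [U HU] := flow_exists Ms.
apply: (tangentP S1 SM Su Ms HU) => t t0; apply: (adherent_sub).
exact: (NS NM HU).
Qed.

(** [F] is a [k]-parameter family in [S]; the rows of [W] are the coordinates of its partial
    derivatives at 0, translated back to the identity by the inverse of [F 0] on the right. *)
Definition tangent_family k (W : 'M[R]_(k, D)) (F : 'rV[R]_k -> 'M[C]_n) :=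
  (exists2 r, 0 < r & forall x, l1 x <= r -> S (F x)) /\
  sdiff (@l1 R k) F (fun x => uncvec (x *m W) *m F 0).

Local Lemma tangent_family0 (W : 'M[R]_(0, D)) : tangent_family W (fun=> 1%:M).
Proof.
split; first by exists 1.
apply: sdiff_ext (sdiff_cst (@l1_ge0 R 0) 1%:M) => // x.
rewrite mulmx1 (_ : x = 0); last by apply/rowP => -[].
by rewrite mul0mx uncvec0.
Qed.

(** Multiplying on the right by fixed factors leaves the old directions unchanged, while the new
    parameter contributes [M] conjugated by [F 0 *m h]. *)
Local Lemma tangent_family_extend k W F h M : @tangent_family k W F -> S h -> N M ->
  exists F', tangent_family (col_mx W (cvec (F 0 *m h *m M *m mx_adj (F 0 *m h)))) F'.
Proof.
move=> [[r r0 SF] sF] Sh NM; have [Ms _] := Nsu NM; have [U HU] := flow_exists Ms.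
have SF0 : S (F 0) by apply: SF; rewrite l1_0 ltW.
have ugh : unitary (F 0 *m h) by apply: Su; exact: SM.
(* The factor [U 1] centers the new parameter at time 1, so that the total time remains nonnegative
   when the parameter is slightly negative. *)
pose F1 (x : 'rV[R]_(k + 1)) := F (lsubmx x) *m h *m U (rsubmx x 0 0) *m U 1.
exists F1; split.
  exists (Num.min r 1); first by rewrite lt_min r0 ltr01.
  move=> x; rewrite le_min l1_split => /andP[xr x1]; rewrite /F1 -mulmxA -(flowD HU).
  apply: SM; first apply: SM => //.
    by apply: SF; apply: le_trans xr; rewrite lerDl.
  apply: (NS NM HU).
  have : `|rsubmx x 0 0| <= 1 by apply: le_trans x1; rewrite lerDr l1_ge0.
  by rewrite ler_norml => /andP[]; rewrite -lerBlDr sub0r.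
have ng := @l1_ge0 R (k + 1); have n0 := @l1_0 R (k + 1).
have s1 : sdiff (@l1 R (k + 1)) (F \o lsubmx) ((fun x => uncvec (x *m W) *m F 0) \o lsubmx).
  apply: (sdiff_comp ng _ ler01 _ sF) => [x y|x]; first by rewrite linearB.
  by rewrite mul1r l1_split lerDl.
have s2 : sdiff (@l1 R (k + 1)) (U \o (fun x => rsubmx x 0 0))
    ((fun s => s%:C%C *: M) \o (fun x => rsubmx x 0 0)).
  apply: (sdiff_comp ng _ ler01 _ (flow_sdiff HU)) => [x y|x]; first by rewrite !mxE.
  by rewrite mul1r l1_split lerDr l1_ge0.
have := sdiffM n0 ng (sdiffM n0 ng (sdiffM n0 ng s1 (sdiff_cst ng h)) s2) (sdiff_cst ng (U 1)).
apply: sdiff_ext => // x; rewrite /F1 /= mulmx0 !addr0 !linear0.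
rewrite (_ : (0 : 'M[R]_1) 0 0 = 0); last by rewrite mxE.
rewrite (flow0 HU) !mulmx1 addr0 mulmxDl.
rewrite -[in RHS](hsubmxK x) mul_row_col uncvecD mulmxDl; congr (_ + _).
  by rewrite !mulmxA.
rewrite [rsubmx x *m _](_ : _ = rsubmx x 0 0 *: cvec (F 0 *m h *m M *m mx_adj (F 0 *m h))).
  rewrite uncvecZ cvecK -scalemxAr -!scalemxAl; congr (_ *: _).
  by rewrite [RHS]mulmxA -[X in _ = X *m _]mulmxA ugh mulmx1.
by rewrite [rsubmx x in LHS]mx11_scalar mul_scalar_mx.
Qed.

(** Among families with independent rows, bounded in number by the real dimension [D], take a
    longest one: a conjugate outside the row space would extend it. *)
Local Lemma maximal_family : exists k W F, @tangent_family k W F /\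
  forall h M, S h -> N M -> (cvec (F 0 *m h *m M *m mx_adj (F 0 *m h)) <= W)%MS.
Proof.
pose P k := `[< exists W F, row_free W /\ @tangent_family k W F >].
have P0 : exists k, P k.
  exists 0%N; apply/asboolP; exists 0, (fun=> 1%:M); split; last exact: tangent_family0.
  by rewrite /row_free mxrank0.
have PD k : P k -> (k <= D)%N.
  by move=> /asboolP[W [F [/eqP Wk _]]]; have := rank_leq_col W; rewrite Wk.
case: (ex_maxnP P0 PD) => k /asboolP[W [F [Wf HF]]] kmax.
exists k, W, F; split=> // h M Sh NM; apply: contrapT => /negP nv.
set v := cvec _ in nv.
have [F' HF'] := tangent_family_extend HF Sh NM.
have : P (k + 1)%N.
  apply/asboolP; exists (col_mx W v), F'; split=> //.
  rewrite /row_free eqn_leq rank_leq_row /= -addsmxE addn1.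
  suff : (\rank W < \rank (W + v)%MS)%N by rewrite (eqP Wf).
  rewrite ltn_neqAle mxrankS ?addsmxSl // andbT.
  apply: contraNN nv => /eqP E.
  have : (W == W + v)%MS by rewrite -(mxrank_leqif_eq (addsmxSl W v)) E.
  by move=> /andP[_]; apply: submx_trans; exact: addsmxSr.
by move=> /kmax; rewrite addn1 ltnn.
Qed.

Local Lemma family_spans k W F : @tangent_family k W F ->
  (forall h M, S h -> N M -> (cvec (F 0 *m h *m M *m mx_adj (F 0 *m h)) <= W)%MS) ->
  forall M, in_su M -> (cvec M <= W)%MS.
Proof.
move=> [[r r0 SF] _] HW; have SF0 : S (F 0) by apply: SF; rewrite l1_0 ltW.
have K0 := unitary_bound_gt0 R n.
(* Spanning by duality: every functional [w] vanishing on [W] must vanish on [su(n)]. Requiring this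
   of all [SU(n)]-conjugates makes [L] closed under brackets, by differentiating the conjugation
   along a flow. *)
pose L M := in_su M /\ forall w : 'cV[R]_D, W *m w = 0 ->
  forall X, in_SU X -> cvec (X *m M *m mx_adj X) *m w = 0.
(* The kernel of a linear functional is closed; this passes to limits for difference quotients and
   for approximations by elements of [S]. *)
have small (w : 'cV[R]_D) A : (forall e, 0 < e ->
    exists2 B, cvec B *m w = 0 & nrm (A - B) <= e) -> cvec A *m w = 0.
  move=> H; have [K Kge0 HK] := cvec_mul_bound w.
  have K1 : 0 < K + 1 by rewrite ltr_wpDl.
  apply/matrixP => i j; rewrite !ord1 [RHS]mxE; apply/eqP; rewrite -normr_le0.
  apply/ler_addgt0Pr => e e0; rewrite add0r.
  have [B Bw AB] := H _ (divr_gt0 e0 K1).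
  have -> : cvec A *m w = cvec (A - B) *m w by rewrite cvecB mulmxBl Bw subr0.
  have := HK (A - B); rewrite /l1 big_ord1 => {}HK; apply: le_trans HK _.
  apply: (@le_trans _ _ ((K + 1) * (e / (K + 1)))); last by rewrite mulrC divfK ?gt_eqF.
  by apply: ler_pM => //; rewrite ?nrm_ge0 // lerDl.
suff LL : forall M, in_su M -> L M.
  move=> M /LL[_ HM]; rewrite submxE; apply/eqP/matrixP => i j.
  have Wj : W *m col j (cokermx W) = 0 by rewrite colE mulmxA mulmx_coker mul0mx.
  have SU1 : in_SU (1%:M : 'M[C]_n) by split; [exact: unitary1|exact: det1].
  have := HM _ Wj _ SU1; rewrite mx_adj1 mulmx1 mul1mx colE mulmxA -colE.
  by move=> /matrixP/(_ i 0); rewrite mxE => ->; rewrite !mxE.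
apply: Ngen.
  split.
  - move=> A B [[As At] LA] [[Bs Bt] LB]; split.
      by split; [rewrite mx_adjD As Bs opprD|rewrite raddfD /= At Bt addr0].
    move=> w Ww X XSU; rewrite mulmxDr mulmxDl cvecD mulmxDl (LA _ Ww _ XSU).
    by rewrite (LB _ Ww _ XSU) addr0.
  - move=> a A [[As At] LA]; split.
      by split; [rewrite mx_adjZ conjc_real As scalerN|rewrite mxtraceZ At mulr0].
    move=> w Ww X XSU; rewrite -scalemxAr -scalemxAl cvecZ -scalemxAl.
    by rewrite (LA _ Ww _ XSU) scaler0.
  - move=> A B [[As At] LA] [[Bs Bt] LB]; split.
      split; first exact: skew_bracket.
      by rewrite /bracket raddfB /= mxtrace_mulC subrr.
    move=> w Ww X XSU; apply: small => e e0.
    have [U HU] := flow_exists As; have [uX _] := XSU.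
    have KK : 0 < unitary_bound R n ^+ 2 by rewrite exprn_gt0.
    have [s s0 Hs] := flow_Ad_diff B HU (divr_gt0 e0 KK).
    have US : in_SU (X *m U s).
      apply: SU_mul => //; split; first exact: flow_unitary HU _.
      exact: (flow_det _ As At HU).
    exists ((s^-1)%:C%C *: (X *m (U s *m B *m mx_adj (U s) - B) *m mx_adj X)).
      rewrite cvecZ -scalemxAl mulmxBr mulmxBl cvecB mulmxBl (LB _ Ww _ XSU) subr0.
      by have := LB _ Ww _ US; rewrite mx_adjM !mulmxA => ->; rewrite scaler0.
    have sC : (s^-1)%:C%C * s%:C%C = 1 :> C by rewrite -rmorphM mulVf ?rmorph1 // gt_eqF.
    have := Hs s; rewrite (ger0_norm (ltW s0)) => /(_ (lexx _)).
    move: (U s *m B *m mx_adj (U s) - B) (bracket A B) => T G HT.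
    rewrite (_ : _ - _ = X *m ((s^-1)%:C%C *: (s%:C%C *: G - T)) *m mx_adj X); last first.
      rewrite scalerBr scalerA sC scale1r mulmxBr mulmxBl; congr (_ - _).
      by rewrite -scalemxAr -scalemxAl.
    apply: le_trans (nrm_unitaryMr _ (unitary_adj uX)) _.
    apply: le_trans (_ : _ <= unitary_bound R n * (unitary_bound R n * (e / unitary_bound R n ^+ 2))) _.
      rewrite ler_pM2l //; apply: le_trans (nrm_unitaryMl _ uX) _; rewrite ler_pM2l //.
      rewrite nrmZ ger0_norm ?invr_ge0 ?(ltW s0) // mulrC ler_pdivrMr // nrm_subC.
      exact: HT.
    by rewrite mulrA -expr2 mulrC divfK ?gt_eqF.
move=> M NM; split; first exact: Nsu.
move=> w Ww X XSU; apply: small => e e0.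
have uX : unitary X by case: XSU.
have ug := Su SF0.
pose K := unitary_bound R n; pose Q := K * (K * (nrm M + 1)) * 2.
have M1 : 0 < nrm M + 1 by rewrite ltr_wpDl ?nrm_ge0.
have Q0 : 0 < Q by rewrite !mulr_gt0.
(* By density [F 0 *m h] approximates an arbitrary [X] in [SU(n)], while [HW] controls exactly the
   conjugates by matrices of this form. *)
have [h Sh Hh] := S_dense (SU_mul (SU_adj (SSU SF0)) XSU) (divr_gt0 e0 Q0).
have ugh : unitary (F 0 *m h) by apply: unitaryM => //; exact: Su.
exists (F 0 *m h *m M *m mx_adj (F 0 *m h)).
  by have /submxP[y ->] := HW _ _ Sh NM; rewrite -mulmxA Ww mulmx0.
have Xgh : nrm (X - F 0 *m h) <= K * (e / Q).
  rewrite (_ : X - _ = F 0 *m (mx_adj (F 0) *m X - h)).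
    by apply: le_trans (nrm_unitaryMl _ ug) _; rewrite ler_pM2l.
  by rewrite mulmxBr mulmxA (unitary_mulVC ug) mul1mx.
set Y := F 0 *m h in ugh Xgh *.
rewrite (_ : _ - _ = (X - Y) *m M *m mx_adj X + Y *m (M *m mx_adj (X - Y))); last first.
  by rewrite mx_adjD mx_adjN !mulmxBr !mulmxBl !mulmxA addrA subrK.
apply: le_trans (nrmD _ _) _.
have T1 : nrm ((X - Y) *m M *m mx_adj X) <= K * (K * (e / Q) * (nrm M + 1)).
  apply: le_trans (nrm_unitaryMr _ (unitary_adj uX)) _; rewrite ler_pM2l //.
  apply: le_trans (nrmM _ _) _; apply: ler_pM; rewrite ?nrm_ge0 //.
  by rewrite lerDl.
have T2 : nrm (Y *m (M *m mx_adj (X - Y))) <= K * (K * (e / Q) * (nrm M + 1)).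
  apply: le_trans (nrm_unitaryMl _ ugh) _; rewrite ler_pM2l //.
  apply: le_trans (nrmM _ _) _; rewrite mulrC nrm_adj; apply: ler_pM; rewrite ?nrm_ge0 //.
  by rewrite lerDl.
apply: le_trans (lerD T1 T2) _.
apply: (@le_trans _ _ (Q * (e / Q))); last by rewrite mulrC divfK ?gt_eqF.
rewrite le_eqVlt; apply/orP; left; apply/eqP; rewrite {2 4}/Q.
by move: (e / Q) => q; rewrite {1}/Q; ring.
Qed.

(** The matrix space splits into Hermitian matrices, real multiples of [i], and [su(n)]. [Phi]
    multiplies one factor for each summand and has derivative the identity. When its value is in
    [SU(n)], unitarity kills the Hermitian factor and the determinant kills the scalar one, leaving
    a value of [F] times the inverse of [F 0]. *)
Lemma SU_semigroup_interior : exists2 g, S g & exists2 e, 0 < e &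
  forall Z, in_SU Z -> nrm (Z - 1%:M) <= e -> S (Z *m g).
Proof.
have [k [W [F [HF HW]]]] := maximal_family.
have span := family_spans HF HW; case: HF => [[r r0 SF] sF].
have SF0 : S (F 0) by apply: SF; rewrite l1_0 ltW.
have [ug dg] := SSU SF0.
exists (F 0) => //.
have nR : n%:R != 0 :> R by rewrite pnatr_eq0 -lt0n.
pose He A : 'M[C]_n := (2^-1 : R)%:C%C *: (A + mx_adj A).
pose sc A : R := complex.Im (\tr A) / n%:R.
pose E t : 'M[C]_n := diag_conj 1%:M (fun=> cis (1 * t)).
have HE : unitary_flow E (diag_conj 1%:M (fun=> 'i%C * (1 : R)%:C%C)).
  exact: (diag_flow (fun=> 1) (unitary1 R n)).
have iE : diag_conj 1%:M (fun=> 'i%C * (1 : R)%:C%C) = 'i%C%:M :> 'M[C]_n.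
  rewrite /diag_conj mx_adj1 mulmx1 mul1mx; apply/matrixP => i j.
  by rewrite !mxE mulr1.
pose pr A : 'M[C]_n := A - He A - (sc A)%:C%C *: 'i%C%:M.
(* Parameters of the family realizing the [su(n)] component to first order: [span] places this
   component in the row space of [W], where [pinvmx W] inverts exactly. *)
pose xv A : 'rV[R]_k := cvec (pr A) *m pinvmx W.
have HeB : {morph He : A B / A - B}.
  move=> A B; rewrite /He -scalerBr mx_adjD mx_adjN; congr (_ *: _).
  by rewrite addrACA -opprD.
have scB : {morph sc : A B / A - B}.
  have ImB (x y : C) : complex.Im (x - y) = complex.Im x - complex.Im y.
    by case: x y => ? ? [].
  by move=> A B; rewrite /sc raddfB /= ImB mulrBl.
have prB : {morph pr : A B / A - B}.
  move=> A B; rewrite /pr HeB scB rmorphB scalerBl.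
  by move: (He A) (He B) (_ *: _) (_ *: _) => a1 a2 a3 a4; apply/matrixP => i j; rewrite !mxE; ring.
have He_le A : nrm (He A) <= nrm A.
  rewrite /He nrmZ ger0_norm ?invr_ge0 // mulrC ler_pdivrMr //.
  by apply: le_trans (nrmD _ _) _; rewrite nrm_adj mulr_natr mulr2n.
have [Ks Ks0 sc_le] : exists2 K, 0 <= K & forall A, `|sc A| <= K * nrm A.
  exists 1 => // A; rewrite mul1r /sc normrM normfV normr_nat.
  rewrite ler_pdivrMr ?ltr0n //.
  have -> : complex.Im (\tr A) = \sum_i complex.Im (A i i).
    by rewrite /mxtrace (big_morph (@complex.Im R) (id1 := 0) (op1 := +%R)) //; case=> ? ? [].
  apply: le_trans (ler_norm_sum _ _ _) _.
  apply: (@le_trans _ _ (\sum_(i < n) nrm A)).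
    by apply: ler_sum => i _; apply: le_trans (cnorm_le_nrm A i i); rewrite /cnorm lerDr.
  by rewrite sumr_const card_ord mulr_natr.
have prsu A : in_su (pr A).
  have adjHe : mx_adj (He A) = He A.
    by rewrite /He mx_adjZ mx_adjD mx_adjK conjc_real addrC.
  have HeE : mx_adj A = He A + He A - A.
    rewrite /He -scalerDl -rmorphD (_ : 2^-1 + 2^-1 = 1 :> R); last by field.
    by rewrite rmorph1 scale1r addrC addKr.
  have adji : mx_adj ('i%C%:M : 'M[C]_n) = - 'i%C%:M.
    apply/matrixP => i j; rewrite !mxE eq_sym; case: eqP => _.
      by rewrite !mulr1n; simpc.
    by rewrite !mulr0n rmorph0 oppr0.
  split.
    rewrite /pr !mx_adjD !mx_adjN mx_adjZ conjc_real adjHe adji HeE.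
    by move: (He A) => a1; apply/matrixP => i j; rewrite !mxE; ring.
  have trJ : \tr (mx_adj A) = (\tr A)^*%C by rewrite /mx_adj mxtrace_tr trace_map_mx.
  have trHe : \tr (He A) = (complex.Re (\tr A))%:C%C.
    rewrite /He mxtraceZ mxtraceD trJ addcJ mulrA fmorphV rmorph_nat.
    by rewrite mulVf ?pnatr_eq0 // mul1r.
  have tri : \tr ((sc A)%:C%C *: 'i%C%:M : 'M[C]_n) = 'i%C * (complex.Im (\tr A))%:C%C.
    rewrite mxtraceZ mxtrace_scalar.
    have -> : 'i%C *+ n = 'i%C * n%:R :> C by rewrite mulr_natr.
    rewrite /sc rmorphM fmorphV rmorph_nat /=.
    have nC : n%:R != 0 :> C by rewrite pnatr_eq0 -lt0n.
    by move: (_%:C%C) => a; field.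
  by rewrite /pr !raddfB /= trHe tri {1}[\tr A]complexE [X in X - _]addrAC subrr add0r subrr.
have [Kx Kx0 xv_le] : exists2 K, 0 <= K & forall A, l1 (xv A) <= K * nrm A.
  have [K K0 HK] := cvec_mul_bound (pinvmx W).
  exists (K * (2 + Ks * nrm ('i%C%:M : 'M[C]_n))).
    by rewrite mulr_ge0 // addr_ge0 // mulr_ge0 // nrm_ge0.
  move=> A; apply: le_trans (HK _) _; rewrite -mulrA ler_wpM2l //.
  apply: le_trans (nrmB _ _) _; rewrite mulrDl nrmZ; apply: lerD.
    by apply: le_trans (nrmB _ _) _; rewrite mulr_natl mulr2n lerD2l.
  by rewrite mulrAC ler_wpM2r ?nrm_ge0.
have ng := @nrm_ge0 R n; have n0 := @nrm0 R n.
have sH : sdiff (@nrm R n) (fun A => 1%:M + He A) He.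
  split; first by exists 1 => // A; rewrite mul1r.
  move=> c c0; exists 1 => // A B _ _.
  by rewrite opprD addrACA subrr add0r -HeB subrr nrm0 mulr_ge0 // ltW.
have sE := sdiff_comp ng scB Ks0 sc_le (flow_sdiff HE).
have xvB : {morph xv : A B / A - B} by move=> A B; rewrite /xv prB cvecB mulmxBl.
have sF' := sdiff_comp ng xvB Kx0 xv_le sF.
pose Phi A := (1%:M + He A) *m E (sc A) *m (F (xv A) *m mx_adj (F 0)).
have He0 : He 0 = 0 by have := HeB 0 0; rewrite subrr subrr.
have sc0 : sc 0 = 0 by have := scB 0 0; rewrite subrr subrr.
have xv0 : xv 0 = 0 by have := xvB 0 0; rewrite subrr subrr.
have sPhi : sdiff (@nrm R n) Phi id.
  have := sdiffM n0 ng (sdiffM n0 ng sH sE) (sdiffM n0 ng sF' (sdiff_cst ng (mx_adj (F 0)))).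
  apply: sdiff_ext => // A; rewrite /= He0 sc0 xv0 (flow0 HE) !addr0 !mulmx1 mul1mx mulmx0 addr0.
  rewrite -mulmxA (unitary_mulVC ug) !mulmx1 mul1mx mulmxKpV ?span // cvecK iE.
  rewrite /pr; move: (He A) ((sc A)%:C%C *: _) => a1 a2.
  by apply/matrixP => i j; rewrite !mxE; ring.
have Phi0 : Phi 0 = 1%:M.
  by rewrite /Phi He0 sc0 xv0 (flow0 HE) addr0 !mul1mx (unitary_mulVC ug).
(* The three bounds keep the parameters where [F] takes values in [S], allow [unitary_herm_small],
   and keep the angle [n * sc A] within the range of [cis_eq1]. *)
have [rho rho0 [Hr1 Hr2 Hr3]] : exists2 rho, 0 < rho &
    [/\ Kx * rho <= r, rho < 2 & n%:R * (Ks * rho) <= 1].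
  exists (Num.min (r / (Kx + 1)) (Num.min 1 (1 / (n%:R * Ks + 1)))).
    by rewrite !lt_min !divr_gt0 ?ltr01 ?ltr_wpDl ?mulr_ge0.
  split.
  - apply: (@le_trans _ _ ((Kx + 1) * (r / (Kx + 1)))).
      by apply: ler_pM; rewrite ?le_min ?lerDl ?ge_min ?lexx // !divr_ge0 ?addr_ge0 ?mulr_ge0 // ltW.
    by rewrite mulrC divfK // gt_eqF // ltr_wpDl.
  - by rewrite !gt_min ltr1n orbT.
  - have n1 : 0 < n%:R * Ks + 1 by rewrite ltr_wpDl // mulr_ge0.
    apply: (@le_trans _ _ ((n%:R * Ks + 1) * (1 / (n%:R * Ks + 1)))).
      rewrite mulrA; apply: ler_pM; rewrite ?mulr_ge0 ?lerDl ?ge_min ?lexx ?orbT //.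
      by rewrite !le_min !divr_ge0 ?addr_ge0 ?mulr_ge0 // ltW.
    by rewrite mulrC divfK // gt_eqF.
have [e e0 He'] := local_surjectivity sPhi rho0.
exists e => // Z ZSU; rewrite -Phi0 => /He'[A Arho PhiA].
have [uZ dZ] := ZSU.
have SFx : S (F (xv A)).
  by apply: SF; apply: le_trans (xv_le A) _; apply: le_trans Hr1; rewrite ler_wpM2l.
have [uFx dFx] := SSU SFx.
have uV : unitary (E (sc A) *m (F (xv A) *m mx_adj (F 0))).
  apply: unitaryM; first exact: flow_unitary HE _.
  by apply: unitaryM => //; exact: unitary_adj.
have HA : He A = 0.
  apply: unitary_herm_small.
  - rewrite (_ : 1%:M + He A = Z *m mx_adj (E (sc A) *m (F (xv A) *m mx_adj (F 0)))).
      by apply: unitaryM => //; exact: unitary_adj.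
    rewrite -PhiA /Phi -[_ *m E _ *m _]mulmxA; move: uV; move: (E _ *m _) => V uV.
    by rewrite -mulmxA (unitary_mulVC uV) mulmx1.
  - by rewrite /He mx_adjZ mx_adjD mx_adjK conjc_real addrC.
  - by apply: le_lt_trans (He_le A) _; exact: le_lt_trans Arho Hr2.
have scA : sc A = 0.
  have : n%:R * sc A = 0.
    apply: cis_eq1.
      rewrite normrM normr_nat; apply: le_trans Hr3; rewrite ler_wpM2l //.
      by apply: le_trans (sc_le A) _; rewrite ler_wpM2l.
    have dag : \det (mx_adj (F 0)) = 1 by have [] := SU_adj (SSU SF0).
    have dE : \det (E (sc A)) = cis (n%:R * sc A).
      rewrite /E det_diag_conj; last exact: unitary1.
      by rewrite -cis_sum sumr_const card_ord mul1r mulr_natl.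
    move: dZ; rewrite -PhiA /Phi HA addr0 mul1mx det_mulmx.
    by rewrite [\det (F _ *m _)]det_mulmx dFx dag !mulr1 dE.
  by move=> /eqP; rewrite mulf_eq0 (negPf nR) => /eqP.
move: PhiA; rewrite /Phi HA scA (flow0 HE) addr0 !mul1mx => <-.
by rewrite -mulmxA ug mulmx1.
Qed.

(** Choose [h] in [S] close to [Y g^-1]. Then [Z = h^-1 Y g^-1] is near 1, so [Z g] is in [S], and
    [Y = h (Z g)]. *)
Theorem SU_semigroup Y : in_SU Y -> S Y.
Proof.
move=> YSU; have [g Sg [e e0 He]] := SU_semigroup_interior.
have K0 := unitary_bound_gt0 R n; have [ug _] := SSU Sg.
have [h Sh Hh] := S_dense (SU_mul YSU (SU_adj (SSU Sg))) (divr_gt0 e0 K0).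
have [uh _] := SSU Sh.
have SZ : S (mx_adj h *m (Y *m mx_adj g) *m g).
  apply: He; first by apply: SU_mul; [exact: SU_adj (SSU Sh)|apply: SU_mul => //; exact: SU_adj (SSU Sg)].
  rewrite -uh -mulmxBr; apply: le_trans (nrm_unitaryMl _ (unitary_adj uh)) _.
  by rewrite mulrC -ler_pdivlMr.
have := SM Sh SZ; rewrite !mulmxA (unitary_mulVC uh) mul1mx -mulmxA ug mulmx1.
by [].
Qed.

End SemigroupInterior.

(** * Reachability *)

Section Gluing.
Variable R : realType.
Implicit Types (f h : R -> R) (t T : R).

Definition glue (A : Type) T (f h : R -> A) t := if t < T then f t else h t.

Lemma is_derive_local f h t d r : is_derive t 1 f d -> 0 < r ->
  (forall s, `|s| <= r -> h (t + s) = f (t + s)) -> is_derive t 1 h d.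
Proof.
move=> fd r0 E; apply: littleo_is_derive => c c0.
have [r1 r10 H] := is_derive_littleo fd c0.
exists (Num.min r r1) => [|s]; first by rewrite lt_min r0.
rewrite le_min => /andP[sr sr1]; rewrite E //.
have := E 0; rewrite normr0 addr0 => ->; last exact: ltW.
exact: H.
Qed.

Lemma is_derive_continuous f t d : is_derive t 1 f d -> {for t, continuous f}.
Proof. by case=> /derivable1_diffP/differentiable_continuous. Qed.

Lemma glue_continuous f h T T' : 0 <= T -> T <= T' ->
  {within `[0, T], continuous f} -> continuous h -> f T = h T ->
  {within `[0, T'], continuous (glue T f h)}.
Proof.
move=> T0 TT' cf ch fhT.
have -> : `[0, T']%classic = `[0, T]%classic `|` `[T, T']%classic :> set R.
  apply/seteqP; split=> x /=; rewrite !in_itv /=.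
    move=> /andP[x0 xT]; case: (leP x T) => h0; [left|right].
      by rewrite x0.
    by rewrite (ltW h0).
  case=> /andP[h1 h2]; apply/andP; split => //.
    exact: le_trans h2 TT'.
  exact: le_trans T0 h1.
apply: withinU_continuous.
- exact: interval_closed.
- exact: interval_closed.
- apply: subspace_eq_continuous cf => x; rewrite inE /= in_itv /= => /andP[_ xT].
  change (f x = glue T f h x); rewrite /glue.
  case: (ltP x T) => [xlt|Tx]; first by [].
  by have -> : x = T by apply/le_anti; rewrite xT Tx.
- apply: (@subspace_eq_continuous _ _ _ h); last exact: continuous_subspaceT.
  move=> x; rewrite inE /= in_itv /= => /andP[Tx _].
  by change (h x = glue T f h x); rewrite /glue ltNge Tx.
Qed.

Lemma glue_piecewise_continuous f T T' (v : R) : 0 <= T -> T <= T' ->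
  piecewise_continuous T f -> piecewise_continuous T' (glue T f (fun=> v)).
Proof.
move=> T0 TT' [[bad Hbad] [Hr Hl]]; split; [exists (T :: bad)|split].
- move=> t /andP[t0 tT']; rewrite inE negb_or => /andP[tT tbad].
  case: (ltgtP t T) tT => // [tT _|Tt _].
    apply: cvg_trans; first apply: near_eq_cvg (_ : {near t, f =1 glue T f (fun=> v)}).
      near=> x; rewrite /glue (_ : x < T) //; near: x.
      exact: lt_nbhsl.
    rewrite /glue tT; apply: Hbad => //.
    by rewrite t0.
  apply: cvg_near_cst; rewrite /glue [t < T]ltNge (ltW Tt) /=.
  near=> x; rewrite ltNge (_ : T <= x) //; apply: ltW; near: x.
  exact: lt_nbhsr.
- move=> t /andP[t0 tT']; case: (ltP t T) => [tT|Tt].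
    have [|l Hlim] := Hr t; first by rewrite t0.
    exists l; apply: cvg_trans Hlim.
    apply: near_eq_cvg; near=> x; rewrite /glue (_ : x < T) //; near: x.
  exists v; apply: cvg_near_cst; near=> x; rewrite /glue ltNge (_ : T <= x) //.
  apply: le_trans Tt _; apply: ltW; near: x; exact: nbhs_right_gt.
- move=> t /andP[t0 tT']; case: (leP t T) => [tT|Tt].
    have [|l Hlim] := Hl t; first by rewrite t0.
    exists l; apply: cvg_trans Hlim.
    apply: near_eq_cvg; near=> x; rewrite /glue (_ : x < T) //.
    apply: lt_le_trans tT; near: x; exact: nbhs_left_lt.
  exists v; apply: cvg_near_cst; near=> x; rewrite /glue ltNge (_ : T <= x) //.
  apply: ltW; near: x; exact: nbhs_left_gt.
Unshelve. all: by end_near.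
Qed.
End Gluing.

(** * Trajectories and products of flows *)

Section Reachability.
Variables (R : realType) (n m : nat).
Local Notation C := R[i].
Variables (B0 : 'M[C]_n) (Bs : 'I_m -> 'M[C]_n).

Lemma flow_has_deriv (U : R -> 'M[C]_n) M Y (T t : R) : unitary_flow U M ->
  mx_has_deriv (fun s => U (s - T) *m Y) t (M *m (U (t - T) *m Y)).
Proof.
move=> HU i j.
set Z := U (t - T) *m Y.
have key c : 0 < c -> exists2 r, 0 < r & forall s, `|s| <= r ->
    cnorm ((U (t + s - T) *m Y) i j - Z i j - s%:C%C * (M *m Z) i j) <= c * `|s|.
  move=> c0; have Z1 : 0 < nrm Z + 1 by rewrite ltr_wpDl ?nrm_ge0.
  have [r r0 Hr] := flow_diff0 HU (divr_gt0 c0 Z1).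
  exists r => // s sr.
  have -> : (U (t + s - T) *m Y) i j - Z i j - s%:C%C * (M *m Z) i j
      = ((U s - 1%:M - s%:C%C *: M) *m Z) i j.
    have -> : U (t + s - T) *m Y = U s *m Z.
      by rewrite /Z mulmxA -(flowD HU); congr (U _ *m _); ring.
    rewrite !mulmxBl mul1mx -scalemxAl.
    by move: (U s *m Z) (M *m Z) => a1 a2; rewrite !mxE.
  apply: le_trans (cnorm_le_nrm _ i j) _; apply: le_trans (nrmM _ _) _.
  apply: (@le_trans _ _ (c / (nrm Z + 1) * `|s| * (nrm Z + 1))).
    apply: ler_pM; rewrite ?nrm_ge0 ?Hr //.
    by rewrite lerDl.
  by rewrite mulrAC divfK // gt_eqF.
split; apply: littleo_is_derive => c c0; have [r r0 Hr] := key c c0;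
  exists r => // s /Hr; rewrite /cnorm.
  case: ((U _ *m Y) i j) (Z i j) ((M *m Z) i j) => [a b] [a' b'] [a'' b''] /=.
  rewrite !mul0r subr0 addr0; apply: le_trans.
  by rewrite lerDl.
case: ((U _ *m Y) i j) (Z i j) ((M *m Z) i j) => [a b] [a' b'] [a'' b''] /=.
rewrite !mul0r subr0 addr0; apply: le_trans.
by rewrite lerDr.
Qed.

Definition drift_control (v : 'I_m -> R) : 'M[C]_n := B0 + \sum_k (v k)%:C%C *: Bs k.

Lemma reachable1 : reachable B0 Bs 1%:M.
Proof.
exists 0, (fun _ _ => 0), (fun=> 1%:M); split=> //; split.
  move=> k; split; first by exists [::] => t /andP[t0 /(lt_trans t0)]; rewrite ltxx.
  split=> t /andP[t0].
    by move=> /(le_lt_trans t0); rewrite ltxx.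
  by move=> /(lt_le_trans t0); rewrite ltxx.
split=> //; split=> //; split.
  by move=> i j; split; apply: continuous_subspaceT; apply: cst_continuous.
by exists [::] => t /andP[t0 /(lt_trans t0)]; rewrite ltxx.
Qed.

(** Follow the old control up to time [T], then apply the constant control [v] for time [tau]; later
    motion multiplies on the left. *)
Lemma reachable_flow Y v (U : R -> 'M[C]_n) tau : reachable B0 Bs Y ->
  unitary_flow U (drift_control v) -> 0 <= tau -> reachable B0 Bs (U tau *m Y).
Proof.
move=> [T [u [X [T0 [pcu [[X0 [cX [bad dX]]] XT]]]]]] HU tau0.
exists (T + tau), (fun k => glue T (u k) (fun=> v k)), (glue T X (fun t => U (t - T) *m Y)).
have TT' : T <= T + tau by rewrite lerDl.
split; first exact: addr_ge0.
split; first by move=> k; apply: glue_piecewise_continuous.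
split; last first.
  by rewrite /glue ltNge TT' /= [T + tau]addrC addrK.
have dU t := flow_has_deriv Y T t HU.
split.
  rewrite /glue; case: (ltP 0 T) => // T0'.
  have -> : T = 0 by apply/le_anti; rewrite T0 T0'.
  rewrite subrr (flow0 HU) mul1mx -XT.
  by have -> : T = 0 by apply/le_anti; rewrite T0 T0'.
split.
  have E (p : C -> R) i j t : p (glue T X (fun t => U (t - T) *m Y) t i j)
      = glue T (fun t => p (X t i j)) (fun t => p ((U (t - T) *m Y) i j)) t.
    by rewrite /glue; case: ifP.
  have UT : U (T - T) *m Y = Y by rewrite subrr (flow0 HU) mul1mx.
  move=> i j; have [c1 c2] := cX i j; split.
    rewrite (funext (E (@complex.Re R) i j)).
    apply: glue_continuous => //; last by rewrite UT XT.
    by move=> t; apply: is_derive_continuous; exact: (dU t i j).1.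
  rewrite (funext (E (@complex.Im R) i j)).
  apply: glue_continuous => //; last by rewrite UT XT.
  by move=> t; apply: is_derive_continuous; exact: (dU t i j).2.
(* The junction time joins the exceptional points, since the control may jump there. At any other
   time, half the distance to [T] is a radius that stays on one side of it. *)
exists (T :: bad) => t /andP[t0 tT']; rewrite inE negb_or => /andP[tT tbad].
have r0 : 0 < `|t - T| / 2 by rewrite divr_gt0 // normr_gt0 subr_eq0.
case: (ltgtP t T) tT => // [tT _|Tt _].
  have -> : glue T X (fun t0 => U (t0 - T) *m Y) t = X t by rewrite /glue tT.
  rewrite (eq_bigr (fun k => (u k t)%:C%C *: Bs k)); last first.
    by move=> k _; rewrite /glue tT.
  have E s : `|s| <= `|t - T| / 2 ->
      glue T X (fun t0 => U (t0 - T) *m Y) (t + s) = X (t + s).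
    move=> sr; rewrite /glue (_ : t + s < T) //; move: sr.
    rewrite (ltr0_norm (x := t - T)) ?subr_lt0 // => /(le_trans (ler_norm _)).
    by move: tT; lra.
  have dXt := dX t; rewrite t0 tT in dXt.
  move=> i j; have [d1 d2] := dXt isT tbad i j; split.
    by apply: (is_derive_local d1 r0) => s /E ->.
  by apply: (is_derive_local d2 r0) => s /E ->.
have gE s : T <= s -> glue T X (fun t0 => U (t0 - T) *m Y) s = U (s - T) *m Y.
  by move=> Ts; rewrite /glue ltNge Ts.
rewrite (gE _ (ltW Tt)) (eq_bigr (fun k => (v k)%:C%C *: Bs k)); last first.
  by move=> k _; rewrite /glue ltNge (ltW Tt).
have E s : `|s| <= `|t - T| / 2 ->
    glue T X (fun t0 => U (t0 - T) *m Y) (t + s) = U (t + s - T) *m Y.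
  move=> sr; apply: gE; move: sr.
  rewrite (gtr0_norm (x := t - T)) ?subr_gt0 // -normrN => /(le_trans (ler_norm _)).
  by move: Tt; lra.
move=> i j; have [d1 d2] := dU t i j; split.
  by apply: (is_derive_local d1 r0) => s /E ->.
by apply: (is_derive_local d2 r0) => s /E ->.
Qed.

Inductive flow_product : 'M[C]_n -> Prop :=
| flow_product1 : flow_product 1%:M
| flow_productM v (U : R -> 'M[C]_n) t Y : unitary_flow U (drift_control v) ->
    0 <= t -> flow_product Y -> flow_product (U t *m Y).

Lemma flow_product_reachable Y : flow_product Y -> reachable B0 Bs Y.
Proof.
elim=> [|v U t Z HU t0 _ IH]; first exact: reachable1.
exact: reachable_flow HU t0.
Qed.

Lemma flow_product_mul X Y : flow_product X -> flow_product Y -> flow_product (X *m Y).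
Proof.
move=> HX HY; elim: HX => [|v U t Z HU t0 _ IH]; first by rewrite mul1mx.
by rewrite -mulmxA; exact: flow_productM HU t0 IH.
Qed.

Hypotheses (B0su : in_su B0) (Bssu : forall k, in_su (Bs k)).

Lemma drift_control_su v : in_su (drift_control v).
Proof.
have [h1 h2] := B0su; split.
  rewrite /drift_control mx_adjD h1 opprD; congr (_ + _).
  have adj0 : mx_adj (0 : 'M[C]_n) = 0 by rewrite /mx_adj map_mx0 trmx0.
  rewrite (big_morph (@mx_adj R n) (@mx_adjD R n) adj0) -sumrN.
  by apply: eq_bigr => k _; rewrite mx_adjZ conjc_real (Bssu k).1 scalerN.
rewrite /drift_control raddfD /= h2 add0r raddf_sum big1 // => k _.
by rewrite /= mxtraceZ (Bssu k).2 mulr0.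
Qed.

Lemma flow_product_SU X : flow_product X -> in_SU X.
Proof.
elim=> [|v U t Z HU t0 _ [uZ dZ]]; first by split; [exact: unitary1|exact: det1].
have [h1 h2] := drift_control_su v; split.
  by apply: unitaryM => //; exact: flow_unitary HU _.
by rewrite det_mulmx dZ mulr1; exact: flow_det h1 h2 HU.
Qed.

End Reachability.

(** * Conserved quantity *)

Section PiecewiseConstant.
Variable R : realType.

(** Induction on the exceptional points: split the interval at each interior one, and apply the mean
    value theorem when none is left. Continuity carries the value across the splits. *)
Lemma piecewise_constant (f : R -> R) (bad : seq R) (a b : R) : a <= b ->
  {within `[a, b], continuous f} ->
  (forall t, a < t < b -> t \notin bad -> is_derive t 1 f 0) -> f b = f a.
Proof.
elim: bad a b => [|c bad IH] a b ab cf df.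
  have [->//|ab'] := eqVneq a b.
  have {}ab : a < b by rewrite lt_neqAle ab' ab.
  have [x _] := MVT (f := f) (df := fun=> 0) ab (fun x xab => df x xab isT) cf.
  by rewrite mul0r => /eqP; rewrite subr_eq0 => /eqP.
case: (boolP (a < c < b)) => [/andP[ac cb]|nacb].
  have sub1 : `[a, c] `<=` `[a, b].
    move=> x /=; rewrite !in_itv /= => /andP[-> xc]; exact: le_trans xc (ltW cb).
  have sub2 : `[c, b] `<=` `[a, b].
    move=> x /=; rewrite !in_itv /= => /andP[cx ->]; rewrite andbT; exact: le_trans (ltW ac) cx.
  transitivity (f c).
    apply: (IH c b (ltW cb)); first exact: continuous_subspaceW sub2 cf.
    move=> t /andP[ct tb] tbad; apply: df; first by rewrite tb andbT (lt_trans ac).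
    by rewrite inE negb_or tbad andbT gt_eqF.
  apply: (IH a c (ltW ac)); first exact: continuous_subspaceW sub1 cf.
  move=> t /andP[lt_at tc] tbad; apply: df; first by rewrite lt_at (lt_trans tc).
  by rewrite inE negb_or tbad andbT lt_eqF.
apply: IH => // t tab tbad; apply: df => //; rewrite inE negb_or tbad andbT.
by apply: contraNneq nacb => <-.
Qed.

Lemma within_continuous_sum (A : set R) n (h : 'I_n -> R -> R) :
  (forall i, {within A, continuous (h i)}) -> {within A, continuous (\sum_i h i)}.
Proof.
move=> ch; apply: (big_ind (fun f : R -> R => {within A, continuous f})) => //.
  by apply: continuous_subspaceT; exact: cst_continuous.
by move=> f g cf cg x; apply: (@continuousD _ _ (subspace A)); [exact: cf|exact: cg].
Qed.
End PiecewiseConstant.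

(** * The gauge and the matrix that is not reachable *)

Section Necessity.
Variables (R : realType) (n : nat).
Local Notation C := R[i].
Variable p : 'I_n -> bool.
Implicit Types (M X : 'M[C]_n) (i j k : 'I_n).

Let th i : C := if p i then 'i%C else 1.
Let gauge M i j : C := (th i)^*%C * M i j * th j.

Local Lemma th_conj i : th i * (th i)^*%C = 1.
Proof. by rewrite /th; case: (p i); simpc. Qed.

Local Lemma gauge_mul M X i j : gauge (M *m X) i j = \sum_k gauge M i k * gauge X k j.
Proof.
rewrite /gauge mxE mulr_sumr mulr_suml; apply: eq_bigr => k _.
have := th_conj k; move: (th k) (th k)^*%C => a b ab.
by ring: ab.
Qed.

Local Lemma gauge_off M i j : (off_part p i j M == 0) = (complex.Im (gauge M i j) == 0).
Proof.
rewrite /off_part /gauge /th; case: (M i j) => r s.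
by case: (p i); case: (p j); rewrite ?conjc1 ?mul1r ?mulr1; simpc; rewrite //= ?oppr_eq0.
Qed.

Local Lemma gauge_skew M i j : mx_adj M = - M ->
  complex.Re (gauge M j i) = - complex.Re (gauge M i j).
Proof.
move=> Ms; have -> : gauge M j i = - (gauge M i j)^*%C.
  rewrite /gauge !rmorphM /= conjcK.
  have : (M i j)^*%C = - M j i.
    by have /matrixP/(_ j i) := Ms; rewrite !mxE.
  by move=> ->; ring.
by case: (gauge M i j).
Qed.

Definition compatible M := forall i j, off_part p i j M = 0.

Local Lemma gauge_deriv (X : R -> 'M[C]_n) t D i j : mx_has_deriv X t D ->
  is_derive t 1 (fun s => complex.Im (gauge (X s) i j)) (complex.Im (gauge D i j)).
Proof.
move=> /(_ i j)[d1 d2]; have ImE M : complex.Im (gauge M i j) =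
    if p i == p j then complex.Im (M i j)
    else if p i then - complex.Re (M i j) else complex.Re (M i j).
  rewrite /gauge /th; case: (M i j) => r s.
  by case: (p i); case: (p j); rewrite ?conjc1 ?mul1r ?mulr1; simpc.
rewrite (_ : (fun s => _) = (fun s => if p i == p j then complex.Im (X s i j)
    else if p i then - complex.Re (X s i j) else complex.Re (X s i j))); last first.
  by apply/funext => s; rewrite ImE.
rewrite ImE; case: eqP => // _; case: (p i) => //.
exact: is_deriveN.
Qed.

Local Lemma gauge_continuous (X : R -> 'M[C]_n) a b i j : mx_continuous_on X a b ->
  {within `[a, b], continuous (fun s => complex.Im (gauge (X s) i j))}.
Proof.
move=> /(_ i j)[c1 c2].
rewrite (_ : (fun s => _) = (fun s => if p i == p j then complex.Im (X s i j)
    else if p i then - complex.Re (X s i j) else complex.Re (X s i j))); last first.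
  apply/funext => s; rewrite /gauge /th; case: (X s i j) => r u.
  by case: (p i); case: (p j); rewrite ?conjc1 ?mul1r ?mulr1; simpc.
case: eqP => // _; case: (p i) => // x; apply: continuousN; exact: c1.
Qed.

(** After the gauge the generator is a real skew-symmetric matrix [r], so each column of imaginary
    parts obeys [q' = r q] and keeps its Euclidean length, which is 0 at the identity. *)
Lemma compatible_solution m (B0 : 'M[C]_n) (Bs : 'I_m -> 'M[C]_n) u (T : R) (X : R -> 'M[C]_n) :
  in_su B0 -> (forall l, in_su (Bs l)) -> compatible B0 -> (forall l, compatible (Bs l)) ->
  0 <= T -> is_solution B0 Bs u T X -> compatible (X T).
Proof.
move=> B0su Bssu cB0 cBs T0 [X0 [cX [bad dX]]].
pose q i j (s : R) := complex.Im (gauge (X s) i j).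
pose F : R -> R := \sum_(i < n) \sum_(j < n) (q i j) ^+ 2.
have FE t : F t = \sum_i \sum_j q i j t ^+ 2.
  by rewrite /F fct_sumE; apply: eq_bigr => i _; rewrite fct_sumE.
have FT : F T = F 0.
  apply: (piecewise_constant (bad := bad) T0).
    apply: within_continuous_sum => i; apply: within_continuous_sum => j.
    have cq : {within `[0, T], continuous (q i j)} := gauge_continuous cX.
    by move=> x; rewrite expr2; apply: (@continuousM _ (subspace `[0, T])); exact: cq.
  move=> t tT tbad; have {}dX := dX t tT tbad.
  set N := B0 + _ in dX.
  have [Ns _] : in_su N := drift_control_su B0su Bssu (fun l => u l t).
  have cN i j : complex.Im (gauge N i j) = 0.
    apply/eqP; rewrite -gauge_off; apply/eqP.
    rewrite /off_part /N !mxE summxE; have := cB0 i j; rewrite /off_part.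
    have H (f : C -> R) : (forall x y, f (x + y) = f x + f y) ->
        (forall (a : R) x, f (a%:C%C * x) = a * f x) -> f (B0 i j) = 0 ->
        (forall l, f (Bs l i j) = 0) ->
        f (B0 i j + \sum_(k < m) ((u k t)%:C%C *: Bs k) i j) = 0.
      move=> fD fZ f0 fk; rewrite fD f0 add0r (big_morph f (id1 := 0) fD); last first.
        by have := fZ 0 0; rewrite mulr0 mul0r.
      by apply: big1 => k _; rewrite mxE fZ fk mulr0.
    case: ifP => pij h0.
      apply: (H (@complex.Im R)) => // [[? ?] [] //|a [? ?]|l] /=.
        by rewrite mul0r addr0.
      by have := cBs l i j; rewrite /off_part pij.
    apply: (H (@complex.Re R)) => // [[? ?] [] //|a [? ?]|l] /=.
      by rewrite mul0r subr0.
    by have := cBs l i j; rewrite /off_part pij.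
  pose r i k := complex.Re (gauge N i k).
  have dq i j : is_derive t 1 (q i j) (\sum_k r i k * q k j t).
    suff <- : complex.Im (gauge (N *m X t) i j) = \sum_k r i k * q k j t.
      exact: gauge_deriv dX.
    rewrite gauge_mul.
    rewrite (big_morph (@complex.Im R) (id1 := 0) (op1 := +%R)) //; last by case=> ? ? [].
    apply: eq_bigr => k _; rewrite /r /q; have := cN i k.
    by case: (gauge N i k) (gauge (X t) k j) => [a b] [a' b'] /= ->; rewrite mul0r addr0.
  have dF : is_derive t 1 F (\sum_i \sum_j (2%:R * q i j t ^+ 1) *: (\sum_k r i k * q k j t)).
    apply: is_derive_sum => i; apply: is_derive_sum => j; exact: is_deriveX.
  apply: (@is_derive_eq _ _ _ _ _ _ _ _ dF).
  have -> : \sum_i \sum_j (2%:R * q i j t ^+ 1) *: (\sum_k r i k * q k j t)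
      = \sum_j \sum_i \sum_k 2 * (q i j t * r i k * q k j t).
    rewrite exchange_big /=; apply: eq_bigr => j _; apply: eq_bigr => i _.
    rewrite /GRing.scale /= mulr_sumr; apply: eq_bigr => k _.
    by rewrite expr1; ring.
  apply: big1 => j _; set s := (LHS).
  (* Exchanging the summation indices [i] and [k] changes the sign, by skew-symmetry of [r]. *)
  suff : s = - s by move=> /eqP; rewrite -addr_eq0 -mulr2n mulrn_eq0 => /eqP.
  rewrite {1}/s exchange_big /= -sumrN; apply: eq_bigr => i _.
  rewrite -sumrN; apply: eq_bigr => k _; rewrite /r (@gauge_skew N i k Ns).
  by ring.
have F0 : F 0 = 0.
  rewrite FE; apply: big1 => i _; apply: big1 => j _; rewrite /q X0.
  have /eqP -> : complex.Im (gauge 1%:M i j) == 0.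
    rewrite -gauge_off /off_part !mxE; case: (eqVneq i j) => [->|_].
      by rewrite eqxx /=.
    by rewrite mulr0n; case: ifP => _ /=.
  by rewrite expr0n.
move=> i j; apply/eqP; rewrite gauge_off -/(q i j T) -sqrf_eq0.
move: FT; rewrite F0 FE => /eqP; rewrite psumr_eq0 => [/allP/(_ i)|k _].
  rewrite mem_index_enum => /(_ isT)/=; rewrite psumr_eq0 => [/allP/(_ j)|k _].
    by rewrite mem_index_enum => /(_ isT).
  exact: sqr_ge0.
by apply: sumr_ge0 => l _; exact: sqr_ge0.
Qed.

Lemma compatible_unreachable m (B0 : 'M[C]_n) (Bs : 'I_m -> 'M[C]_n) : (2 <= n)%N ->
  in_su B0 -> (forall l, in_su (Bs l)) -> compatible B0 -> (forall l, compatible (Bs l)) ->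
  ~ controllable B0 Bs.
Proof.
move=> hn B0su Bssu cB0 cBs ctr.
pose i0 : 'I_n := Ordinal (ltnW hn); pose i1 : 'I_n := Ordinal hn.
(* The entries [i] and [-i] have product 1, which keeps the determinant; on the diagonal [off_part]
   is the imaginary part whatever [p] is, here 1. *)
pose d i : C := if i == i0 then 'i%C else if i == i1 then - 'i%C else 1.
pose Y : 'M[C]_n := diag_mx (\row_i d i).
have YSU : in_SU Y.
  split.
    have -> : mx_adj Y = diag_mx (\row_i (d i)^*%C).
      by apply/matrixP => i j; rewrite !mxE rmorphMn eq_sym; case: eqP => // ->.
    rewrite mulmx_diag; apply/matrixP => i j; rewrite !mxE; congr (_ *+ _).
    rewrite /d; case: ifP => _; first by simpc.
    by case: ifP => _; simpc.
  rewrite det_diag (bigD1 i0) //= (bigD1 i1) //= big1 => [|i /andP[h0 h1]].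
    by rewrite !mxE /d eqxx /=; simpc.
  by rewrite mxE /d (negPf h0) (negPf h1).
have [T [u [X [T0 [_ [sol XT]]]]]] := ctr Y YSU.
have := compatible_solution B0su Bssu cB0 cBs T0 sol i0 i0.
rewrite XT /off_part eqxx !mxE eqxx mulr1n /d eqxx /= => /eqP.
by rewrite oner_eq0.
Qed.

End Necessity.

(** * Graphs and zero patterns *)

Section GraphPotential.
Variable n : nat.
Implicit Types (g : cgraph n) (x y z : 'I_n).

Lemma walk_cat g x w1 y w2 z : walk g x w1 y -> walk g y w2 z -> walk g x (w1 ++ w2) z.
Proof.
elim: w1 x => [x /= -> //|[[c a] b] w1 IH x /= [-> [gab w1y]] w2z].
by split=> //; split=> //; apply: IH.
Qed.

Lemma walk_rev g x w y : (forall c i j, g c i j -> g c j i) -> walk g x w y ->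
  exists2 w', walk g y w' x & num_red w' = num_red w.
Proof.
move=> gsym; elim: w x => [x /= ->|[[c a] b] w IH x /= [-> [gab wy]]].
  by exists [::].
have [w' w'b E] := IH _ wy; exists (w' ++ [:: (c, b, x)]).
  by apply: walk_cat w'b _; split=> //; split=> //; apply: gsym.
by rewrite /num_red count_cat /= addn0 addnC -/(num_red w') E.
Qed.

(** The potential at a node is the Red parity of a chosen walk from [x0]. An edge closes up the
    walks chosen for its endpoints into a cycle, whose even Red count is the required relation. *)
Lemma potential_exists g x0 : (forall c i j, g c i j -> g c j i) ->
  (forall i j, g Green i j -> i = j) -> connected_graph g ->
  ~ has_self_loop g -> ~ has_odd_red_cycle g -> exists p, potential g p.
Proof.
move=> gsym ggreen gconn nloop nodd.
have /choice[W HW] := gconn x0.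
exists (fun i => odd (num_red (W i))) => c i j gij.
have [w' wj Ew] := walk_rev gsym (HW j).
have parity : ~~ odd (num_red (W i ++ (c, i, j) :: w')).
  apply/negP => o; apply: nodd; exists x0, (W i ++ (c, i, j) :: w'); split=> //.
  by apply: walk_cat (HW i) _; split.
move: parity; rewrite /num_red count_cat /= -/(num_red _) -/(num_red w') Ew.
case: c gij => gij.
- by rewrite add0n oddD; case: (odd _); case: (odd _).
- by rewrite !oddD /=; case: (odd _); case: (odd _).
- by case: nloop; exists Green, j; rewrite -{1}(ggreen _ _ gij).
Qed.

End GraphPotential.

(** * Real combinations and zero patterns *)

Section Combinations.
Variables (R : realType) (n : nat).
Local Notation C := R[i].
Implicit Types (M : 'M[C]_n) (gs : seq 'M[C]_n) (l : nat -> R).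

Lemma real_comb_ind (P : 'M[C]_n -> Prop) gs l : P 0 ->
  (forall A B, P A -> P B -> P (A + B)) -> (forall (a : R) A, P A -> P (a%:C%C *: A)) ->
  (forall M, M \in gs -> P M) -> P (real_comb gs l).
Proof.
move=> P0 PD PZ Pgs; apply: (big_ind P) => // k _; apply: PZ; apply: Pgs.
exact: mem_nth.
Qed.

Lemma Sigma_f_mem gs M : M \in gs -> Sigma_f gs M.
Proof.
rewrite -mem_undup => Mgs.
have lt : (index M (undup gs) < size (undup gs))%N by rewrite index_mem.
exists (fun k => (k == index M (undup gs))%:R); rewrite /real_comb.
rewrite (bigD1 (Ordinal lt)) //= eqxx rmorph1 scale1r nth_index //.
rewrite big1 ?addr0 // => k kl; rewrite (_ : (_ == _) = false) ?rmorph0 ?scale0r //.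
by apply: contraNF kl => /eqP E; apply/eqP/val_inj.
Qed.

Lemma Sigma_f0 gs : Sigma_f gs 0.
Proof.
exists (fun=> 0); rewrite /real_comb big1 // => k _.
by rewrite rmorph0 scale0r.
Qed.

Lemma su_add M M' : in_su M -> in_su M' -> in_su (M + M').
Proof.
by move=> [h1 h2] [h3 h4]; split; rewrite ?mx_adjD ?h1 ?h3 ?opprD // raddfD /= h2 h4 addr0.
Qed.

Lemma su_scale (a : R) M : in_su M -> in_su (a%:C%C *: M).
Proof.
by move=> [h1 h2]; split; rewrite ?mx_adjZ ?conjc_real ?h1 ?scalerN // mxtraceZ h2 mulr0.
Qed.

Lemma su0 : in_su (0 : 'M[C]_n).
Proof.
by split; [rewrite /mx_adj map_mx0 trmx0 oppr0|rewrite raddf0].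
Qed.

Variable p : 'I_n -> bool.

Lemma off_partD i j M M' : off_part p i j (M + M') = off_part p i j M + off_part p i j M'.
Proof. by rewrite /off_part mxE; case: ifP; case: (M i j) (M' i j) => ? ? []. Qed.

Lemma off_partZ i j (a : R) M : off_part p i j (a%:C%C *: M) = a * off_part p i j M.
Proof.
by rewrite /off_part mxE; case: ifP; case: (M i j) => ? ? _ /=; rewrite mul0r ?addr0 ?subr0.
Qed.

Lemma off_part0 i j : off_part p i j (0 : 'M[C]_n) = 0.
Proof. by rewrite /off_part mxE; case: ifP. Qed.

Lemma off_part_real_comb i j gs l :
  off_part p i j (real_comb gs l) = \sum_(k < size gs) l k * off_part p i j gs`_k.
Proof.
rewrite /real_comb (big_morph _ (@off_partD i j) (@off_part0 i j)).
by apply: eq_bigr => k _; rewrite off_partZ.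
Qed.

Lemma skew_diag_Im M i : mx_adj M = - M -> M i i <> 0 -> complex.Im (M i i) != 0.
Proof.
move=> /matrixP/(_ i i); rewrite !mxE; case: (M i i) => r s /= [/eqP].
rewrite -addr_eq0 -mulr2n mulrn_eq0 /= => /eqP -> nz.
by apply/eqP => s0; apply: nz; rewrite s0.
Qed.

(** All coefficients must be nonzero. If the all-ones combination has vanishing [off_part], doubling
    the coefficient of [M] adds exactly the nonzero [off_part] of [M]. *)
Lemma Sigma_r_off i j gs M : M \in gs -> off_part p i j M != 0 ->
  exists2 B, Sigma_r gs B & off_part p i j B != 0.
Proof.
rewrite -mem_undup => Mgs nz; set us := undup gs.
have lt : (index M us < size us)%N by rewrite index_mem.
have [E|ne] := eqVneq (off_part p i j (real_comb us (fun=> 1))) 0; last first.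
  exists (real_comb us (fun=> 1)); last exact: ne.
  by exists (fun=> 1); split=> [k _|]; [rewrite oner_eq0|].
pose l k : R := if k == index M us then 2 else 1.
exists (real_comb us l).
  by exists l; split=> [k _|//]; rewrite /l; case: (k == _); rewrite ?oner_eq0 ?pnatr_eq0.
suff -> : off_part p i j (real_comb us l) = off_part p i j M by [].
rewrite -[RHS]add0r -E !off_part_real_comb.
rewrite (bigD1 (Ordinal lt)) //= [in RHS](bigD1 (Ordinal lt)) //= nth_index //.
rewrite {1}/l eqxx mul1r addrAC -mulr2n mulr_natl; congr (_ + _).
apply: eq_bigr => k kl; rewrite /l (_ : (_ == _) = false) //.
by apply: contraNF kl => /eqP E'; apply/eqP/val_inj.
Qed.

End Combinations.

(** * The two implications *)

Section StructuralControllability.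
Variables (R : realType) (n d : nat) (hn : (2 <= n)%N).
Local Notation C := R[i].
Variables (A : 'I_d -> 'M[C]_n) (hA : forall s, in_su (A s)).
Variables (S1 S2 S3 : {set 'I_n * 'I_n}).
Hypotheses (hS1 : forall p, p \in S1 -> (p.1 < p.2)%N)
  (hS2 : forall p, p \in S2 -> (p.1 < p.2)%N)
  (hS3 : forall p, p \in S3 -> (p.1 < p.2)%N)
  (hconn : connected_graph (G_contr S1 S2 S3)).
Local Notation gU := (graph_union (G_drift A) (G_contr S1 S2 S3)).
Local Notation ctrl := (ctrl_mats R S1 S2 S3).
Implicit Types (i j k : 'I_n) (M : 'M[C]_n).

Local Lemma ctrl_mem M : M \in ctrl ->
  [\/ exists i j, (i, j) \in S1 /\ M = Bmx R i j, exists i j, (i, j) \in S2 /\ M = Cmx R i j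
    | exists i j, (i, j) \in S3 /\ M = Dmx R i j].
Proof.
rewrite !mem_cat => /or3P[]/mapP[[i j]]; rewrite mem_enum => ij ->.
- by constructor 1; exists i, j.
- by constructor 2; exists i, j.
- by constructor 3; exists i, j.
Qed.

Local Lemma ctrl_su M : M \in ctrl -> in_su M.
Proof.
have adjE i j : mx_adj (Emx R i j) = Emx R j i.
  by rewrite /mx_adj /Emx map_delta_mx trmx_delta.
have ne i j (ij : (i < j)%N) : (j == i) = false by rewrite eq_sym -val_eqE ltn_eqF.
have trE i j : \tr (Emx R i j) = (i == j)%:R.
  rewrite /Emx /mxtrace (bigD1 i) //= big1 => [|k ki]; first by rewrite mxE eqxx addr0.
  by rewrite mxE (negPf ki).
have adji : ('i : C)^*%C = - 'i%C by simpc.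
move=> /ctrl_mem[] [i [j [ij ->]]]; rewrite /Bmx /Cmx /Dmx.
- split; first by rewrite mx_adjD mx_adjN !adjE opprB.
  by rewrite raddfB /= !trE eq_sym subrr.
- split; first by rewrite mx_adjZ mx_adjD !adjE adji scaleNr addrC.
  by rewrite mxtraceZ raddfD /= !trE eq_sym (ne _ _ (hS2 ij)) addr0 mulr0.
- split; first by rewrite mx_adjZ mx_adjD mx_adjN !adjE adji scaleNr.
  by rewrite mxtraceZ raddfB /= !trE !eqxx subrr mulr0.
Qed.

Local Lemma drift_sym c i j : G_drift A c i j -> G_drift A c j i.
Proof.
case: c => /=.
- by case=> ij [s [E nz]]; split; [exact/nesym|exists s; split; [rewrite E opprK|rewrite E in nz => h; apply: nz; rewrite h oppr0]].
- by case=> ij [s [E nz]]; split; [exact/nesym|exists s; split; rewrite -?E].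
- by case=> -> [s nz]; split=> //; exists s.
Qed.

Local Lemma contr_sym c i j : G_contr S1 S2 S3 c i j -> G_contr S1 S2 S3 c j i.
Proof.
by case: c => /= [[]|[]|[-> [k H]]]; [right|left|right|left|split=> //; exists k].
Qed.

(** An incompatible entry of some [A s] yields a drift edge that violates the potential [p];
    skew-Hermitian symmetry supplies the relation between the entries [(i, j)] and [(j, i)] required
    of an edge. *)
Local Lemma drift_edge p s i j : off_part p i j (A s) != 0 ->
  exists c, G_drift A c i j /\
    match c with Blue => p i != p j | Red => p i == p j | Green => true end.
Proof.
have [As _] := hA s; have sk : A s j i = - (A s i j)^*%C.
  by have /matrixP/(_ j i) := As; rewrite !mxE => ->; rewrite opprK.
have [<- nz|ij] := eqVneq i j.
  exists Green; split=> //; split=> //; exists s => E.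
  by move: nz; rewrite /off_part E eqxx /= eqxx.
rewrite /off_part; case: ifP => pij nz.
  exists Red; split=> //; split; [exact/eqP|exists s].
  split; last exact/eqP.
  by rewrite sk; case: (A s i j) => ? ? /=; rewrite opprK.
exists Blue; split; last by [].
split; [exact/eqP|exists s]; split; last exact/eqP.
by rewrite sk; case: (A s i j) => ? ? /=; rewrite opprK.
Qed.

Lemma necessity : structurally_controllable (Sigma_r [seq A s | s <- enum 'I_d]) (Sigma_f ctrl) ->
  has_self_loop gU \/ has_odd_red_cycle gU.
Proof.
move=> [m [B0 [Bs [_ [[l0 [_ B0E]] [HBs ctr]]]]]]; apply: contrapT => /not_orP[nloop nodd].
have [p pot] : exists p, potential gU p.
  apply: (@potential_exists _ _ (Ordinal (ltnW hn))) => //.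
  - by move=> c i j [/drift_sym|/contr_sym] h; [left|right].
  - by move=> i j [[]|[]].
  - move=> x y; have [w Hw] := hconn x y; exists w.
    elim: w x Hw => [//|[[c a] b] w IH x /= [-> [gab /IH wy]]].
    by split=> //; split=> //; right.
have cZ (a : R) M : compatible p M -> compatible p (a%:C%C *: M).
  by move=> cM i j; rewrite off_partZ cM mulr0.
have cD M M' : compatible p M -> compatible p M' -> compatible p (M + M').
  by move=> cM cM' i j; rewrite off_partD cM cM' addr0.
have c0 : compatible p (0 : 'M[C]_n) by move=> i j; exact: off_part0.
have cA s : compatible p (A s).
  move=> i j; apply/eqP; apply: contrapT => /negP /drift_edge[c [gc]].
  have := pot c i j (or_introl gc).
  by case: c {gc} => [-> |-> |//]; rewrite ?eqxx //; case: (p j).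
have cctrl M : M \in ctrl -> compatible p M.
  move=> /ctrl_mem[] [i [j [ij ->]]] a b.
  - have pij : p i = p j by exact: (pot Blue i j (or_intror (or_introl ij))).
    rewrite /off_part /Bmx !mxE; case: ifP => [_|pab].
      by case: (_ && _); case: (_ && _); rewrite /= ?oppr0 ?addr0 ?subr0.
    case: andP => [[/eqP ai /eqP bj]|_]; first by rewrite ai bj pij eqxx in pab.
    case: andP => [[/eqP ai /eqP bj]|_]; first by rewrite ai bj pij eqxx in pab.
    by rewrite /= subr0.
  - have pij : p i = ~~ p j by exact: (pot Red i j (or_intror (or_introl ij))).
    rewrite /off_part /Cmx !mxE; case: ifP => [pab|_]; last first.
      by case: (_ && _); case: (_ && _); rewrite /= ?addr0 ?mul0r ?mulr0 ?subr0 ?mul1r ?oppr0.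
    case: andP => [[/eqP ai /eqP bj]|_].
      by move: pab; rewrite ai bj pij; case: (p j).
    case: andP => [[/eqP ai /eqP bj]|_].
      by move: pab; rewrite ai bj pij; case: (p j).
    by rewrite /= !(addr0, mulr0, mul0r).
  - by have := pot Green i i (or_intror (conj erefl (ex_intro _ j (or_introl ij)))).
have undupP (P : 'M[C]_n -> Prop) gs : (forall M, M \in gs -> P M) -> forall M, M \in undup gs -> P M.
  by move=> H M; rewrite mem_undup; exact: H.
have AP (P : 'M[C]_n -> Prop) : (forall s, P (A s)) -> forall M, M \in [seq A s | s <- enum 'I_d] -> P M.
  by move=> H M /mapP[s _ ->].
apply: (compatible_unreachable (p := p) hn) ctr.
- by rewrite B0E; apply: real_comb_ind; [exact: su0|exact: su_add|exact: su_scale|apply: undupP; exact: AP].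
- move=> k; have [l ->] := HBs k.
  by apply: real_comb_ind; [exact: su0|exact: su_add|exact: su_scale|apply: undupP; exact: ctrl_su].
- by rewrite B0E; apply: real_comb_ind; [exact: c0|exact: cD|exact: cZ|apply: undupP; exact: AP].
- move=> k; have [l ->] := HBs k.
  by apply: real_comb_ind; [exact: c0|exact: cD|exact: cZ|apply: undupP; exact: cctrl].
Qed.

(** If the control graph has no potential, any admissible drift will do. Otherwise some [A s] is
    incompatible with a potential [p0], for else [p0] would be a potential of the union and exclude
    both loops and odd Red cycles. *)
Local Lemma drift_choice : has_self_loop gU \/ has_odd_red_cycle gU ->
  exists2 B0, Sigma_r [seq A s | s <- enum 'I_d] B0 &
    forall p, potential (G_contr S1 S2 S3) p -> exists i j, off_part p i j B0 != 0.
Proof.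
move=> H; have [[p0 pot0]|npot] := pselect (exists p, potential (G_contr S1 S2 S3) p); last first.
  exists (real_comb (undup [seq A s | s <- enum 'I_d]) (fun=> 1)).
    by exists (fun=> 1); split=> [k _|]; [rewrite oner_eq0|].
  by move=> p pot; case: npot; exists p.
have [s [i [j nz]]] : exists s i j, off_part p0 i j (A s) != 0.
  apply: contrapT => nA.
  have cA s i j : off_part p0 i j (A s) = 0.
    by apply/eqP; apply: contrapT => /negP nz; apply: nA; exists s, i, j.
  have pot : potential gU p0.
    move=> c i j [|/pot0 //]; case: c => /=.
    - move=> [_ [s [_ nz]]]; have := cA s i j; rewrite /off_part.
      by case: eqP.
    - move=> [_ [s [_ nz]]]; have := cA s i j; rewrite /off_part.
      by case: eqP => // + _; case: (p0 i); case: (p0 j).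
    - move=> [_ [s /(skew_diag_Im (hA s).1)]]; have := cA s i i.
      by rewrite /off_part eqxx => ->; rewrite eqxx.
  case: H => [[c [x gx]]|[x [w [wx o]]]].
    have := pot c x x gx; case: c gx => //= gx; last by case: (p0 x).
    case: gx => [[]//|[]/hS1] /=; by rewrite ltnn.
  by move: o; rewrite (potential_walk pot wx) addbb.
have [|B0 B0r B0nz] := @Sigma_r_off R n p0 i j [seq A s | s <- enum 'I_d] (A s) _ nz.
  by apply: map_f; rewrite mem_enum.
(* Every potential has the same difference between [i] and [j], namely the Red parity of any control
   walk joining them, so the entry found for [p0] is bad for all [p]. *)
exists B0 => // p pot; exists i, j; have [w Hw] := hconn i j.
have := potential_walk pot Hw; rewrite (potential_walk pot0 Hw) => E.
move: B0nz; rewrite /off_part.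
have -> : (p i == p j) = (p0 i == p0 j) by move: E; case: (p i); case: (p j); case: (p0 i); case: (p0 j).
by [].
Qed.

Lemma sufficiency : has_self_loop gU \/ has_odd_red_cycle gU ->
  structurally_controllable (Sigma_r [seq A s | s <- enum 'I_d]) (Sigma_f ctrl).
Proof.
move=> /drift_choice[B0 B0r B0off].
(* The additional index reads the default value 0 of [nth], so at least one control is always
   present. *)
pose m := (size ctrl).+1; pose Bs (k : 'I_m) : 'M[C]_n := ctrl`_k.
have B0su : in_su B0.
  case: B0r => l [_ ->]; apply: real_comb_ind; [exact: su0|exact: su_add|exact: su_scale|].
  by move=> M; rewrite mem_undup => /mapP[s _ ->].
have Bssu (k : 'I_m) : in_su (Bs k).
  rewrite /Bs; case: (ltnP k (size ctrl)) => ks; first by apply: ctrl_su; exact: mem_nth.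
  by rewrite nth_default //; exact: su0.
exists m, B0, Bs; split=> //; split=> //; split.
  move=> k; rewrite /Bs; case: (ltnP k (size ctrl)) => ks.
    by apply: Sigma_f_mem; exact: mem_nth.
  by rewrite nth_default //; exact: Sigma_f0.
move=> Y YSU; apply: flow_product_reachable.
pose N M := exists v, M = drift_control B0 Bs v.
apply: (@SU_semigroup R n (ltnW hn) (flow_product B0 Bs) _ _ _ N) YSU.
- exact: flow_product1.
- exact: flow_product_mul.
- exact: flow_product_SU.
- by move=> _ [v ->]; exact: drift_control_su.
- move=> M U [v ->] HU t t0; rewrite -[U t]mulmx1.
  by apply: flow_productM HU t0 _; exact: flow_product1.
move=> L HL NL.
have LB0 : L B0.
  apply: NL; exists (fun=> 0); rewrite /drift_control big1 ?addr0 // => k _.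
  by rewrite rmorph0 scale0r.
(* Only the sums of drift and controls are generators; subtracting the drift from the one with an
   indicator control isolates [Bs k]. *)
have LBs (k : 'I_m) : L (Bs k).
  have : L (drift_control B0 Bs (fun l => (l == k)%:R)) by apply: NL; eexists.
  move=> /(lieB HL) /(_ LB0); rewrite /drift_control addrC addKr.
  rewrite (bigD1 k) //= eqxx rmorph1 scale1r big1 ?addr0 // => l /negPf ->.
  by rewrite rmorph0 scale0r.
have Lctrl M : M \in ctrl -> L M.
  move=> Mc; have lt : (index M ctrl < m)%N by rewrite ltnS index_size.
  by have := LBs (Ordinal lt); rewrite /Bs /= nth_index.
apply: (control_lie_full hn hS1 hS2 hS3 hconn HL _ _ _ B0su LB0 B0off).
- move=> i j ij; apply: Lctrl; rewrite !mem_cat; apply/or3P; constructor 1.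
  by apply/mapP; exists (i, j); rewrite ?mem_enum.
- move=> i j ij; apply: Lctrl; rewrite !mem_cat; apply/or3P; constructor 2.
  by apply/mapP; exists (i, j); rewrite ?mem_enum.
- move=> i j ij; apply: Lctrl; rewrite !mem_cat; apply/or3P; constructor 3.
  by apply/mapP; exists (i, j); rewrite ?mem_enum.
Qed.

End StructuralControllability.

Theorem theorem4 (R : realType) (n d : nat) (hn : (2 <= n)%N)
    (A : 'I_d -> 'M[R[i]]_n) (hA : forall s, in_su (A s))
    (S1 S2 S3 : {set 'I_n * 'I_n})
    (hS1 : forall p, p \in S1 -> (p.1 < p.2)%N)
    (hS2 : forall p, p \in S2 -> (p.1 < p.2)%N)
    (hS3 : forall p, p \in S3 -> (p.1 < p.2)%N)
    (hconn : connected_graph (G_contr S1 S2 S3)) :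
  structurally_controllable (Sigma_r [seq A s | s <- enum 'I_d])
                            (Sigma_f (ctrl_mats R S1 S2 S3))
  <->
  (has_self_loop (graph_union (G_drift A) (G_contr S1 S2 S3)) \/
   has_odd_red_cycle (graph_union (G_drift A) (G_contr S1 S2 S3))).
Proof.
split; first exact: necessity.
exact: sufficiency.
Qed.
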